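(* Let $d\geq 2$ and let $G\leq \mathrm{Aut}(\mathcal{T}_d)$ be a contracting self-similar group. Then there exists a finitely presented simple group $K$ and an injective group homomorphism $G\to K$.
   Context: For $d\geq 2$, let $X_d=\{0,\ldots,d-1\}$, let $X_d^*$ be the set of finite words over $X_d$ (including the empty word), and let $\mathcal{T}_d$ be the infinite rooted $d$-ary tree whose nodes are the elements of $X_d^*$ (the root is the empty word and the children of $\alpha$ are the words $\alpha x$ with $x\in X_d$). $\mathrm{Aut}(\mathcal{T}_d)$ is the group of rooted tree automorphisms. If $g\in \mathrm{Aut}(\mathcal{T}_d)$ and $\alpha\in X_d^*$, the local action of $g$ at $\alpha$ is the unique automorphism $g|_\alpha\in \mathrm{Aut}(\mathcal{T}_d)$ such that $g(\alpha\cdot\beta)=g(\alpha)\cdot g|_\alpha(\beta)$ for every $\beta\in X_d^*$, where $\cdot$ denotes concatenation. A group $G\leq\mathrm{Aut}(\mathcal{T}_d)$ is self-similar if $g|_\alpha\in G$ for all $g\in G$ and $\alpha\in X_d^*$. A self-similar group $G$ is contracting if there exists a finite set $\mathcal{N}\subseteq G$ such that for every $g\in G$ the set $\{\alpha\in X_d^*\mid g|_\alpha\notin\mathcal{N}\}$ is finite. The group $G$ is not assumed to be finitely generated. *)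

(* Defs.v *)
From HB Require Import structures.
From mathcomp Require Import all_boot.
From mathcomp Require Import boolp classical_sets functions cardinality.

Set Implicit Arguments.
Unset Strict Implicit.
Unset Printing Implicit Defensive.

Local Open Scope classical_set_scope.
Local Open Scope group_scope.

(* Vertices of the rooted d-ary tree are words; the root is [::]. *)
Definition vertex (d : nat) := seq 'I_d.

Definition child d (u v : vertex d) : Prop := exists x : 'I_d, v = rcons u x.

Record tree_aut (d : nat) := TreeAut {
  aut_fun :> vertex d -> vertex d;
  aut_bij : bijective aut_fun;
  aut_root : aut_fun [::] = [::];
  aut_child : forall u v, child (aut_fun u) (aut_fun v) <-> child u v }.

Lemma tree_aut_ext d (g h : tree_aut d) : g =1 h -> g = h.
Proof.
case: g h => [f bf rf cf] [f' bf' rf' cf'] /= /funext eff'.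
by case: _ / eff' in bf' rf' cf' *; congr TreeAut; apply: Prop_irrelevance.
Qed.

HB.instance Definition _ d := gen_eqMixin (tree_aut d).
HB.instance Definition _ d := gen_choiceMixin (tree_aut d).

Section TreeAutGroup.
Variable d : nat.
Implicit Types g h : tree_aut d.

Definition tree_aut_one : tree_aut d :=
  @TreeAut d id (Bijective (fun=> erefl) (fun=> erefl)) erefl
    (fun u v => iff_refl _).

Lemma mul_child g h u v : child ((g \o h) u) ((g \o h) v) <-> child u v.
Proof. by rewrite /= !aut_child. Qed.

Lemma mul_root g h : (g \o h) [::] = [::].
Proof. by rewrite /= !aut_root. Qed.

(* Automorphisms act on the left: (g * h)(u) = g (h u). *)
Definition tree_aut_mul g h : tree_aut d :=
  @TreeAut d (g \o h) (bij_comp (aut_bij g) (aut_bij h))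
    (mul_root g h) (@mul_child g h).

Lemma aut_inv_exists g : exists f, cancel g f /\ cancel f g.
Proof. by have [f gK fK] := aut_bij g; exists f. Qed.

Definition aut_inv g : vertex d -> vertex d := projT1 (cid (aut_inv_exists g)).

Lemma aut_funK g : cancel g (aut_inv g).
Proof. by have [] := projT2 (cid (aut_inv_exists g)). Qed.

Lemma aut_invK g : cancel (aut_inv g) g.
Proof. by have [] := projT2 (cid (aut_inv_exists g)). Qed.

Lemma inv_root g : aut_inv g [::] = [::].
Proof. by rewrite -{1}(aut_root g) aut_funK. Qed.

Lemma inv_child g u v : child (aut_inv g u) (aut_inv g v) <-> child u v.
Proof. by rewrite -(aut_child g) !aut_invK. Qed.

Definition tree_aut_inv g : tree_aut d :=
  @TreeAut d (aut_inv g) (Bijective (aut_invK g) (aut_funK g))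
    (inv_root g) (@inv_child g).

Lemma tree_aut_mulA : associative tree_aut_mul.
Proof. by move=> f g h; apply: tree_aut_ext. Qed.

Lemma tree_aut_mul1 : left_id tree_aut_one tree_aut_mul.
Proof. by move=> g; apply: tree_aut_ext. Qed.

Lemma tree_aut_mulr1 : right_id tree_aut_one tree_aut_mul.
Proof. by move=> g; apply: tree_aut_ext. Qed.

Lemma tree_aut_mulV : left_inverse tree_aut_one tree_aut_inv tree_aut_mul.
Proof. by move=> g; apply: tree_aut_ext => u /=; rewrite aut_funK. Qed.

Lemma tree_aut_mulrV : right_inverse tree_aut_one tree_aut_inv tree_aut_mul.
Proof. by move=> g; apply: tree_aut_ext => u /=; rewrite aut_invK. Qed.

HB.instance Definition _ := isGroup.Build (tree_aut d)
  tree_aut_mulA tree_aut_mul1 tree_aut_mulr1 tree_aut_mulV tree_aut_mulrV.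

Lemma tree_aut_mulE g h (u : vertex d) : (g * h) u = g (h u).
Proof. by []. Qed.

Lemma tree_aut_oneE (u : vertex d) : (1 : tree_aut d) u = u.
Proof. by []. Qed.

Lemma aut_prefix g (a b : vertex d) : exists w, g (a ++ b) = g a ++ w.
Proof.
elim/last_ind: b => [|b x [w gab]]; first by exists [::]; rewrite !cats0.
have [y ->] : child (g (a ++ b)) (g (a ++ rcons b x)).
  by apply/aut_child; exists x; rewrite rcons_cat.
by exists (rcons w y); rewrite gab rcons_cat.
Qed.

(* The local action of g at a; its characterization is local_actionE below. *)
Definition local_fun g (a b : vertex d) : vertex d :=
  drop (size (g a)) (g (a ++ b)).

Lemma local_funE g a b : g (a ++ b) = g a ++ local_fun g a b.
Proof.
by have [w gab] := aut_prefix g a b; rewrite /local_fun gab drop_size_cat.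
Qed.

Lemma child_cat (a u v : vertex d) : child (a ++ u) (a ++ v) <-> child u v.
Proof.
split=> -[x e]; exists x; last by rewrite e rcons_cat.
by move/eqP: e; rewrite rcons_cat eqseq_cat // eqxx => /eqP.
Qed.

Lemma cat_injl (a : vertex d) : injective (cat a).
Proof. by move=> u v /eqP; rewrite eqseq_cat // eqxx => /eqP. Qed.

Lemma local_bij g a : bijective (local_fun g a).
Proof.
pose k := local_fun (tree_aut_inv g) (g a).
have kE w : aut_inv g (g a ++ w) = a ++ k w.
  by rewrite -[in RHS](aut_funK g a) -(local_funE (tree_aut_inv g)).
exists k => u.
- by apply: (@cat_injl a); rewrite -kE -local_funE aut_funK.
- by apply: (@cat_injl (g a)); rewrite -local_funE -kE aut_invK.
Qed.

Lemma local_root g a : local_fun g a [::] = [::].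
Proof. by rewrite /local_fun cats0 drop_size. Qed.

Lemma local_child g a u v :
  child (local_fun g a u) (local_fun g a v) <-> child u v.
Proof. by rewrite -(child_cat (g a)) -!local_funE aut_child child_cat. Qed.

Definition local_action g a : tree_aut d :=
  @TreeAut d (local_fun g a) (local_bij g a)
    (local_root g a) (@local_child g a).

Lemma local_actionE g a b : g (a ++ b) = g a ++ local_action g a b.
Proof. exact: local_funE. Qed.

Lemma local_action_unique g a h :
  (forall b, g (a ++ b) = g a ++ h b) -> h = local_action g a.
Proof.
move=> gE; apply: tree_aut_ext => b; apply: (@cat_injl (g a)).
by rewrite -gE -local_actionE.
Qed.

End TreeAutGroup.

Definition subgroup (T : groupType) (H : set T) : Prop :=
  [/\ H 1, forall x y, H x -> H y -> H (x * y) & forall x, H x -> H x^-1].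

Definition self_similar d (G : set (tree_aut d)) : Prop :=
  forall g a, G g -> G (local_action g a).

Definition contracting d (G : set (tree_aut d)) : Prop :=
  exists N : set (tree_aut d),
    [/\ finite_set N, N `<=` G &
        forall g, G g -> finite_set [set a | ~ N (local_action g a)]].

Definition simple_group (T : groupType) : Prop :=
  (exists x : T, x <> 1) /\
  forall N : set T, subgroup N -> (forall x y : T, N x -> N (x ^ y)) ->
    N = [set 1] \/ N = [set: T].

(* Group words in n generators: (i, false) stands for the i-th generator and
   (i, true) for its inverse. *)
Definition group_word (n : nat) := seq ('I_n * bool).

Definition word_val (T : groupType) n (x : 'I_n -> T) (w : group_word n) : T :=
  \prod_(l <- w) (if l.2 then (x l.1)^-1 else x l.1).

(* Equality of two words in the group presented by n generators and the
   relators rs: the presented group is the set of words modulo this relation. *)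
Inductive presented_eq n (rs : seq (group_word n)) :
    group_word n -> group_word n -> Prop :=
| presented_refl w : presented_eq rs w w
| presented_sym w1 w2 : presented_eq rs w1 w2 -> presented_eq rs w2 w1
| presented_trans w1 w2 w3 :
    presented_eq rs w1 w2 -> presented_eq rs w2 w3 -> presented_eq rs w1 w3
| presented_cancel u v i b :
    presented_eq rs (u ++ [:: (i, b); (i, ~~ b)] ++ v) (u ++ v)
| presented_relator u v r :
    r \in rs -> presented_eq rs (u ++ r ++ v) (u ++ v).

(* Evaluation of words induces an isomorphism from the group presented by
   n generators and the relators rs onto T. *)
Definition finitely_presented (T : groupType) : Prop :=
  exists (n : nat) (rs : seq (group_word n)) (x : 'I_n -> T),
    (forall t : T, exists w, word_val x w = t) /\
    (forall w1 w2, word_val x w1 = word_val x w2 <-> presented_eq rs w1 w2).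

(* Main.v *)
(* The group is embedded into a labelled Thompson group. After doubling the
   alphabet and adding two fixed letters, the tree boundary (restricted to the
   eventually zero sequences) minus the point p = 000... is a disjoint union
   of strands indexed by [nat], and the labelled Thompson group is generated by
   splittings x_i and swaps s_i of strands, copies of the nucleus acting on one
   strand, and an involution t moving p.

   Finite presentation. Conjugation by x_0 shifts indices, so finitely many
   relations imply all the expected ones, as for Thompson's group F. For the
   stabilizer H of p, every element is a quotient of forests with a labelled
   permutation in between, which a forest refinement makes unique; here the
   contraction property trivializes every word in the nucleus representing 1.
   The subgroup E of H fixing a second point satisfies H = E u E s_0 E and
   t E t = E, so that H and H t H exhaust the group, and t moves p: hence the
   presented group acts faithfully.

   Simplicity. Let T be the normal subgroup generated by a 3-cycle of strands.
   Modulo T only the classes [n] of nucleus elements survive; they commute, and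
   [n] = (prod_x [n|_x])^2 because each letter occurs twice. The determinant of
   1 - 2A is odd, so the quotient by T is finite: T is finitely presented
   (Reidemeister-Schreier), and if m is the exponent of the quotient then
   letting g act simultaneously on m strands embeds the original group into T.
   A commutator argument shows that T is simple. *)
Require Import Defs.
From HB Require Import structures.
From mathcomp Require Import all_boot zify.
From mathcomp Require Import ssralg ssrint matrix ssrnum zmodp.
From mathcomp Require Import boolp classical_sets functions cardinality.

Set Implicit Arguments.
Unset Strict Implicit.
Unset Printing Implicit Defensive.

Local Open Scope classical_set_scope.
Local Open Scope group_scope.

(** * Presented groups and finite index *)

(** The nucleus need not generate [G], which may be infinitely generated. By contraction, however,
    every [g] in [G] becomes, after finitely many splittings of its strand, a permutation of strands
    with nucleus labels, so that finitely many generators let one strand carry all of [G]. The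
    obstacle is that the finitely presented group is an abstract one, whose relations between labels
    are only those products of two nucleus elements that stay in the nucleus. Everything rests on
    its acting faithfully on points, after which identities are checked point by point. One of the
    added letters has trivial sections and provides the point [p]: every label fixes [p] and its
    image under [t], so all labels lie in [E]. The other makes [e] odd, so that a splitting creates
    an odd number of new strands and the sign of a permutation of strands dies modulo the 3-cycles.
    Only eventually zero sequences are kept as points: on them the action is transitive, and near
    each of them an element merely translates the strand index. *)

Lemma quotient_group (W : Type) (e : W -> W -> Prop)
    (one : W) (mul : W -> W -> W) (inv : W -> W) :
  (forall x, e x x) -> (forall x y, e x y -> e y x) ->
  (forall x y z, e x y -> e y z -> e x z) ->
  (forall x x' y y', e x x' -> e y y' -> e (mul x y) (mul x' y')) ->
  (forall x x', e x x' -> e (inv x) (inv x')) ->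
  (forall x y z, e (mul x (mul y z)) (mul (mul x y) z)) ->
  (forall x, e (mul one x) x) -> (forall x, e (mul x one) x) ->
  (forall x, e (mul (inv x) x) one) -> (forall x, e (mul x (inv x)) one) ->
  exists (Q : groupType) (f : W -> Q),
    [/\ forall q, exists w, f w = q,
        forall x y, f x = f y <-> e x y,
        f one = 1, {morph f : x y / mul x y >-> x * y}
      & {morph f : x / inv x >-> x^-1}].
Proof.
move=> er es et em ei eA e1l e1r eVl eVr.
(* Elements of the quotient are the equivalence classes themselves, taken as sets, so that
   extensionality turns equivalence into equality. *)
pose T := {A : set W | exists w, A = e w}.
pose cls w : T := exist _ (e w) (ex_intro _ w erefl).
have clsE x y : cls x = cls y <-> e x y.
  split=> [[] E|exy]; first by rewrite E.
  apply: eq_exist => /=; apply/funext => z; apply/propext; split => h.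
  - by apply: et h; apply: es.
  - by apply: et h.
have clsP q : exists w, cls w = q.
  by case: q => A [w AE]; exists w; apply: eq_exist; rewrite AE.
pose repr q := projT1 (cid (clsP q)).
have reprK q : cls (repr q) = q by rewrite /repr; case: (cid _).
have reprE w : e (repr (cls w)) w by apply/clsE; rewrite reprK.
pose mu p q := cls (mul (repr p) (repr q)).
pose iv p := cls (inv (repr p)).
have muE x y : mu (cls x) (cls y) = cls (mul x y).
  by apply/clsE; apply: em; apply: reprE.
have ivE x : iv (cls x) = cls (inv x).
  by apply/clsE; apply: ei; apply: reprE.
pose C : choiceType := HB.pack T (gen_eqMixin T) (gen_choiceMixin T).
have muA : @associative C mu.
  by move=> p q r; rewrite -(reprK p) -(reprK q) -(reprK r) !muE; apply/clsE.
have mu1l : @left_id C C (cls one) mu.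
  by move=> p; rewrite -(reprK p) !muE; apply/clsE.
have mu1r : @right_id C C (cls one) mu.
  by move=> p; rewrite -(reprK p) !muE; apply/clsE.
have muVl : @left_inverse C C C (cls one) iv mu.
  by move=> p; rewrite -(reprK p) ivE muE; apply/clsE.
have muVr : @right_inverse C C C (cls one) iv mu.
  by move=> p; rewrite -(reprK p) ivE muE; apply/clsE.
pose Q : groupType := HB.pack C (isGroup.Build C muA mu1l mu1r muVl muVr).
by exists Q, cls; split.
Qed.

Section Bijections.
Variable P : Type.

Record bij := Bij {
  bij_fun :> P -> P;
  bij_inv : P -> P;
  bij_funK : cancel bij_fun bij_inv;
  bij_invK : cancel bij_inv bij_fun }.

Implicit Types f g : bij.

Lemma bij_ext f g : f =1 g -> f = g.
Proof.
case: f g => [f f' fK f'K] [g g' gK g'K] /= /funext fg.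
case: _ / fg in gK g'K *.
have /funext E : f' =1 g' by move=> u; rewrite -{1}(g'K u) fK.
by case: _ / E in gK g'K *; congr Bij; apply: Prop_irrelevance.
Qed.

HB.instance Definition _ := gen_eqMixin bij.
HB.instance Definition _ := gen_choiceMixin bij.

Definition bij_one : bij := @Bij id id (fun=> erefl) (fun=> erefl).

Definition bij_mul f g : bij :=
  @Bij (f \o g) (bij_inv g \o bij_inv f)
    (can_comp (bij_funK f) (bij_funK g)) (can_comp (bij_invK g) (bij_invK f)).

Definition bij_opp f : bij := Bij (bij_invK f) (bij_funK f).

Lemma bij_mulA : associative bij_mul.
Proof. by move=> f g h; apply: bij_ext. Qed.

Lemma bij_mul1 : left_id bij_one bij_mul.
Proof. by move=> f; apply: bij_ext. Qed.

Lemma bij_mulr1 : right_id bij_one bij_mul.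
Proof. by move=> f; apply: bij_ext. Qed.

Lemma bij_mulV : left_inverse bij_one bij_opp bij_mul.
Proof. by move=> f; apply: bij_ext => u /=; rewrite bij_funK. Qed.

Lemma bij_mulrV : right_inverse bij_one bij_opp bij_mul.
Proof. by move=> f; apply: bij_ext => u /=; rewrite bij_invK. Qed.

HB.instance Definition _ := isGroup.Build bij
  bij_mulA bij_mul1 bij_mulr1 bij_mulV bij_mulrV.

Lemma bijM f g u : (f * g) u = f (g u). Proof. by []. Qed.
Lemma bij1 u : (1 : bij) u = u. Proof. by []. Qed.
Lemma bijVK f u : f^-1 (f u) = u. Proof. exact: bij_funK. Qed.
Lemma bijKV f u : f (f^-1 u) = u. Proof. exact: bij_invK. Qed.

End Bijections.

Section GroupMorphism.
Variables (T B : groupType) (f : T -> B).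
Hypothesis fM : {morph f : x y / x * y}.

Lemma morph1g : f 1 = 1.
Proof. by apply: (@mulgI _ (f 1)); rewrite -fM !mulg1. Qed.

Lemma morphVg x : f x^-1 = (f x)^-1.
Proof. by apply: (@mulgI _ (f x)); rewrite -fM !mulgV morph1g. Qed.

Lemma morph_prodg (I : Type) (r : seq I) (F : I -> T) :
  f (\prod_(i <- r) F i) = \prod_(i <- r) f (F i).
Proof. by elim/big_rec2: _ => [|i ? y _ <-]; rewrite ?morph1g ?fM. Qed.

Lemma morphXg x n : f (x ^+ n) = f x ^+ n.
Proof. by elim: n => [|n IHn]; rewrite ?morph1g // !expgS fM IHn. Qed.

End GroupMorphism.

(** * Words, presentations and their universal property *)

Section Words.
Variables (I : Type).
Implicit Types w : seq (I * bool).

Definition letter_val (T : groupType) (x : I -> T) (l : I * bool) : T :=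
  if l.2 then (x l.1)^-1 else x l.1.

Definition gval (T : groupType) (x : I -> T) w : T :=
  \prod_(l <- w) letter_val x l.

Definition winv w : seq (I * bool) := rev [seq (l.1, ~~ l.2) | l <- w].

Lemma gval_nil (T : groupType) (x : I -> T) : gval x [::] = 1.
Proof. exact: big_nil. Qed.

Lemma gval_cons (T : groupType) (x : I -> T) l w :
  gval x (l :: w) = letter_val x l * gval x w.
Proof. exact: big_cons. Qed.

Lemma gval_cat (T : groupType) (x : I -> T) w1 w2 :
  gval x (w1 ++ w2) = gval x w1 * gval x w2.
Proof. exact: big_cat. Qed.

Lemma letter_valN (T : groupType) (x : I -> T) l :
  letter_val x (l.1, ~~ l.2) = (letter_val x l)^-1.
Proof. by case: l => i [] /=; rewrite /letter_val /= ?invgK. Qed.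

Lemma gval_winv (T : groupType) (x : I -> T) w : gval x (winv w) = (gval x w)^-1.
Proof.
elim: w => [|l w IHw]; first by rewrite gval_nil invg1.
rewrite /winv /= rev_cons -cats1 gval_cat -/(winv w) IHw.
by rewrite !gval_cons gval_nil mulg1 letter_valN invgM.
Qed.

Lemma gval_morph (T B : groupType) (f : T -> B) (x : I -> T) w :
  {morph f : x y / x * y} -> f (gval x w) = gval (f \o x) w.
Proof.
move=> fM; rewrite /gval morph_prodg //; apply: eq_bigr => -[i []] _ //=.
by rewrite /letter_val /= morphVg.
Qed.

Lemma eq_gval (T : groupType) (x y : I -> T) w : x =1 y -> gval x w = gval y w.
Proof. by move=> xy; apply: eq_bigr => l _; rewrite /letter_val xy. Qed.

Lemma winvK : involutive winv.
Proof.
move=> w; rewrite /winv map_rev revK -map_comp -[RHS]map_id.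
by apply: eq_map => -[i b] /=; rewrite negbK.
Qed.

End Words.

Lemma gval_map (I J : Type) (T : groupType) (x : J -> T) (h : I -> J)
    (w : seq (I * bool)) :
  gval x [seq (h l.1, l.2) | l <- w] = gval (x \o h) w.
Proof. by rewrite /gval big_map. Qed.

(** The last clause is a universal property instead of derivability of words: it lets relations be
    checked in an arbitrary target group, without manipulating derivations. *)
Definition presents (T : groupType) (I : finType) (rs : seq (seq (I * bool)))
    (x : I -> T) : Prop :=
  [/\ forall g, exists w, gval x w = g,
      forall r, r \in rs -> gval x r = 1
    & forall (B : groupType) (y : I -> B),
        (forall r, r \in rs -> gval y r = 1) ->
        forall w, gval x w = 1 -> gval y w = 1].

Section PresentedEq.
Variables (n : nat) (rs : seq (group_word n)).
Implicit Types w : group_word n.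

Lemma presented_eq_ctx a b w1 w2 : presented_eq rs w1 w2 ->
  presented_eq rs (a ++ w1 ++ b) (a ++ w2 ++ b).
Proof.
elim=> {w1 w2} [w|w1 w2 _|w1 w2 w3 _ IH1 _|u v i c|u v r rin].
- exact: presented_refl.
- exact: presented_sym.
- exact: presented_trans IH1.
- rewrite -!catA !(catA a u); exact: presented_cancel.
- rewrite -!catA !(catA a u); exact: presented_relator.
Qed.

Lemma presented_eq_winvr w : presented_eq rs (w ++ winv w) [::].
Proof.
elim/last_ind: w => [|w [i b] IHw]; first exact: presented_refl.
rewrite /winv map_rcons rev_rcons -/(winv w) cat_rcons /=.
exact: (presented_trans (presented_cancel rs w (winv w) i b)).
Qed.

Lemma presented_eq_winvl w : presented_eq rs (winv w ++ w) [::].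
Proof. by have := presented_eq_winvr (winv w); rewrite winvK. Qed.

Lemma presented_eq_cat u u' v v' : presented_eq rs u u' ->
  presented_eq rs v v' -> presented_eq rs (u ++ v) (u' ++ v').
Proof.
move=> hu hv; apply: (@presented_trans _ _ _ (u' ++ v)).
  exact: (presented_eq_ctx [::] v hu).
by have := presented_eq_ctx u' [::] hv; rewrite !cats0.
Qed.

Lemma presented_eq_inv u v : presented_eq rs u v ->
  presented_eq rs (winv u) (winv v).
Proof.
move=> uv; apply: (@presented_trans _ _ _ (winv u ++ (v ++ winv v))).
  apply: presented_sym; rewrite -[X in presented_eq rs _ X]cats0.
  apply: presented_eq_cat; [exact: presented_refl | exact: presented_eq_winvr].
rewrite catA -[X in presented_eq rs _ X]cat0s.
apply: presented_eq_cat; last exact: presented_refl.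
apply: presented_trans (presented_eq_winvl u).
apply: presented_eq_cat; [exact: presented_refl | exact: presented_sym].
Qed.

Lemma presented_eq_val (B : groupType) (y : 'I_n -> B) w1 w2 :
  (forall r, r \in rs -> gval y r = 1) ->
  presented_eq rs w1 w2 -> gval y w1 = gval y w2.
Proof.
move=> yrs; elim=> {w1 w2} //.
- by move=> ? ? ? _ -> _ ->.
- move=> u v i b; rewrite catA gval_cat [in RHS]gval_cat gval_cat; congr (_ * _).
  by rewrite !gval_cons gval_nil mulg1 (letter_valN y (i, b)) mulgV mulg1.
- by move=> u v r rin; rewrite !gval_cat (yrs r) // mul1g.
Qed.

Lemma presented_group_ord : exists (L : groupType) (x : 'I_n -> L),
  (forall g, exists w, gval x w = g) /\
  forall w1 w2, gval x w1 = gval x w2 <-> presented_eq rs w1 w2.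
Proof.
have [||||||||||L [f [fs fE f1 fM fV]]] :=
  @quotient_group _ (presented_eq rs) [::] cat (@winv _).
- exact: presented_refl.
- exact: presented_sym.
- by move=> x y z xy; apply: presented_trans.
- by move=> *; apply: presented_eq_cat.
- exact: presented_eq_inv.
- by move=> *; rewrite catA; apply: presented_refl.
- by move=> *; apply: presented_refl.
- by move=> *; rewrite cats0; apply: presented_refl.
- exact: presented_eq_winvl.
- exact: presented_eq_winvr.
pose x i := f [:: (i, false)].
have xE w : gval x w = f w.
  elim: w => [|[i b] w IHw]; first by rewrite gval_nil.
  rewrite gval_cons IHw -cat1s fM; congr (_ * _).
  by case: b; rewrite /letter_val /= // -fV.
exists L, x; split=> [g|w1 w2]; last by rewrite !xE.
by have [w <-] := fs g; exists w; rewrite xE.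
Qed.

End PresentedEq.

Section Presentations.
Variables (I : finType) (rs : seq (seq (I * bool))).

Let rk (w : seq (I * bool)) : group_word #|I| :=
  [seq (enum_rank l.1, l.2) | l <- w].

Let gval_rk (B : groupType) (y : 'I_#|I| -> B) w :
  gval y (rk w) = gval (y \o enum_rank) w.
Proof. exact: gval_map. Qed.

Let gval_rkV (B : groupType) (y : I -> B) w :
  gval (y \o enum_val) (rk w) = gval y w.
Proof. by rewrite gval_rk; apply: eq_gval => i /=; rewrite enum_rankK. Qed.

Let unrk (w : group_word #|I|) : seq (I * bool) :=
  [seq (enum_val l.1, l.2) | l <- w].

Let gval_unrk (B : groupType) (y : I -> B) w :
  gval y (unrk w) = gval (y \o enum_val) w.
Proof. exact: gval_map. Qed.

Lemma presented_group : exists (L : groupType) (x : I -> L), presents rs x.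
Proof.
have [L [x [xs xE]]] := presented_group_ord (map rk rs).
exists L, (x \o enum_rank); split.
- move=> g; have [w <-] := xs g; exists (unrk w); rewrite gval_unrk.
  by apply: eq_gval => i /=; rewrite enum_valK.
- move=> r rin; rewrite -gval_rk -(gval_nil x); apply/xE.
  rewrite -[rk r]cats0; apply: (@presented_relator _ _ [::] [::]).
  exact: map_f.
- move=> B y yrs w; rewrite -gval_rk -(gval_nil x) => /xE.
  move=> /(@presented_eq_val _ _ _ (y \o enum_val)).
  rewrite gval_rkV gval_nil; apply=> _ /mapP[r rin ->].
  by rewrite gval_rkV; apply: yrs.
Qed.

(** Derivability is recovered by testing the universal property on the presented group itself, where
    equality of values is [presented_eq]. *)
Lemma presents_finitely_presented (T : groupType) (x : I -> T) :
  presents rs x -> finitely_presented T.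
Proof.
move=> [xs xrs xU]; exists #|I|, (map rk rs), (x \o enum_val).
split=> [g|w1 w2].
  by have [w <-] := xs g; exists (rk w); apply: gval_rkV.
have xrs' r : r \in map rk rs -> gval (x \o enum_val) r = 1.
  by case/mapP=> r' rin ->; rewrite gval_rkV; apply: xrs.
split=> [E|]; last exact: presented_eq_val.
have [L [y [ys yE]]] := presented_group_ord (map rk rs).
apply/yE/divg1_eq; rewrite -gval_winv -gval_cat.
have -> w : gval y w = gval (y \o enum_rank) (unrk w).
  by rewrite gval_unrk; apply: eq_gval => i /=; rewrite enum_valK.
rewrite (xU _ (y \o enum_rank)) //.
  move=> r rin; rewrite -gval_rk -(gval_nil y); apply/yE.
  rewrite -[rk r]cats0; apply: (@presented_relator _ _ [::] [::]).
  exact: map_f.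
have {}E : gval (x \o enum_val) w1 = gval (x \o enum_val) w2 := E.
by rewrite gval_unrk gval_cat gval_winv E mulgV.
Qed.

Lemma presents_lift (T B : groupType) (x : I -> T) (y : I -> B) :
  presents rs x -> (forall r, r \in rs -> gval y r = 1) ->
  exists2 f : T -> B, {morph f : u v / u * v} & forall i, f (x i) = y i.
Proof.
move=> [xs _ xU] yrs.
pose wd g := projT1 (cid (xs g)).
have wdE g : gval x (wd g) = g by rewrite /wd; case: (cid _).
have E w1 w2 : gval x w1 = gval x w2 -> gval y w1 = gval y w2.
  move=> E; apply/divg1_eq; rewrite -gval_winv -gval_cat; apply: xU => //.
  by rewrite gval_cat gval_winv E mulgV.
exists (gval y \o wd) => [u v|i] /=.
  by rewrite -gval_cat; apply: E; rewrite gval_cat !wdE.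
rewrite -[RHS](_ : gval y [:: (i, false)] = _); last first.
  by rewrite gval_cons gval_nil mulg1.
by apply: E; rewrite wdE gval_cons gval_nil mulg1.
Qed.

End Presentations.

(* Reidemeister-Schreier: the relators rewrite, from every coset, the relators
   of the big group and the chosen words of the coset representatives. The
   words are rewritten semantically, through the action of the big group on
   [J * B] for an arbitrary group [B] satisfying the new relators. *)
Section FiniteIndex.
Variables (L : groupType) (I : finType) (rs : seq (seq (I * bool))) (x : I -> L).
Hypothesis xP : presents rs x.
Variables (K : groupType) (v : K -> L).
Hypothesis vM : {morph v : a b / a * b}.
Hypothesis v_inj : injective v.
Variables (J : finType) (j0 : J) (t : J -> L) (k : L -> J).
Hypothesis t0 : t j0 = 1.
Hypothesis tK : cancel t k.
Hypothesis kE : forall g h, k g = k h <-> exists a, h = g * v a.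

Let ktE g : exists a, g = t (k g) * v a.
Proof. by apply/kE; rewrite tK. Qed.

Let kM g h1 h2 : k h1 = k h2 -> k (g * h1) = k (g * h2).
Proof. by move=> /kE[a ->]; apply/kE; exists a; rewrite mulgA. Qed.

Let z_ex (j : J) (g : L) : exists a, v a = (t (k (g * t j)))^-1 * (g * t j).
Proof. by have [a {2}->] := ktE (g * t j); exists a; rewrite mulKg. Qed.

Let zz (j : J) (g : L) : K := projT1 (cid (z_ex j g)).

Let zzE j g : v (zz j g) = (t (k (g * t j)))^-1 * (g * t j).
Proof. by rewrite /zz; case: (cid _). Qed.

Let z (p : J * I) : K := zz p.1 (x p.2).

Let wd_ex g : exists w, gval x w = g.
Proof. by case: xP => + _ _; apply. Qed.

Let wd g : seq (I * bool) := projT1 (cid (wd_ex g)).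

Let wdE g : gval x (wd g) = g.
Proof. by rewrite /wd; case: (cid _). Qed.

(** An inverse letter is a generator traversed backwards, hence the Schreier generator is attached
    to the coset it leads to. *)
Let tau1 (l : I * bool) (j : J) : (J * I) * bool :=
  if l.2 then ((k ((x l.1)^-1 * t j), l.1), true) else ((j, l.1), false).

Let Fixpoint tau (w : seq (I * bool)) (j : J) : seq ((J * I) * bool) :=
  if w is l :: w' then tau1 l (k (gval x w' * t j)) :: tau w' j else [::].

Let k1 j : k (1 * t j) = j.
Proof. by rewrite mul1g tK. Qed.

Let tau1_val l j : v (letter_val z (tau1 l j)) =
  (t (k (letter_val x l * t j)))^-1 * (letter_val x l * t j).
Proof.
case: l => i []; rewrite /letter_val /= ?zzE //.
rewrite morphVg // zzE /= !invgM invgK.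
have -> : k (x i * t (k ((x i)^-1 * t j))) = j.
  rewrite -[RHS](k1 j) -(mulgV (x i)) -mulgA; apply: kM; exact: tK.
by rewrite ?mulgA.
Qed.

Let tau_val w j : v (gval z (tau w j)) =
  (t (k (gval x w * t j)))^-1 * (gval x w * t j).
Proof.
elim: w => [|l w IHw] /=.
  by rewrite !gval_nil morph1g // k1 mul1g mulVg.
rewrite !gval_cons vM tau1_val IHw -!mulgA mulVKg.
by congr ((t _)^-1 * _); apply: kM; apply: tK.
Qed.

Let rs' : seq (seq ((J * I) * bool)) :=
  [seq tau r j | r <- rs, j <- enum J] ++ [seq tau (wd (t j)) j0 | j <- enum J].

Section Target.
Variables (B : groupType) (y : J * I -> B).
Hypothesis yrs : forall r, r \in rs' -> gval y r = 1.

Let act (i : I) (p : J * B) : J * B := (k (x i * t p.1), y (p.1, i) * p.2).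
Let actV (i : I) (p : J * B) : J * B :=
  let j := k ((x i)^-1 * t p.1) in (j, (y (j, i))^-1 * p.2).

Let actK i : cancel (act i) (actV i).
Proof.
move=> [j b]; rewrite /act /actV /=.
have -> : k ((x i)^-1 * t (k (x i * t j))) = j.
  rewrite -[RHS](k1 j) -(mulVg (x i)) -mulgA; apply: kM; exact: tK.
by rewrite mulKg.
Qed.

Let actVK i : cancel (actV i) (act i).
Proof.
move=> [j b]; rewrite /act /actV /=; congr pair; last by rewrite mulVKg.
rewrite -[RHS](k1 j) -(mulgV (x i)) -mulgA; apply: kM; exact: tK.
Qed.

Let perm i : bij (J * B) := Bij (actK i) (actVK i).

Let perm_val w j b :
  gval perm w (j, b) = (k (gval x w * t j), gval y (tau w j) * b).
Proof.
elim: w => [|l w IHw]; first by rewrite !gval_nil k1 mul1g.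
rewrite !gval_cons bijM IHw /=; case: l => i c.
have kk g : k (g * t (k (gval x w * t j))) = k (g * gval x w * t j).
  by rewrite -mulgA; apply: kM; apply: tK.
rewrite /tau1; case: c => /=; rewrite /letter_val /=; last first.
  by rewrite /act /= kk mulgA.
by rewrite /actV /= kk mulgA.
Qed.

Let perm1 w : gval x w = 1 -> gval perm w = 1.
Proof.
case: xP => _ _ xU; apply: xU => r rin; apply: bij_ext => -[j b].
rewrite perm_val; case: xP => _ -> // _; rewrite k1 yrs ?mul1g //.
rewrite mem_cat; apply/orP; left; apply/allpairsP; exists (r, j).
by rewrite mem_enum.
Qed.

Let expand (l : (J * I) * bool) : seq (I * bool) :=
  let w := winv (wd (t (k (x l.1.2 * t l.1.1)))) ++ (l.1.2, false) :: wd (t l.1.1)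
  in if l.2 then winv w else w.

Let flat (w : seq ((J * I) * bool)) := flatten (map expand w).

(** The relators attached to the coset representatives act here: they make the path from the base
    coset to [j] leave the component in [B] unchanged. *)
Let perm_t j b : gval perm (wd (t j)) (j0, b) = (j, b).
Proof.
rewrite perm_val wdE t0 mulg1 tK yrs ?mul1g // mem_cat; apply/orP; right.
by apply/mapP; exists j; rewrite ?mem_enum.
Qed.

Let perm_expand l b :
  gval perm (expand l) (j0, b) = (j0, letter_val y l * b).
Proof.
have pE j i b' : gval perm (expand ((j, i), false)) (j0, b') = (j0, y (j, i) * b').
  rewrite /expand /= gval_cat gval_cons !bijM perm_t gval_winv.
  have -> : letter_val perm (i, false) (j, b') = (k (x i * t j), y (j, i) * b').
    by [].
  by rewrite -(perm_t (k (x i * t j))) bijVK.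
case: l => -[j i] [] /=; last exact: pE.
have := pE j i ((y (j, i))^-1 * b); rewrite mulVKg => <-.
by rewrite /expand /= gval_winv bijVK.
Qed.

Let perm_flat w b : gval perm (flat w) (j0, b) = (j0, gval y w * b).
Proof.
elim: w b => [|l w IHw] b; first by rewrite /flat /= !gval_nil mul1g.
by rewrite /flat /= gval_cat bijM IHw perm_expand gval_cons mulgA.
Qed.

Let expand_val l : gval x (expand l) = v (letter_val z l).
Proof.
case: l => -[j i] []; rewrite /expand /letter_val /= ?gval_winv ?morphVg //.
  congr _^-1; rewrite gval_cat gval_winv gval_cons !wdE zzE //.
by rewrite gval_cat gval_winv gval_cons !wdE zzE.
Qed.

Let flat_val w : gval x (flat w) = v (gval z w).
Proof.
elim: w => [|l w IHw]; first by rewrite /flat /= !gval_nil morph1g.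
by rewrite /flat /= gval_cat IHw expand_val gval_cons vM.
Qed.

(** A word trivial in [K] expands to a word trivial in [L], which acts trivially on [J * B]; at
    [(j0, 1)] this action records the value of the word in [B]. *)
Lemma finite_index_relations w : gval z w = 1 -> gval y w = 1.
Proof.
move=> zw; have /perm1 : gval x (flat w) = 1 by rewrite flat_val zw morph1g.
move=> /(congr1 (fun p : bij _ => p (j0, 1))); rewrite perm_flat mulg1.
by case.
Qed.

End Target.

Lemma finite_index_presents : presents rs' z.
Proof.
split; last exact: finite_index_relations.
- move=> a; exists (tau (wd (v a)) j0); apply: v_inj; rewrite tau_val wdE t0 mulg1.
  have -> : k (v a) = j0 by rewrite -(tK j0) t0; apply/esym/kE; exists a; rewrite mul1g.
  by rewrite t0 invg1 mul1g.
- move=> r; rewrite mem_cat => /orP[/allpairsP[[r' j] [r'in _ ->]]|/mapP[j _ ->]].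
    apply: v_inj; rewrite tau_val; case: xP => _ -> // _.
    by rewrite k1 mul1g mulVg morph1g.
  by apply: v_inj; rewrite tau_val wdE t0 mulg1 tK mulVg morph1g.
Qed.

Lemma finite_index_finitely_presented : finitely_presented K.
Proof. exact: presents_finitely_presented finite_index_presents. Qed.

End FiniteIndex.

(** * The space of points and the basic bijections *)

(* The alphabet has [deg + 1] letters: those [i < deg], and an implicit letter
   fixed by the whole group with trivial sections. The implicit letter is [0]
   in [subcone], [act'] and [sec'], where the letter [i] becomes [i + 1]. *)
Record automaton := Automaton {
  agroup :> groupType;
  deg : nat;
  act : agroup -> nat -> nat;
  sec : agroup -> nat -> agroup;
  deg_gt4 : 4 < deg;
  deg_odd : odd deg;
  act1 : forall i, act 1 i = i;
  sec1 : forall i, sec 1 i = 1;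
  actM : forall g h i, act (g * h) i = act g (act h i);
  secM : forall g h i, sec (g * h) i = sec g (act h i) * sec h i;
  act_out : forall g i, deg <= i -> act g i = i;
  sec_out : forall g i, deg <= i -> sec g i = 1 }.

Section Points.
Variable M : automaton.
Local Notation e := (deg M).
Implicit Types (g h : M) (i j k : nat) (u v w : seq nat).

Fixpoint app g w : seq nat :=
  if w is i :: w' then act g i :: app (sec g i) w' else [::].

Lemma app1 w : app (1 : M) w = w.
Proof. by elim: w => //= i w IHw; rewrite act1 sec1 IHw. Qed.

Lemma appM g h w : app (g * h) w = app g (app h w).
Proof. by elim: w g h => //= i w IHw g h; rewrite actM secM IHw. Qed.

Lemma actK g : cancel (act g) (act g^-1).
Proof. by move=> i; rewrite -actM mulVg act1. Qed.

Lemma appK g : cancel (app g) (app g^-1).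
Proof. by move=> w; rewrite -appM mulVg app1. Qed.

Lemma appKV g : cancel (app g^-1) (app g).
Proof. by move=> w; rewrite -appM mulgV app1. Qed.

Lemma act_lt g i : i < e -> act g i < e.
Proof.
move=> ie; rewrite ltnNge; apply/negP => h.
by have := actK g i; rewrite act_out // => E; move: h; rewrite E leqNgt ie.
Qed.

(* The list [j :: w], on the strand [j = k * deg + i] with [i < deg], encodes the
   sequence [0^k (i + 1)] followed by [w], and [::] is the zero sequence, the
   point at infinity. *)
Definition shift w : seq nat := if w is i :: w' then (i + e)%N :: w' else [::].

Definition subcone y w : seq nat := if y is k.+1 then k :: w else shift w.

Definition act' g y : nat := if y is k.+1 then (act g k).+1 else 0.

Definition sec' g y : M := if y is k.+1 then sec g k else 1.

Lemma app_subcone g y w : app g (subcone y w) = subcone (act' g y) (app (sec' g y) w).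
Proof.
case: y => [|y] //=; rewrite app1; case: w => //= i w.
by rewrite act_out ?sec_out ?app1 // leq_addl.
Qed.

Lemma act'_lt g y : y < e.+1 -> act' g y < e.+1.
Proof. by case: y => //= y; rewrite !ltnS; apply: act_lt. Qed.

Lemma act'_out g y : e < y -> act' g y = y.
Proof. by case: y => //= y ey; rewrite act_out. Qed.

Lemma act'M g h y : act' (g * h) y = act' g (act' h y).
Proof. by case: y => //= y; rewrite actM. Qed.

Lemma act'1 y : act' (1 : M) y = y.
Proof. by case: y => //= y; rewrite act1. Qed.

Lemma act'K g : cancel (act' g) (act' g^-1).
Proof. by move=> y; rewrite -act'M mulVg act'1. Qed.

Lemma sec'M g h y : sec' (g * h) y = sec' g (act' h y) * sec' h y.
Proof. by case: y => /= [|y]; rewrite ?secM ?mulg1. Qed.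

(** A caret of a Thompson group as a map of points: the strands [i] to [i + e] become the [e.+1]
    children of strand [i], and the later strands move down by [e] to close the gap. *)
Definition split_fun i u : seq nat :=
  if u is j :: w then
    if j < i then u else if j <= i + e then i :: subcone (j - i) w
    else (j - e)%N :: w
  else [::].

Definition join_fun i u : seq nat :=
  if u is j :: v then
    if j < i then u else if j == i then
      if v is k :: w then if k < e then (i + k.+1)%N :: w else i :: (k - e)%N :: w
      else [:: i]
    else (j + e)%N :: v
  else [::].

Lemma split_funK i : cancel (split_fun i) (join_fun i).
Proof.
case=> //= j w; case: ltnP => ji; first by rewrite /= ji.
case: leqP => jie /=; last first.
  by rewrite ifN ?ifN; [congr (_ :: _); lia | lia | lia].
rewrite ltnn eqxx; case E: (j - i)%N => [|k] /=.
  have -> : j = i by lia.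
  case: w => //= k w; rewrite ifN; last lia.
  by congr [:: _, _ & _]; lia.
by rewrite ifT; [congr (_ :: _); lia | lia].
Qed.

Lemma join_funK i : cancel (join_fun i) (split_fun i).
Proof.
case=> //= j w; case: ltnP => ji; first by rewrite /= ji.
case: eqP => [->|ne] /=; last first.
  by rewrite ifN ?ifN; [congr (_ :: _); lia | lia | lia].
case: w => [|k w] /=; first by rewrite ltnn leq_addr subnn.
case: ltnP => ke /=; last first.
  by rewrite ltnn leq_addr subnn /=; congr [:: _, _ & _]; lia.
rewrite ifN; last lia.
by rewrite ifT ?addKn //; lia.
Qed.

Definition xb i : bij (seq nat) := Bij (@split_funK i) (@join_funK i).

Definition swp i j : nat := if j == i then i.+1 else if j == i.+1 then i else j.

Lemma swpK i : involutive (swp i).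
Proof. by move=> j; rewrite /swp; do ?case: eqP; lia. Qed.

Definition on_head (f : nat -> nat) u : seq nat :=
  if u is j :: w then f j :: w else [::].

Lemma on_swpK i : involutive (on_head (swp i)).
Proof. by case=> //= j w; rewrite swpK. Qed.

Definition sb i : bij (seq nat) := Bij (@on_swpK i) (@on_swpK i).

Definition label_fun g i u : seq nat :=
  if u is j :: w then j :: (if j == i then app g w else w) else [::].

Lemma label_funK g i : cancel (label_fun g i) (label_fun g^-1 i).
Proof. by case=> //= j w; case: eqP => //; rewrite appK. Qed.

Lemma label_funKV g i : cancel (label_fun g^-1 i) (label_fun g i).
Proof. by case=> //= j w; case: eqP => //; rewrite appKV. Qed.

Definition nb g i : bij (seq nat) := Bij (@label_funK g i) (@label_funKV g i).

Lemma nbM g h i : nb g i * nb h i = nb (g * h) i.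
Proof. by apply: bij_ext => -[|j w] //=; case: eqP => //; rewrite appM. Qed.

(* Exchanges the strand [0] with the cone formed by the strands [>= e] and the
   point at infinity. *)
Definition flip_fun u : seq nat :=
  if u is j :: w then
    if j == 0%N then shift w else if j < e then u else 0%N :: (j - e)%N :: w
  else [:: 0%N].

Lemma flip_funK : involutive flip_fun.
Proof.
have := deg_gt4 M => e4.
case=> [|j w] //=; case: eqP => [->|j0]; last first.
  case: ltnP => je /=; first by rewrite je; case: eqP.
  by congr (_ :: _); lia.
case: w => [|k w] //=; rewrite ifN; last lia.
rewrite ifN; last lia.
by congr [:: _, _ & _]; lia.
Qed.

Definition tb : bij (seq nat) := Bij flip_funK flip_funK.

Definition hswp (l : seq nat) j : nat := foldr swp j l.

Lemma hswp_cat l1 l2 j : hswp (l1 ++ l2) j = hswp l1 (hswp l2 j).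
Proof. exact: foldr_cat. Qed.

Lemma hswp_rev l : cancel (hswp l) (hswp (rev l)).
Proof.
elim: l => // i l IHl j.
by rewrite rev_cons -cats1 hswp_cat /= swpK IHl.
Qed.

Lemma sb_prod l u : (\prod_(i <- l) sb i) u = on_head (hswp l) u.
Proof.
elim: l u => [|i l IHl] u; first by rewrite big_nil; case: u.
by rewrite big_cons bijM IHl; case: u.
Qed.

Lemma hswp_up i k j : hswp (iota i k) j =
  if j < i then j else if j < i + k then j.+1 else if j == (i + k)%N then i else j.
Proof.
elim: k i => [|k IHk] i /=; first by do ?case: ifP; lia.
by rewrite IHk /swp; do ?case: ifP; lia.
Qed.

Lemma hswp_down i k j : hswp (rev (iota i k)) j =
  if j < i then j else if j == i then (i + k)%N else if j <= i + k then j.-1 else j.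
Proof.
apply: (can_inj (hswp_rev (iota i k))); rewrite -{1}(revK (iota i k)) hswp_rev.
by rewrite hswp_up; do ?case: ifP; lia.
Qed.

Lemma hswp_out l m j : all (leq m) l -> j < m -> hswp l j = j.
Proof.
elim: l => //= i l IHl /andP[mi ml] jm; rewrite IHl //.
by rewrite /swp; do ?case: eqP; lia.
Qed.

Lemma hswp_exists m (f f' : nat -> nat) : cancel f f' -> cancel f' f ->
  (forall j, m <= j -> f j = j) ->
  exists2 l, hswp l =1 f & all (fun j => j.+1 < m) l.
Proof.
elim: m f f' => [|m IHm] f f' fK f'K fm.
  by exists [::] => // j; rewrite fm.
pose l := iota (f m) (m - f m).
have fmm : f m <= m.
  rewrite leqNgt; apply/negP => h; have := fm _ h.
  by move=> /(can_inj fK) E; rewrite E ltnn in h.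
have lm : hswp l m = f m by rewrite hswp_up; do ?case: ifP; lia.
have l1 j : m < j -> hswp l j = j by rewrite hswp_up; do ?case: ifP; lia.
have lK := hswp_rev l; have lKV : cancel (hswp (rev l)) (hswp l).
  by move=> j; rewrite -{1}(revK l) hswp_rev.
have [|||l' l'E l'm] := IHm (hswp (rev l) \o f) (f' \o hswp l).
- by move=> j /=; rewrite lKV fK.
- by move=> j /=; rewrite f'K lK.
- move=> j; rewrite leq_eqVlt => /orP[/eqP<-|mj] /=; first by rewrite -lm lK.
  by rewrite fm // -{1}(l1 j) // lK.
exists (l ++ l') => [j|]; first by rewrite hswp_cat l'E /= lKV.
rewrite all_cat (sub_all _ l'm) ?andbT; last by move=> j /=; lia.
by apply/allP => j; rewrite mem_iota; lia.
Qed.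

End Points.

(** * Relations between the basic bijections *)

(** Closure under products is not part of the structure: it is replaced by contraction, in the form
    that products of two elements are [deep] at some uniform level. *)
Record nucleus (M : automaton) := Nucleus {
  nuc :> finType;
  nval : nuc -> M;
  none : nuc;
  nval1 : nval none = 1;
  ninv : nuc -> nuc;
  nvalV : forall n, nval (ninv n) = (nval n)^-1;
  nsec : nuc -> nat -> nuc;
  nval_sec : forall n i, nval (nsec n i) = sec (nval n) i }.

Fixpoint deep (M : automaton) (N : nucleus M) k (g : M) : Prop :=
  if k is k'.+1 then forall i, deep N k' (sec g i) else exists n : N, nval n = g.

Section Relations.
Variables (M : automaton) (N : nucleus M).
Local Notation e := (deg M).
Implicit Types (i j k : nat) (n : N).

(* [None] stands for splittings, [Some None] for adjacent swaps and
   [Some (Some n)] for the element [n] of the nucleus acting on one strand. *)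
Definition gen := option (option N).
Local Notation gx := (None : gen).
Local Notation gs := (Some None : gen).
Local Notation gn n := (Some (Some n) : gen).

Lemma head_word_exists n :
  exists l, hswp l =1 act' (nval n) /\ all (fun j => j.+1 < e.+1) l.
Proof.
have [|||l lE le] := @hswp_exists e.+1 (act' (nval n)) (act' (nval n)^-1).
- exact: act'K.
- by move=> y; rewrite -act'M mulgV act'1.
- exact: act'_out.
by exists l.
Qed.

Definition head_word n : seq nat := projT1 (cid (head_word_exists n)).

Lemma head_wordE n : hswp (head_word n) =1 act' (nval n).
Proof. by rewrite /head_word; case: (cid _) => l []. Qed.

Lemma head_word_lt n : all (fun j => j.+1 < e.+1) (head_word n).
Proof. by rewrite /head_word; case: (cid _) => l []. Qed.

Definition nsec' n y : N := if y is k.+1 then nsec n k else none N.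

Lemma nval_sec' n y : nval (nsec' n y) = sec' (nval n) y.
Proof. by case: y => [|y]; rewrite /= ?nval1 ?nval_sec. Qed.

Section Families.
Variables (B : groupType) (a : gen -> nat -> B) (t : B).
Local Notation x := (a gx).
Local Notation s := (a gs).
Local Notation v n := (a (gn n)).

Definition sprod (l : seq nat) : B := \prod_(i <- l) s i.

(** The cycle sending strand 1 to [2 * e - 1] and each strand from 2 to [2 * e - 1] one down. By
    [rel_tx0] it equals [t * x 0 * t * x 0], the defect by which conjugation by [t] fails to invert
    [x 0]. *)
Definition rho : B := sprod (rev (iota 1 (2 * e - 2))).

(** The fields from [rel_shift] to [rel_vx] describe the stabilizer of infinity. Of the fields with
    [t], [rel_tbraid] governs the passage between double cosets, while [rel_tv], [rel_ts], [rel_tx0]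
    and [rel_tx1] tell how [t] conjugates the elements that also fix the image of infinity under
    [t]. *)
Record relations : Prop := Relations {
  rel_shift : forall c i j, i < j -> a c j * x i = x i * a c (j + e)%N;
  rel_vcomm : forall n c j i, j < i -> v n j * a c i = a c i * v n j;
  rel_scomm : forall c j i, j.+1 < i -> s j * a c i = a c i * s j;
  rel_ss : forall i, s i * s i = 1;
  rel_braid : forall i, s i * s i.+1 * s i = s i.+1 * s i * s i.+1;
  rel_sv : forall n i, s i * v n i = v n i.+1 * s i;
  rel_vv : forall n1 n2 n3 i, nval n1 * nval n2 = nval n3 ->
    v n1 i * v n2 i = v n3 i;
  rel_sx : forall i, s i * x i = x i.+1 * sprod (iota i e.+1);
  rel_vx : forall n i, v n i * x i =
    x i * sprod (map (addn i) (head_word n)) *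
      \prod_(y <- iota 0 e.+1) v (nsec' n y) (i + y)%N;
  rel_tt : t * t = 1;
  rel_tbraid : t * s 0 * t = s 0 * t * s 0;
  rel_tv : forall n, t * v n 1 * t = v n 1;
  rel_ts : t * s 1 * t = s 1;
  rel_tx0 : t * x 0 * t = rho * (x 0)^-1;
  rel_tx1 : t * x 1 * t = x 1 * rho ^+ e * (x 0)^-1 }.

End Families.

Lemma relations_morph (B B' : groupType) (f : B -> B') a t :
  {morph f : u v / u * v} -> relations a t ->
  relations (fun c i => f (a c i)) (f t).
Proof.
move=> fM; have sE l : sprod (fun c i => f (a c i)) l = f (sprod a l).
  by rewrite /sprod morph_prodg.
have rE : rho (fun c i => f (a c i)) = f (rho a) by apply: sE.
case=> h1 h2 h3 h4 h5 h6 h7 h8 h9 h10 h11 h12 h13 h14 h15.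
split=> *; rewrite ?sE ?rE -?morphVg -?morphXg -?fM //.
- by congr f; auto.
- by congr f; auto.
- by congr f; auto.
- by rewrite h4 morph1g.
- by congr f; auto.
- by congr f; auto.
- by congr f; auto.
- by congr f; auto.
- by rewrite h9 !fM morph_prodg.
- by rewrite h10 morph1g.
- by congr f; auto.
- by congr f; auto.
- by congr f; auto.
- by congr f; auto.
- by congr f; auto.
Qed.

Definition ab (c : gen) i : bij (seq nat) :=
  match c with
  | None => xb M i
  | Some None => sb i
  | Some (Some n) => nb (nval n) i
  end.

Lemma sprod_ab l u : sprod ab l u = on_head (hswp l) u.
Proof. exact: sb_prod. Qed.

Lemma hswp_addn i l j : hswp (map (addn i) l) j =
  if j < i then j else (i + hswp l (j - i))%N.
Proof.
elim: l => [|k l IHl] /=; first by case: ltnP; lia.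
by rewrite IHl /swp; do ?case: ifP; lia.
Qed.

Lemma nb_prod (F : nat -> M) i k u :
  (\prod_(y <- iota 0 k) nb (F y) (i + y)%N) u =
  if u is j :: w then
    j :: (if (i <= j) && (j < i + k) then app (F (j - i)%N) w else w)
  else [::].
Proof.
elim: k u => [|k IHk] u.
  by rewrite big_nil bij1; case: u => //= j w; rewrite ifN //; lia.
rewrite -addn1 iotaD big_cat big_seq1 bijM IHk add0n.
case: u => //= j w; case: (eqVneq j (i + k)%N) => [->|ne].
  rewrite ifN ?ifT ?addKn //; lia.
by congr (_ :: _); congr (if _ then _ else _); lia.
Qed.

Lemma xb_lt i j w : j < i -> xb M i (j :: w) = j :: w.
Proof. by rewrite /= => ->. Qed.

Lemma xb_gt i j w : i + e < j -> xb M i (j :: w) = (j - e)%N :: w.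
Proof. by move=> h; rewrite /= ifN ?ifN //; lia. Qed.

Lemma xb_mid i y w : y <= e -> xb M i ((i + y)%N :: w) = i :: subcone M y w.
Proof. by move=> h; rewrite /= ifN ?ifT ?addKn //; lia. Qed.

Lemma xbP i u : [\/ u = [::], exists j w, u = j :: w /\ j < i,
  exists y w, u = (i + y)%N :: w /\ y <= e | exists j w, u = (j + e)%N :: w /\ i < j].
Proof.
case: u => [|j w]; first by constructor 1.
case: (ltnP j i) => ji; first by constructor 2; exists j, w.
case: (leqP j (i + e)) => jie.
  constructor 3; exists (j - i)%N, w; split; last lia.
  by congr (_ :: _); lia.
by constructor 4; exists (j - e)%N, w; split; [congr (_ :: _) |]; lia.
Qed.

Lemma ab_nil c i : ab c i [::] = [::].
Proof. by case: c => [[n|]|]. Qed.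

Lemma ab_lt c i j w : j < i -> ab c i (j :: w) = j :: w.
Proof.
move=> ji; case: c => [[n|]|]; last exact: xb_lt.
- by rewrite /= ifN //; lia.
- by congr (_ :: _); rewrite /swp; do ?case: ifP; lia.
Qed.

Lemma ab_shift c i j : i < j -> ab c j * xb M i = xb M i * ab c (j + e)%N.
Proof.
move=> ij; apply: bij_ext => u; rewrite !bijM.
case: (xbP i u) => [->|[k [w [-> ki]]]|[y [w [-> ye]]]|[k [w [-> ik]]]].
- by rewrite !ab_nil.
- by rewrite (xb_lt _ ki) !ab_lt ?(xb_lt _ ki) //; lia.
- by rewrite xb_mid // !ab_lt ?xb_mid //; lia.
have E m z : i < m -> xb M i ((m + e)%N :: z) = m :: z.
  by move=> h; rewrite xb_gt ?addnK //; lia.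
rewrite E //; case: c => [[n|]|].
- by rewrite -[ab _ (j + e) _]/((k + e)%N :: _) E //= eqn_add2r.
- rewrite -[LHS]/(swp j k :: w) -[ab _ _ _]/(swp (j + e) (k + e) :: w).
  have -> : swp (j + e) (k + e) = (swp j k + e)%N.
    by rewrite /swp; do ?case: ifP; lia.
  by rewrite E // /swp; do ?case: ifP; lia.
- case: (xbP j (k :: w)) => [//|[? [? [[<- _] h]]]|[y [? [[-> _] h]]]|].
  + by rewrite (xb_lt _ h) xb_lt ?ltn_add2r // E.
  + by rewrite xb_mid // addnAC xb_mid // E.
  + move=> [k1 [? [[E1 _] h]]]; rewrite E1 in ik *.
    rewrite xb_gt; last lia.
    rewrite (@xb_gt (j + e)); last lia.
    by rewrite !addnK E //; lia.
Qed.


(** Stated for an arbitrary [g], because it serves both for the relation [rel_vx] and, later, for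
    realizing labels outside the nucleus. *)
Lemma nb_split (g : M) l i : hswp l =1 act' g ->
  nb g i * xb M i = xb M i * sprod ab (map (addn i) l) *
    \prod_(y <- iota 0 e.+1) nb (sec' g y) (i + y)%N.
Proof.
move=> lE; apply: bij_ext => u; rewrite !bijM nb_prod sprod_ab.
have E : hswp [seq i + j | j <- l] =1
    fun j => if j < i then j else (i + act' g (j - i))%N.
  by move=> j; rewrite hswp_addn lE.
case: (xbP i u) => [->|[k [w [-> ki]]]|[y [w [-> ye]]]|[k [w [-> ik]]]] //.
- rewrite ifN; last lia.
  by rewrite /on_head E ki !xb_lt //= ifN //; lia.
- rewrite ifT; last lia.
  rewrite addKn /on_head E ifN; last lia.
  rewrite addKn !xb_mid //; last by rewrite -ltnS act'_lt.
  by rewrite -app_subcone /= eqxx.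
- rewrite ifN; last lia.
  rewrite /on_head E ifN; last lia.
  rewrite act'_out; last lia.
  rewrite subnKC; last lia.
  by rewrite xb_gt ?addnK /=; [rewrite ifN //; lia | lia].
Qed.

Lemma tb_shift w : tb M (shift M w) = 0%N :: w.
Proof. by apply: (can_inj (@flip_funK M)); rewrite [LHS]flip_funK. Qed.

Lemma tb_mid j w : 0 < j -> j < e -> tb M (j :: w) = j :: w.
Proof. by move=> j0 je; rewrite /= je ifN //; lia. Qed.

Lemma tbP u : [\/ exists w, u = 0%N :: w, exists w, u = shift M w
  | exists j w, [/\ u = j :: w, 0 < j & j < e]].
Proof.
case: u => [|[|j] w]; first by constructor 2; exists [::].
  by constructor 1; exists w.
case: (ltnP j.+1 e) => h; first by constructor 3; exists j.+1, w.
by constructor 2; exists ((j.+1 - e)%N :: w) => /=; congr (_ :: _); lia.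
Qed.

Lemma ab_low_shift c i w : c != gx -> i.+1 < e -> ab c i (shift M w) = shift M w.
Proof.
move=> cx ie; case: w => [|j w]; first exact: ab_nil.
case: c cx => [[n|]|] // _ /=.
- by rewrite ifN //; lia.
- by congr (_ :: _); rewrite /swp; do ?case: ifP; lia.
Qed.

Lemma tb_commute c : c != gx -> tb M * ab c 1 * tb M = ab c 1.
Proof.
have e4 := deg_gt4 M; move=> cx; apply: bij_ext => u; rewrite !bijM.
case: (tbP u) => [[w ->]|[w ->]|[j [w [-> j0 je]]]].
- by rewrite -[X in ab _ _ X]/(shift M w) !ab_low_shift ?tb_shift ?ab_lt //; lia.
- by rewrite tb_shift ab_lt ?ab_low_shift //; lia.
- rewrite tb_mid //; case: c cx => [[n|]|] // _; first by rewrite tb_mid.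
  rewrite -[ab _ _ _]/(swp 1 j :: w) tb_mid // /swp; do ?case: ifP; lia.
Qed.

Definition down j : nat := hswp (rev (iota 1 (2 * e - 2))) j.

Lemma down0 : down 0 = 0%N. Proof. by rewrite /down hswp_down. Qed.

Lemma down1 : down 1 = (2 * e - 1)%N.
Proof. by have := deg_gt4 M; rewrite /down hswp_down /=; lia. Qed.

Lemma down_mid j : 1 < j -> j < 2 * e -> down j = j.-1.
Proof. by move=> h1 h2; rewrite /down hswp_down; do ?case: ifP; lia. Qed.

Lemma down_out j : 2 * e <= j -> down j = j.
Proof.
by have := deg_gt4 M; rewrite /down hswp_down => ? ?; do ?case: ifP; lia.
Qed.

Lemma iter_down m j : m <= e -> iter m down j =
  if (j == 0%N) || (2 * e <= j) then j
  else if m < j then (j - m)%N else (j + (2 * e - 1) - m)%N.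
Proof.
have e4 := deg_gt4 M; elim: m => [|m IHm] h.
  by do ?case: ifP; rewrite /= ?subn0; lia.
rewrite iterS IHm; last lia.
case: ifP => h1; first by case/orP: h1 => [/eqP->|/down_out]; rewrite ?down0.
case: (ltnP m j) => h2.
  case: (eqVneq j m.+1) => [->|h3]; first by rewrite subSnn down1 ltnn; lia.
  by rewrite down_mid ?ifT; lia.
by rewrite ifN ?down_mid; lia.
Qed.

Lemma rho_ab u : rho ab u = on_head down u.
Proof. exact: sprod_ab. Qed.

Lemma rhoX_ab m u : (rho ab ^+ m) u = on_head (iter m down) u.
Proof.
elim: m u => [|m IHm] u; first by case: u.
by rewrite expgS bijM IHm rho_ab; case: u.
Qed.

Lemma subconeE y w : 0 < y -> subcone M y w = y.-1 :: w.
Proof. by case: y. Qed.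

Lemma xb_shift2 i w : i < e -> xb M i (shift M (shift M w)) = shift M w.
Proof.
move=> ie; case: w => [|j w]; first by [].
by rewrite [shift M (j :: w)]/= xb_gt ?addnK //; lia.
Qed.

Lemma xb_low_subcone i j w : i < e -> xb M i (i + j :: w) =
  if j <= e then i :: subcone M j w else (i + j - e)%N :: w.
Proof. by move=> ie; case: leqP => h; [rewrite xb_mid | rewrite xb_gt //; lia]. Qed.

Lemma ab_relations : relations ab (tb M).
Proof.
have e4 := deg_gt4 M; split.
- exact: ab_shift.
- move=> n c j i ji; apply: bij_ext => -[|k w]; rewrite !bijM ?ab_nil //.
  case: (ltnP k i) => [ki|ik]; first by rewrite (ab_lt c w ki) -[ab (gn n) j _]/(k :: _) ab_lt.
  rewrite [ab (gn n) j (k :: w)]/= ifN; last lia.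
  suff: exists k' w', j < k' /\ ab c i (k :: w) = k' :: w'.
    by move=> [k' [w' [h ->]]]; rewrite /= ifN //; lia.
  case: c => [[n'|]|]; last 1 first.
  + case: (xbP i (k :: w)) => [//|[k' [? [[<- _] h]]]|[y [? [[-> _] h]]]|].
    * by rewrite xb_lt //; eexists _, _; split; last by []; lia.
    * by rewrite xb_mid //; eexists _, _; split; last by [].
    * move=> [k' [? [[-> _] h]]].
      by rewrite xb_gt; [eexists _, _; split; last by []; lia | lia].
  + by eexists _, _; split; last by []; lia.
  + by eexists _, _; split; last by []; rewrite /swp; do ?case: ifP; lia.
- move=> c j i ji; apply: bij_ext => -[|k w]; rewrite !bijM ?ab_nil //.
  case: (ltnP k i) => [ki|ik].
    by rewrite (ab_lt c w ki) -[ab gs j _]/(swp j k :: w) ab_lt // /swp; do ?case: ifP; lia.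
  have sE z m : j.+1 < m -> ab gs j (m :: z) = m :: z.
    by move=> h; congr (_ :: _); rewrite /swp; do ?case: ifP; lia.
  rewrite (sE _ k); last lia.
  suff: exists k' w', j.+1 < k' /\ ab c i (k :: w) = k' :: w'.
    by move=> [k' [w' [h ->]]]; rewrite sE.
  case: c => [[n'|]|]; last 1 first.
  + case: (xbP i (k :: w)) => [//|[k' [? [[<- _] h]]]|[y [? [[-> _] h]]]|].
    * by rewrite xb_lt //; eexists _, _; split; last by []; lia.
    * by rewrite xb_mid //; eexists _, _; split; last by [].
    * move=> [k' [? [[-> _] h]]].
      by rewrite xb_gt; [eexists _, _; split; last by []; lia | lia].
  + by eexists _, _; split; last by []; lia.
  + by eexists _, _; split; last by []; rewrite /swp; do ?case: ifP; lia.
- by move=> i; apply: bij_ext => u; apply: on_swpK.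
- move=> i; apply: bij_ext => -[|j w] //; rewrite !bijM /=; congr (_ :: _).
  by rewrite /swp; do ?case: ifP; lia.
- move=> n i; apply: bij_ext => -[|j w] //; rewrite !bijM /= /swp.
  case: (eqVneq j i) => h; first by rewrite eqxx.
  case: (eqVneq j i.+1) => h'; last by rewrite (negPf h').
  by rewrite ifN //; lia.
- by move=> n1 n2 n3 i E; rewrite -[LHS]/(nb _ _ * nb _ _) nbM E.
- move=> i; apply: bij_ext => u; rewrite !bijM sprod_ab.
  case: (xbP i u) => [->|[k [w [-> ki]]]|[y [w [-> ye]]]|[k [w [-> ik]]]] //.
  + rewrite /on_head hswp_up ki !ab_lt //; last lia.
  + rewrite xb_mid // /on_head hswp_up ifN ?ifT; [|lia|lia].
    by rewrite -addSn xb_mid // -[LHS]/(swp i i :: _) /swp eqxx.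
  + rewrite xb_gt ?addnK /on_head; last lia.
    rewrite -[LHS]/(swp i k :: w) hswp_up ifN; last lia.
    rewrite ifN; last lia.
    case: eqP => h.
      by rewrite ab_lt // /swp ifN ?ifT //; lia.
    rewrite xb_gt ?addnK; last lia.
    by rewrite /swp ifN ?ifN //; lia.
- move=> n i; rewrite -[LHS]/(nb _ _ * xb M i) (nb_split i (head_wordE n)).
  by congr (_ * _); apply: eq_bigr => y _; rewrite -nval_sec'.
- by apply: bij_ext => u; apply: flip_funK.
- apply: bij_ext => u; rewrite !bijM.
  case: (tbP u) => [[w ->]|[w ->]|[j [w [-> j0 je]]]].
  + rewrite -[X in ab _ _ X]/(shift M w) ab_low_shift ?tb_shift //; last lia.
    by rewrite -[X in tb M X]/(1%N :: w) tb_mid //; lia.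
  + rewrite tb_shift -[X in tb M X]/(1%N :: w) tb_mid //; last lia.
    by rewrite ab_low_shift ?tb_shift //; lia.
  + rewrite tb_mid //; case: (eqVneq j 1%N) => [->|j1].
      rewrite -[X in tb M X]/(0%N :: w).
      by rewrite -[tb M _]/(shift M w) ab_low_shift //; lia.
    have E : ab gs 0 (j :: w) = j :: w.
      by congr (_ :: _); rewrite /swp; do ?case: ifP; lia.
    by rewrite E tb_mid // E.
- by move=> n; apply: tb_commute.
- exact: tb_commute.
(* Cancelling [x 0] on the right leaves only forward maps to evaluate: the identity becomes
   [t * x 0 * t * x 0 = rho]. *)
- apply: (@mulIg _ (ab gx 0)); rewrite -[RHS]mulgA mulVg mulg1.
  apply: bij_ext => u; rewrite !bijM rho_ab.
  have x0 j w : ab gx 0 (j :: w) = if j <= e then 0 :: subcone M j w else (j - e)%N :: w.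
    by rewrite -{1}[j]add0n -[ab gx 0]/(xb M 0) xb_low_subcone //; lia.
  have xs2 w : ab gx 0 (shift M (shift M w)) = shift M w by apply: xb_shift2; lia.
  case: u => [|j w].
    by rewrite -[ab gx 0 [::]]/[::] -[tb M [::]]/[:: 0%N] x0.
  rewrite x0 /on_head; case: leqP => je.
    rewrite -[tb M (_ :: _)]/(shift M _); case: j je => [|k] ke.
      by rewrite down0 xs2 tb_shift.
    rewrite x0; case: (posnP k) => [->|k0].
      rewrite add0n leqnn down1 subconeE; last lia.
      by rewrite -[tb M _]/(shift M _) /=; congr (_ :: _); lia.
    rewrite ifN ?addnK; last lia.
    by rewrite tb_mid ?down_mid //; lia.
  case: (ltnP (j - e) e) => h.
    rewrite tb_mid ?x0 ?ifT //; try lia.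
    rewrite down_mid; [|lia|lia].
    rewrite -[tb M _]/(shift M _) subconeE; last lia.
    by rewrite /=; congr (_ :: _); lia.
  rewrite [tb M (_ :: _)](_ : _ = 0%N :: (j - e - e)%N :: w); last first.
    by rewrite /= ifN ?ifN //; lia.
  rewrite x0 /= down_out; last lia.
  by congr (_ :: _); lia.
- apply: (@mulIg _ (ab gx 0)); rewrite -[RHS]mulgA mulVg mulg1.
  apply: bij_ext => u; rewrite !bijM rhoX_ab.
  have x0 j w : ab gx 0 (j :: w) = if j <= e then 0 :: subcone M j w else (j - e)%N :: w.
    by rewrite -{1}[j]add0n -[ab gx 0]/(xb M 0) xb_low_subcone //; lia.
  have xs2 w : ab gx 1 (shift M (shift M w)) = shift M w by apply: xb_shift2; lia.
  have x1 j w : 0 < j -> ab gx 1 (j :: w) =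
      if j <= e.+1 then 1%N :: subcone M j.-1 w else (j - e)%N :: w.
    case: j => // j _; rewrite -{1}add1n -[ab gx 1]/(xb M 1) xb_low_subcone //; lia.
  case: u => [|j w].
    by rewrite -[ab gx 0 [::]]/[::] -[tb M [::]]/[:: 0%N] -[ab gx 1 _]/[:: 0%N].
  rewrite x0 /on_head iter_down //; case: leqP => je.
    rewrite -[tb M (_ :: _)]/(shift M _); case: j je => [|k] ke.
      by rewrite xs2 tb_shift.
    rewrite ifN; last lia.
    rewrite [shift M _]/= !x1; [|lia|lia].
    case: (ltnP 1 k) => k1.
      rewrite ifN; last lia.
      rewrite tb_mid; [|lia|lia].
      rewrite ifN; last lia.
      by congr (_ :: _); lia.
    rewrite ifT; last lia.
    rewrite tb_mid ?ifT //; try lia.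
    by congr (_ :: subcone _ _ _); lia.
  case: (ltnP (j - e) e) => h.
    rewrite tb_mid ?ifN ?ifT //; try lia.
    by rewrite x1 ?ifT ?tb_mid //; lia.
  rewrite [tb M ((j - e)%N :: w)](_ : _ = 0%N :: (j - e - e)%N :: w); last first.
    by rewrite /= ifN ?ifN //; lia.
  rewrite ifT; last lia.
  rewrite -[ab gx 1 (0%N :: _)]/(0%N :: _) x1; last lia.
  rewrite ifN; last lia.
  by rewrite /=; congr (_ :: _); lia.
Qed.

End Relations.

(** * A group with these relations acts faithfully *)

Section Generated.
Variables (L : groupType).
Implicit Types (S : L -> Prop) (y z : L).

Inductive gen_by S : L -> Prop :=
| gen_one : gen_by S 1
| gen_cons y z : S y -> gen_by S z -> gen_by S (y * z)
| gen_consV y z : S y -> gen_by S z -> gen_by S (y^-1 * z).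

Lemma gen_mul S y z : gen_by S y -> gen_by S z -> gen_by S (y * z).
Proof.
elim=> {y} [|y y' Sy _ IH|y y' Sy _ IH] hz; rewrite ?mul1g -?mulgA //.
  by apply: gen_cons => //; apply: IH.
by apply: gen_consV => //; apply: IH.
Qed.

Lemma gen_in S y : S y -> gen_by S y.
Proof. by move=> Sy; rewrite -[y]mulg1; apply: gen_cons => //; apply: gen_one. Qed.

Lemma gen_inv S y : gen_by S y -> gen_by S y^-1.
Proof.
elim=> {y} [|y y' Sy _ IH|y y' Sy _ IH]; rewrite ?invg1 ?invgM ?invgK.
- exact: gen_one.
- apply: gen_mul IH _; rewrite -[y^-1]mulg1; apply: gen_consV => //.
  exact: gen_one.
- by apply: gen_mul IH _; apply: gen_in.
Qed.

Lemma gen_prod S (I : Type) (r : seq I) (F : I -> L) :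
  (forall i, gen_by S (F i)) -> gen_by S (\prod_(i <- r) F i).
Proof.
move=> h; elim/big_ind: _ => // [|y z]; [exact: gen_one | exact: gen_mul].
Qed.

Lemma gen_sub S S' y : (forall z, S z -> gen_by S' z) ->
  gen_by S y -> gen_by S' y.
Proof.
move=> h; elim=> {y} [|y y' Sy _ IH|y y' Sy _ IH]; first exact: gen_one.
  by apply: gen_mul => //; apply: h.
by apply: gen_mul => //; apply: gen_inv; apply: h.
Qed.

Lemma gen_subgroup S (H : set L) y : subgroup H -> (forall z, S z -> H z) ->
  gen_by S y -> H y.
Proof.
case=> H1 HM HV h; elim=> {y} [|y y' Sy _ IH|y y' Sy _ IH] //.
  by apply: HM => //; apply: h.
by apply: HM => //; apply/HV/h.
Qed.

End Generated.

Section Faithful.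
Variables (M : automaton) (N : nucleus M).
Local Notation e := (deg M).
Local Notation gx := (None : gen N).
Local Notation gs := (Some None : gen N).
Local Notation gn n := (Some (Some n) : gen N).
Variables (L : groupType) (a : gen N -> nat -> L) (t : L).
Hypothesis R : relations a t.
Local Notation x := (a gx).
Local Notation s := (a gs).
Local Notation v n := (a (gn n)).
Local Notation sprod := (sprod a).
Implicit Types (i j k : nat) (n : N) (l : seq nat) (w : seq N).

(** * Permutations of strands *)

Lemma sVE i : (s i)^-1 = s i.
Proof. by apply: mulg1_eq; apply: rel_ss R i. Qed.

Lemma tVE : t^-1 = t.
Proof. by apply: mulg1_eq; apply: rel_tt R. Qed.

Lemma ssK i z : s i * (s i * z) = z.
Proof. by rewrite mulgA (rel_ss R) mul1g. Qed.

Lemma sprod0 : sprod [::] = 1. Proof. exact: big_nil. Qed.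
Lemma sprod1 i : sprod [:: i] = s i. Proof. exact: big_seq1. Qed.
Lemma sprod_cons i l : sprod (i :: l) = s i * sprod l. Proof. exact: big_cons. Qed.
Lemma sprod_cat l1 l2 : sprod (l1 ++ l2) = sprod l1 * sprod l2.
Proof. exact: big_cat. Qed.

Lemma sprod_rev l : sprod (rev l) = (sprod l)^-1.
Proof.
elim: l => [|i l IHl]; first by rewrite /rev sprod0 invg1.
by rewrite rev_cons -cats1 sprod_cat sprod1 IHl sprod_cons invgM sVE.
Qed.

Lemma s_comm_lo i l : all (fun j => j.+1 < i) l -> s i * sprod l = sprod l * s i.
Proof.
elim: l => [|j l IHl] /=; first by rewrite sprod0 mulg1 mul1g.
case/andP=> ji li; rewrite sprod_cons mulgA -(rel_scomm R) // -!mulgA.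
by rewrite IHl.
Qed.

Lemma s_comm_hi i l : all (fun j => i.+1 < j) l -> s i * sprod l = sprod l * s i.
Proof.
elim: l => [|j l IHl] /=; first by rewrite sprod0 mulg1 mul1g.
case/andP=> ji li; rewrite sprod_cons mulgA (rel_scomm R) // -!mulgA.
by rewrite IHl.
Qed.

Lemma iota_split m k j : m <= j -> j < m + k ->
  iota m k = iota m (j - m) ++ j :: iota j.+1 (m + k - j.+1).
Proof.
move=> mj jk; have -> : k = ((j - m) + (m + k - j))%N by lia.
rewrite iotaD subnKC //; congr (_ ++ _).
have -> : (m + (j - m + (m + k - j)) - j.+1 = (m + k - j).-1)%N by lia.
by case E: (m + k - j)%N => //; lia.
Qed.

Lemma cycle_s m k j : m <= j -> j.+1 < m + k ->
  sprod (iota m k) * s j = s j.+1 * sprod (iota m k).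
Proof.
move=> mj jk; rewrite (@iota_split m k j) //; last lia.
rewrite (@iota_split j.+1 (m + k - j.+1) j.+1) //; last lia.
rewrite subnn cat0s !(sprod_cat, sprod_cons) -!mulgA -s_comm_hi; last first.
  by apply/allP => i; rewrite mem_iota; lia.
rewrite (mulgA (s j.+1) (s j)) (mulgA (s j) (_ * _)) (mulgA (s j) (s j.+1)).
rewrite (rel_braid R) -!mulgA (mulgA (sprod _) (s j.+1)) -s_comm_lo ?mulgA //.
by apply/allP => i; rewrite mem_iota; lia.
Qed.

(** The cycles [sprod (iota m k)] represent the cosets of the subgroup generated by the swaps above
    [m]. One more swap on the right lengthens the cycle, shortens it, or passes through it to the
    left. *)
Lemma coset_word m r l : all (fun j => m <= j < m + r) l ->
  exists k l', [/\ all (fun j => m < j < m + r) l', k <= r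
    & sprod l = sprod l' * sprod (iota m k)].
Proof.
elim/last_ind: l => [|l j IHl].
  by exists 0%N, [::]; split=> //; rewrite sprod0 mulg1.
rewrite all_rcons => /andP[/andP[mj jr]] /IHl[k [l' [hl' kr E]]].
have Ej l1 k1 : sprod l' * sprod (iota m k) * s j = sprod l1 * sprod (iota m k1) ->
    sprod (rcons l j) = sprod l1 * sprod (iota m k1).
  by move=> <-; rewrite -cats1 sprod_cat sprod1 E.
case: (ltngtP j (m + k)) => jk; last 1 first.
- exists k.+1, l'; split=> //; first lia.
  by apply: Ej; rewrite -(addn1 k) iotaD sprod_cat -jk sprod1 mulgA.
- case: (ltnP j.+1 (m + k)) => jk'.
    exists k, (rcons l' j.+1); split=> //; first by rewrite all_rcons hl'; lia.
    by apply: Ej; rewrite -mulgA cycle_s // -cats1 sprod_cat sprod1 mulgA.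
  exists k.-1, l'; split=> //; first lia.
  apply: Ej; case: k jk jk' {kr E} => [|k] jk jk'; first lia.
  have -> : j = (m + k)%N by lia.
  by rewrite -(addn1 k) iotaD sprod_cat sprod1 -!mulgA (rel_ss R) mulg1 addn1.
- exists k, (rcons l' j); split=> //; first by rewrite all_rcons hl'; lia.
  apply: Ej; rewrite -cats1 sprod_cat sprod1 -!mulgA; congr (_ * _).
  by rewrite s_comm_lo //; apply/allP => i; rewrite mem_iota; lia.
Qed.

Variable p : L -> bij (seq nat).
Hypothesis pM : {morph p : y z / y * z}.
Hypothesis pa : forall c i, p (a c i) = ab c i.
Hypothesis pt : p t = tb M.

Lemma p1 u : p 1 u = u. Proof. by rewrite (morph1g pM). Qed.

Lemma pK z u : p z^-1 (p z u) = u.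
Proof. by rewrite (morphVg pM) bijVK. Qed.

Lemma pKV z u : p z (p z^-1 u) = u.
Proof. by rewrite (morphVg pM) bijKV. Qed.

Lemma p_sprod l u : p (sprod l) u = on_head (hswp l) u.
Proof.
rewrite -(sprod_ab N l u).
have -> : p (sprod l) = \prod_(i <- l) p (s i) by apply: (morph_prodg pM).
by under eq_bigr do rewrite pa.
Qed.

Lemma eq_hswp l1 l2 : sprod l1 = sprod l2 -> hswp l1 =1 hswp l2.
Proof.
move=> E j; have := p_sprod l1 [:: j]; rewrite E p_sprod /=.
by case.
Qed.

(** This is Coxeter's presentation of the symmetric group. The action on points detects the coset:
    in the normal form [m + k] is sent to [m], so [k] vanishes and the smallest strand can be
    discarded. *)
Lemma sprod_id l : hswp l =1 id -> sprod l = 1.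
Proof.
suff h r m l' : all (fun j => m <= j < m + r) l' -> hswp l' =1 id -> sprod l' = 1.
  apply: (h (\max_(j <- l) j).+1 0%N); apply/allP => j jl /=.
  by rewrite add0n ltnS; apply: (leq_bigmax_seq j).
elim: r m l' => [|r IHr] m l' hl' id_l'.
  by case: l' hl' {id_l'} => [_|j l' /=]; [exact: sprod0 | lia].
have [k [l1 [h1 kr E]]] := coset_word hl'.
have {}id_l' j : hswp (l1 ++ iota m k) j = j.
  by rewrite -[RHS]id_l'; apply: eq_hswp; rewrite sprod_cat E.
have k0 : k = 0%N.
  have l1m : hswp l1 m = m by apply: (@hswp_out l1 m.+1) => //; apply: sub_all h1 => j /=; lia.
  have := id_l' (m + k)%N; rewrite hswp_cat hswp_up ltnNge leq_addr /= ltnn eqxx l1m.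
  by lia.
rewrite E k0 sprod0 mulg1; apply: (IHr m.+1) => [|j].
  by apply: sub_all h1 => j /=; lia.
by rewrite -[RHS]id_l' k0 cats0.
Qed.

Lemma sprod_eq l1 l2 : hswp l1 =1 hswp l2 -> sprod l1 = sprod l2.
Proof.
move=> E; apply: divg1_eq; rewrite -sprod_rev -sprod_cat; apply: sprod_id => j.
by rewrite hswp_cat E -{1}(revK l2) hswp_rev.
Qed.

(** * Labels and the strand group *)

Lemma v_none i : v (none N) i = 1.
Proof.
apply: (@mulgI _ (v (none N) i)); rewrite mulg1.
by apply: rel_vv R _ _ _ _ _; rewrite nval1 mulg1.
Qed.

Lemma vVE n i : (v n i)^-1 = v (ninv n) i.
Proof.
apply: mulg1_eq; rewrite -(v_none i); apply: rel_vv R _ _ _ _ _.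
by rewrite nvalV nval1 mulgV.
Qed.

Lemma sv n i j : s i * v n j = v n (swp i j) * s i.
Proof.
rewrite /swp; case: eqP => [->|ne]; first exact: (rel_sv R).
case: eqP => [->|ne'].
  by rewrite -[RHS](ssK i) (mulgA (s i) (v n i)) (rel_sv R) -mulgA (rel_ss R) mulg1.
have [ji|ij] := ltnP j i; first by rewrite (rel_vcomm R).
by rewrite (rel_scomm R) //; lia.
Qed.

Lemma sprod_v n l j : sprod l * v n j = v n (hswp l j) * sprod l.
Proof.
elim: l => [|i l IHl]; first by rewrite sprod0 mul1g mulg1.
by rewrite sprod_cons -mulgA IHl mulgA sv -mulgA.
Qed.

Lemma v_comm n n' i j : i != j -> commute (v n i) (v n' j).
Proof.
case: ltngtP => // ij _; first exact: (rel_vcomm R n (gn n') ij).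
exact/esym/(rel_vcomm R n' (gn n) ij).
Qed.

Definition vw w i : L := \prod_(n <- w) v n i.

Definition wval w : M := \prod_(n <- w) nval n.

Lemma vw_nil i : vw [::] i = 1. Proof. exact: big_nil. Qed.
Lemma vw_cons n w i : vw (n :: w) i = v n i * vw w i. Proof. exact: big_cons. Qed.
Lemma vw_cat w1 w2 i : vw (w1 ++ w2) i = vw w1 i * vw w2 i.
Proof. exact: big_cat. Qed.

Lemma vw_comm w w' i j : i != j -> commute (vw w i) (vw w' j).
Proof.
move=> ij; apply: commute_prod => n _; apply: commute_sym.
by apply: commute_prod => n' _; apply: commute_sym; apply: v_comm.
Qed.

Lemma s_vw_comm i j w : j != i -> j != i.+1 -> s i * vw w j = vw w j * s i.
Proof.
move=> ne ne'; apply: commute_prod => n _; rewrite /commute sv /swp.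
by rewrite (negPf ne) (negPf ne').
Qed.

Lemma s_vw i w : s i * vw w i = vw w i.+1 * s i.
Proof.
elim: w => [|n w IHw]; first by rewrite !vw_nil mulg1 mul1g.
by rewrite !vw_cons mulgA sv /swp eqxx -mulgA IHw mulgA.
Qed.

Lemma s_vwS i w : s i * vw w i.+1 = vw w i * s i.
Proof. by rewrite -[RHS](ssK i) (mulgA (s i) (vw w i)) s_vw -mulgA (rel_ss R) mulg1. Qed.

(** Labels are kept as words: two words with the same value in [M] are not yet known to agree in
    [L], which is the content of [vw_trivial]. *)
Definition labels m (F : nat -> seq N) : L := \prod_(j <- iota 0 m) vw (F j) j.

Lemma lam0 F : labels 0 F = 1. Proof. exact: big_nil. Qed.

Lemma lamS m F : labels m.+1 F = labels m F * vw (F m) m.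
Proof. by rewrite /labels -addn1 iotaD big_cat big_seq1. Qed.

Lemma eq_lam m F G : (forall j, j < m -> F j = G j) -> labels m F = labels m G.
Proof.
move=> FG; apply: eq_big_seq => j; rewrite mem_iota add0n => /FG ->.
by [].
Qed.

Lemma labels_out m k F : (forall j, m <= j -> F j = [::]) -> m <= k -> labels k F = labels m F.
Proof.
move=> F0 mk; rewrite -(subnKC mk); elim: (k - m)%N => [|r IHr].
  by rewrite addn0.
by rewrite addnS lamS IHr F0 ?leq_addr // vw_nil mulg1.
Qed.

Lemma labels_comm m F w j : m <= j -> labels m F * vw w j = vw w j * labels m F.
Proof.
move=> mj; apply: commute_sym; rewrite /labels big_seq; apply: commute_prod => i.
by rewrite mem_iota => h; apply: vw_comm; lia.
Qed.

Lemma labels_cat m F G : labels m F * labels m G = labels m (fun j => F j ++ G j).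
Proof.
elim: m => [|m IHm]; first by rewrite !lam0 mulg1.
by rewrite !lamS -IHm vw_cat -!mulgA (mulgA (vw _ _) (labels _ _)) -labels_comm // -!mulgA.
Qed.

Lemma labels_nil m : labels m (fun=> [::]) = 1.
Proof. by rewrite (@labels_out 0) ?lam0. Qed.

Lemma labels_delta m n i : i < m -> labels m (fun j => if j == i then [:: n] else [::]) = v n i.
Proof.
move=> im; rewrite (@labels_out i.+1) //; last by move=> j ij; rewrite ifN //; lia.
rewrite lamS eqxx (@eq_lam i _ (fun=> [::])); last first.
  by move=> j ij; rewrite ifN //; lia.
by rewrite labels_nil mul1g vw_cons vw_nil mulg1.
Qed.

Lemma s_lam m F j : j.+1 < m -> s j * labels m F = labels m (F \o swp j) * s j.
Proof.
move=> jm; have split_iota : iota 0 m = iota 0 j ++ [:: j; j.+1] ++ iota j.+2 (m - j.+2).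
  rewrite (@iota_split 0 m j) //; last lia.
  rewrite (@iota_split j.+1 (0 + m - j.+1) j.+1) //; last lia.
  rewrite subn0 subnn /=; congr (_ ++ [:: _, _ & iota _ _]); lia.
rewrite /labels split_iota !big_cat !big_cons !big_nil /= !mulg1.
have far (r : seq nat) G : (forall i, i \in r -> i != j /\ i != j.+1) ->
    s j * \prod_(i <- r) vw (G i) i = \prod_(i <- r) vw (G (swp j i)) i * s j.
  elim: r => [|i r IHr] h; first by rewrite !big_nil mulg1 mul1g.
  have [h1 h2] := h i (mem_head _ _); rewrite !big_cons mulgA s_vw_comm // -mulgA.
  rewrite IHr ?mulgA /swp ?(negPf h1) ?(negPf h2) //.
  by move=> k kr; apply: h; rewrite in_cons kr orbT.
rewrite mulgA far; last by move=> i; rewrite mem_iota; lia.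
rewrite -!mulgA; congr (_ * _).
rewrite (mulgA (s j) (vw _ _)) s_vw -!mulgA (mulgA (s j) (vw _ _)) s_vwS.
rewrite -!mulgA far; last by move=> i; rewrite mem_iota; lia.
rewrite !mulgA; congr (_ * _ * _); rewrite /swp eqxx ifN ?eqxx; last lia.
by apply: vw_comm; lia.
Qed.

Lemma labels_sprod m F l : all (fun j => j.+1 < m) l ->
  labels m F * sprod l = sprod l * labels m (F \o hswp l).
Proof.
elim: l F => [|j l IHl] F /=; first by rewrite sprod0 mulg1 mul1g.
case/andP=> jm lm; rewrite sprod_cons mulgA -[X in labels m X](_ : F \o swp j \o swp j = F).
  by rewrite -s_lam // -!mulgA IHl.
by apply/funext => i /=; rewrite swpK.
Qed.

Definition strand_group z := gen_by (fun y => exists i, y = s i \/ exists n, y = v n i) z.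

Lemma strand_group_s i : strand_group (s i).
Proof. by apply: gen_in; exists i; left. Qed.

Lemma strand_group_v n i : strand_group (v n i).
Proof. by apply: gen_in; exists i; right; exists n. Qed.

Lemma strand_group_sprod l : strand_group (sprod l).
Proof. by apply: gen_prod => i; apply: strand_group_s. Qed.

Lemma strand_group_ind (Q : L -> Prop) : Q 1 ->
  (forall i z, strand_group z -> Q z -> Q (s i * z)) ->
  (forall n i z, strand_group z -> Q z -> Q (v n i * z)) -> forall z, strand_group z -> Q z.
Proof.
move=> Q1 Qs Qv z; elim=> {z} [//|y z|y z]; case=> i [->|[n ->]] hz Qz; auto.
  by rewrite sVE; auto.
by rewrite vVE; auto.
Qed.

Lemma strand_group_form z : strand_group z -> exists l m F, z = sprod l * labels m F.
Proof.
elim/strand_group_ind=> {z} [|i z _ [l [m [F ->]]]|n i z _ [l [m [F ->]]]].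
- by exists [::], 0%N, (fun=> [::]); rewrite sprod0 lam0 mulg1.
- by exists (i :: l), m, F; rewrite sprod_cons mulgA.
have E : v n i * sprod l = sprod l * v n (hswp (rev l) i).
  by rewrite sprod_v -{2}(revK l) hswp_rev.
pose j := hswp (rev l) i; pose F0 k := if k < m then F k else [::].
exists l, (m + j.+1)%N, (fun k => (if k == j then [:: n] else [::]) ++ F0 k).
rewrite -labels_cat labels_delta; last by lia.
rewrite mulgA E -!mulgA; congr (_ * (_ * _)); rewrite (@labels_out m _ F0) //.
- by apply: eq_lam => k; rewrite /F0 => ->.
- by move=> k; rewrite /F0 ltnNge => ->.
- lia.
Qed.

Definition wact w y := act' (wval w) y.

Fixpoint secw w y : seq N :=
  if w is n :: w' then nsec' n (wact w' y) :: secw w' y else [::].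

Lemma wval_nil : wval [::] = 1. Proof. exact: big_nil. Qed.
Lemma wval_cons n w : wval (n :: w) = nval n * wval w. Proof. exact: big_cons. Qed.

Lemma wval_secw w y : wval (secw w y) = sec' (wval w) y.
Proof.
elim: w => [|n w IHw] /=; first by rewrite wval_nil; case: y => //= y; rewrite sec1.
by rewrite !wval_cons IHw nval_sec' sec'M.
Qed.

(** The word carried by each child, [secw], has the length of [w]; the induction in [vw_trivial]
    depends on splitting not lengthening words. *)
Lemma vw_x w i : exists l,
  [/\ hswp l =1 (fun j => if j < i then j else (i + wact w (j - i))%N),
      all (fun j => j.+1 < i + e.+1) l
    & vw w i * x i = x i * sprod l *
        labels (i + e.+1) (fun j => if i <= j then secw w (j - i) else [::])].
Proof.
elim: w => [|n w [l [lE lm E]]].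
  exists [::]; split=> // [j|]; last first.
    rewrite vw_nil mul1g sprod0 mulg1 (@eq_lam _ _ (fun=> [::])) ?labels_nil ?mulg1 //.
    by move=> j _; case: ifP.
  by rewrite /wact wval_nil act'1; case: ltnP => //= h; rewrite subnKC.
exists (map (addn i) (head_word n) ++ l); split=> [j||].
- rewrite hswp_cat lE hswp_addn head_wordE; case: (ltnP j i) => ji; first by rewrite ji.
  by rewrite ltnNge leq_addr /= addKn /wact wval_cons act'M.
- rewrite all_cat lm andbT all_map; apply: sub_all (head_word_lt n) => j /=; lia.
rewrite vw_cons -mulgA E !mulgA (rel_vx R) sprod_cat.
pose G j := if i <= j then [:: nsec' n (j - i)] else [::].
have -> : \prod_(y <- iota 0 e.+1) v (nsec' n y) (i + y) = labels (i + e.+1) G.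
  elim: (e.+1) => [|k IHk].
    rewrite addn0 big_nil (@eq_lam _ _ (fun=> [::])) ?labels_nil // => j ji.
    by rewrite /G leqNgt ji.
  rewrite addnS lamS -IHk -addn1 iotaD big_cat big_seq1 /G leq_addr addKn.
  by rewrite vw_cons vw_nil mulg1.
rewrite -!mulgA (mulgA (labels _ G)) labels_sprod // -!mulgA labels_cat; do 3 congr (_ * _).
apply: eq_lam => j jie /=; rewrite /G lE; case: ltnP => ij; first by rewrite leqNgt ij.
by rewrite leq_addr addKn.
Qed.

Lemma deep1 k : deep N k 1.
Proof. by elim: k => [|k IHk] /=; [exists (none N); rewrite nval1 | move=> i; rewrite sec1]. Qed.

Hypothesis contract : exists k, forall n n' : N, deep N k (nval n * nval n').

Lemma labels_trivial m F : (forall j, j < m -> vw (F j) j = 1) -> labels m F = 1.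
Proof.
elim: m => [|m IHm] h; first exact: lam0.
by rewrite lamS h // IHm ?mulg1 // => j jm; apply: h; lia.
Qed.

(* Deep sections of the product of the first two letters are single elements of
   the nucleus, so refining the strand shortens the word. *)
Lemma vw_trivial w i : wval w = 1 -> vw w i = 1.
Proof.
have [r] : exists r, size w <= r by exists (size w).
elim: r w i => [|r IHr] w i.
  by rewrite leqn0 size_eq0 => /eqP-> _; rewrite vw_nil.
have [K hK] := contract; case: w => [|n1 [|n2 w]] /= sw; first by rewrite vw_nil.
  rewrite wval_cons wval_nil mulg1 vw_cons vw_nil mulg1 => E.
  rewrite -(v_none i) -[LHS]mulg1 -(v_none i); apply: rel_vv R _ _ _ _ _.
  by rewrite E nval1 mulg1.
have {hK} := hK n1 n2; elim: K n1 n2 w sw i => [|K IHK] n1 n2 w sw i.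
  case=> n3 E h; rewrite !vw_cons mulgA (rel_vv R _ (esym E)) -vw_cons IHr //.
  by move: h; rewrite !wval_cons mulgA -E.
move=> /= hK h; have [l [lE _]] := vw_x [:: n1, n2 & w] i.
have -> : sprod l = 1.
  apply: sprod_id => j; rewrite lE /wact h act'1; case: ltnP => //= ij.
  by rewrite subnKC.
rewrite mulg1 labels_trivial => [E|j _].
  by apply: (@mulIg _ (x i)); rewrite E mulg1 mul1g.
case: ifP => [_|_]; last exact: vw_nil.
have size_secw y : size (secw w y) = size w by elim: (w) => //= n w' ->.
apply: IHK => /=; first by rewrite size_secw.
  rewrite !nval_sec' /wact wval_cons act'M -sec'M.
  by case: (act' _ _) => [|k] /=; [apply: deep1 | apply: hK].
rewrite -[LHS]/(wval (secw [:: n1, n2 & w] (j - i))) wval_secw h.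
by case: (j - i)%N => //= k; rewrite sec1.
Qed.

Lemma p_vw w i : p (vw w i) = nb (wval w) i.
Proof.
elim: w => [|n w IHw].
  rewrite vw_nil wval_nil; apply: bij_ext => u; rewrite p1.
  by case: u => //= j u; rewrite app1 if_same.
by rewrite vw_cons wval_cons pM IHw pa -nbM.
Qed.

Lemma p_lam m F u : p (labels m F) u =
  if u is j :: u' then j :: (if j < m then app (wval (F j)) u' else u') else [::].
Proof.
elim: m u => [|m IHm] u; first by rewrite lam0 p1; case: u.
rewrite lamS pM bijM IHm p_vw; case: u => [//|j u] /=; congr (_ :: _).
by rewrite ltnS; case: ltngtP => [||->].
Qed.

Hypothesis faithful : forall g : M, (forall u, app g u = u) -> g = 1.

Lemma strand_group_faithful z : strand_group z -> (forall u, p z u = u) -> z = 1.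
Proof.
case/strand_group_form => l [m [F ->]] h.
have E j u : hswp l j :: (if j < m then app (wval (F j)) u else u) = j :: u.
  by rewrite -[RHS]h pM bijM p_lam p_sprod.
rewrite sprod_id ?mul1g => [|j]; last by case: (E j [::]).
apply: labels_trivial => j jm; apply: vw_trivial; apply: faithful => u.
by case: (E j u); rewrite jm.
Qed.

(** * Forests, fractions and the stabilizer of infinity *)

Definition xw l : L := \prod_(i <- l) x i.

Lemma xw_nil : xw [::] = 1. Proof. exact: big_nil. Qed.
Lemma xw_cat l1 l2 : xw (l1 ++ l2) = xw l1 * xw l2. Proof. exact: big_cat. Qed.
Lemma xw_cons i l : xw (i :: l) = x i * xw l. Proof. exact: big_cons. Qed.

Lemma strand_group_mul y z : strand_group y -> strand_group z -> strand_group (y * z).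
Proof. exact: gen_mul. Qed.

Lemma strand_group_inv z : strand_group z -> strand_group z^-1.
Proof. exact: gen_inv. Qed.

Lemma s_x i j : exists k z, strand_group z /\ s i * x j = x k * z.
Proof.
case: (ltngtP j i) => [ji|ij|->].
- by exists j, (s (i + e)%N); split; [apply: strand_group_s | apply: rel_shift R _ _ _ _].
- case: (ltnP i.+1 j) => ij'.
    by exists j, (s i); split; [apply: strand_group_s | rewrite (rel_scomm R)].
  have -> : j = i.+1 by lia.
  exists i, (sprod (iota i e.+1))^-1; split; first exact/strand_group_inv/strand_group_sprod.
  by apply: (@mulIg _ (sprod (iota i e.+1))); rewrite mulgVK -mulgA -(rel_sx R) ssK.
- exists i.+1, (sprod (iota i e.+1)); split; [exact: strand_group_sprod | exact: rel_sx R _].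
Qed.

Lemma v_x n i j : exists k z, strand_group z /\ v n i * x j = x k * z.
Proof.
case: (ltngtP j i) => [ji|ij|->].
- by exists j, (v n (i + e)%N); split; [apply: strand_group_v | apply: rel_shift R _ _ _ _].
- by exists j, (v n i); split; [apply: strand_group_v | rewrite (rel_vcomm R)].
- exists i; rewrite (rel_vx R) -mulgA; eexists; split; last by [].
  by apply: strand_group_mul; [apply: strand_group_sprod | apply: gen_prod => y; apply: strand_group_v].
Qed.

Lemma strand_group_x z i : strand_group z -> exists k z', strand_group z' /\ z * x i = x k * z'.
Proof.
elim/strand_group_ind => {z} [|j z _ [k [z' [hz' E]]]|n j z _ [k [z' [hz' E]]]].
- by exists i, 1; split; [apply: gen_one | rewrite mulg1 mul1g].
- have [k' [z1 [hz1 E1]]] := s_x j k; exists k', (z1 * z'); split.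
    exact: strand_group_mul.
  by rewrite -mulgA E !mulgA E1.
- have [k' [z1 [hz1 E1]]] := v_x n j k; exists k', (z1 * z'); split.
    exact: strand_group_mul.
  by rewrite -mulgA E !mulgA E1.
Qed.

Lemma strand_group_xw z l : strand_group z -> exists l' z', strand_group z' /\ z * xw l = xw l' * z'.
Proof.
elim: l z => [|i l IHl] z hz.
  by exists [::], z; split=> //; rewrite xw_nil mulg1 mul1g.
have [k [z1 [/IHl[l' [z' [hz' E']]] E]]] := strand_group_x i hz.
by exists (k :: l'), z'; split=> //; rewrite !xw_cons mulgA E -!mulgA E'.
Qed.

(** The Ore condition: two forests have a common right multiple, so inverses of splittings can be
    moved to the right. *)
Lemma ore i l : exists l1 l2, (x i)^-1 * xw l = xw l1 * (xw l2)^-1.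
Proof.
elim: l i => [|k l IHl] i.
  by exists [::], [:: i]; rewrite xw_cons xw_nil mulg1 mul1g mulg1.
case: (ltngtP k i) => ik.
- have [l1 [l2 E]] := IHl (i + e)%N; exists (k :: l1), l2.
  rewrite !xw_cons -mulgA -E !mulgA; congr (_ * _).
  apply: (@mulgI _ (x i)); apply: (@mulIg _ (x (i + e)%N)).
  by rewrite !mulgA mulgV mul1g mulgVK (rel_shift R _ ik).
- have [l1 [l2 E]] := IHl i; exists ((k + e)%N :: l1), l2.
  rewrite !xw_cons -mulgA -E !mulgA; congr (_ * _).
  apply: (@mulgI _ (x i)); apply: (@mulIg _ (x i)).
  by rewrite !mulgA mulgV mul1g mulgVK (rel_shift R _ ik).
- by exists l, [::]; rewrite ik xw_cons mulKg xw_nil invg1 mulg1.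
Qed.

Definition point_group z := gen_by (fun y => exists c i, y = a c i) z.

Lemma point_group_form z : point_group z -> exists l1 y l2, strand_group y /\ z = xw l1 * y * (xw l2)^-1.
Proof.
elim=> {z} [|_ z [c [i ->]] _ [l1 [y [l2 [hy ->]]]]
  |_ z [c [i ->]] _ [l1 [y [l2 [hy ->]]]]].
- exists [::], 1, [::]; split; first exact: gen_one.
  by rewrite !xw_nil invg1 !mulg1.
- case: c => [c|]; last first.
    by exists (i :: l1), y, l2; rewrite xw_cons !mulgA.
  have hc : strand_group (a (Some c) i) by case: c => [n|]; [apply: strand_group_v | apply: strand_group_s].
  have [l' [z' [hz' E]]] := strand_group_xw l1 hc.
  exists l', (z' * y), l2; split; first exact: strand_group_mul.
  by rewrite !mulgA E.
- case: c => [c|].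
    have hc : strand_group (a (Some c) i)^-1.
      by apply: strand_group_inv; case: c => [n|]; [apply: strand_group_v | apply: strand_group_s].
    have [l' [z' [hz' E]]] := strand_group_xw l1 hc.
    exists l', (z' * y), l2; split; first exact: strand_group_mul.
    by rewrite !mulgA E.
  have [l3 [l4 E]] := ore i l1.
  have [l' [z' [hz' E']]] := strand_group_xw l4 (strand_group_inv hy).
  exists l3, (z'^-1), (l2 ++ l'); split; first exact: strand_group_inv.
  have {}E' : (xw l4)^-1 * y = z'^-1 * (xw l')^-1.
    by apply: invg_inj; rewrite !invgM !invgK E'.
  rewrite xw_cat invgM !mulgA E -(mulgA _ (xw l4)^-1) E' !mulgA.
  by [].
Qed.

Definition strand (h : seq nat -> seq nat) :=
  forall j, exists k, forall u, exists u', h (j :: u) = k :: u'.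

Lemma strand_comp h1 h2 : strand h1 -> strand h2 -> strand (h1 \o h2).
Proof.
move=> s1 s2 j; have [k hk] := s2 j; have [k' hk'] := s1 k; exists k' => u /=.
by have [u' ->] := hk u; apply: hk'.
Qed.

Lemma strand_xw l : strand (p (xw l)).
Proof.
elim: l => [|i l IHl]; first by rewrite xw_nil => j; exists j => u; exists u; rewrite p1.
rewrite xw_cons pM pa => j; apply: strand_comp IHl j => j.
case: (xbP M i [:: j]) => [//|[? [? [[<- _] h]]]|[y [? [[-> _] h]]]|].
- by exists j => u; exists u; rewrite [ab _ _ _]xb_lt.
- by exists i => u; eexists; rewrite [ab _ _ _]xb_mid.
- by case=> k [? [[-> _] h]]; exists k => u; exists u; rewrite [ab _ _ _]xb_gt ?addnK //; lia.
Qed.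

Lemma strand_strand_group z : strand_group z -> strand (p z).
Proof.
elim/strand_group_ind => {z} [|i z _ IH|n i z _ IH].
- by move=> j; exists j => u; exists u; rewrite p1.
- rewrite pM pa => j; apply: strand_comp IH j => j.
  by exists (swp i j) => u; exists u.
- rewrite pM pa => j; apply: strand_comp IH j => j.
  by exists j => u; eexists.
Qed.

(** Either the forest subdivides strand [i], and the caret there can be moved to the front, or
    strand [i] is the whole image of a single strand. The size is recorded for the induction in
    [xw_Sset_inj]. *)
Lemma xw_split i l :
  (exists2 l', xw l = x i * xw l' & size l = (size l').+1) \/
  (exists j, forall u, p (xw l) (j :: u) = i :: u).
Proof.
elim: l i => [|k l IHl] i; first by right; exists i => u; rewrite xw_nil p1.
case: (ltngtP k i) => ki; last by left; exists l; rewrite // ki xw_cons.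
- case: (IHl (i + e)%N) => [[l' E sl]|[j hj]].
    left; exists (k :: l'); last by rewrite /= sl.
    by rewrite !xw_cons E !mulgA (rel_shift R _ ki).
  right; exists j => u; rewrite xw_cons pM bijM hj pa [ab _ _ _]xb_gt ?addnK //.
  by lia.
- case: (IHl i) => [[l' E sl]|[j hj]].
    left; exists ((k + e)%N :: l'); last by rewrite /= sl.
    by rewrite !xw_cons E !mulgA (rel_shift R _ ki).
  by right; exists j => u; rewrite xw_cons pM bijM hj pa [ab _ _ _]xb_lt.
Qed.

(** Take the first caret of one side, on strand [i]. If the other forest also subdivides strand [i],
    cancel the caret on both sides. Otherwise the other forest maps one strand onto all of strand
    [i], while the first side maps that strand into a single child of [i], which is impossible. *)
Lemma xw_Sset_inj l1 l2 z : strand_group z -> (forall u, p (xw l1 * z) u = p (xw l2) u) ->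
  xw l1 * z = xw l2.
Proof.
have both0 y : strand_group y -> (forall u, p (xw [::] * y) u = p (xw [::]) u) ->
    xw [::] * y = xw [::].
  rewrite xw_nil mul1g => hy E; apply: strand_group_faithful => // u.
  by rewrite E p1.
have [r] : exists r, size l1 + size l2 <= r by exists (size l1 + size l2)%N.
elim: r l1 l2 z => [|r IHr] l1 l2 z hr hz E.
  move: hr E; rewrite leqn0 addn_eq0 !size_eq0 => /andP[/eqP-> /eqP->].
  exact: both0.
have step m1 m2 y : strand_group y -> size m1 + size m2 <= r.+1 -> m1 <> [::] ->
    (forall u, p (xw m1 * y) u = p (xw m2) u) -> xw m1 * y = xw m2.
  case: m1 => // i m1 hy hm _ E'.
  case: (xw_split i m2) => [[m2' E2 sm2]|[j hj]].
    rewrite E2 xw_cons -mulgA; congr (_ * _); apply: IHr => // [|u].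
      by move: hm; rewrite sm2 /=; lia.
    apply: (can_inj (bij_funK (p (x i)))).
    by have := E' u; rewrite E2 xw_cons -mulgA pM bijM (pM (x i)) bijM.
  have [k hk] := strand_comp (strand_xw m1) (strand_strand_group hy) j.
  have Ek u u' : p (xw m1) (p y (j :: u)) = k :: u' -> xb M i (k :: u') = i :: u.
    by move=> E1; rewrite -hj -E' xw_cons -mulgA !pM !bijM pa E1.
  have hi u : exists2 u', k :: u' = join_fun M i (i :: u) & True.
    have [u' E1] := hk u; exists u' => //; rewrite -(Ek _ _ E1).
    by rewrite split_funK.
  have e4 := deg_gt4 M.
  (* The points [[:: i; 0]] and [[:: i; 1]] come from the strands [i.+1] and [i.+2], which cannot
     both be [k]. *)
  have [u0 k0 _] := hi [:: 0%N]; have [u1 k1 _] := hi [:: 1%N].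
  move: k0 k1; rewrite /= ltnn eqxx !ifT; [|lia|lia].
  by case=> -> _ []; lia.
case: (eqVneq l1 [::]) => [l10|/eqP ?]; last exact: step.
case: (eqVneq l2 [::]) => [l20|/eqP ne]; last first.
  rewrite l10 xw_nil mul1g in E *; apply: (@mulIg _ z^-1); rewrite mulgV -xw_nil.
  apply/esym/step => //; first exact: strand_group_inv.
    by move: hr; rewrite l10 addn0.
  by move=> u; rewrite pM bijM -E pKV xw_nil p1.
by move: E; rewrite l10 l20; apply: both0.
Qed.

Lemma point_group_faithful z : point_group z -> (forall u, p z u = u) -> z = 1.
Proof.
case/point_group_form => l1 [y [l2 [hy ->]]] h; apply: (@mulIg _ (xw l2)).
rewrite mulgVK mul1g; apply: xw_Sset_inj => // u.
by rewrite -[RHS]h (pM (xw l1 * y)) (morphVg pM) [RHS]bijM bijVK.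
Qed.

(** * Elements fixing both infinity and its image [[:: 0]] under [t] *)

Definition pair_gen z := (exists n, z = v n 1) \/ z \in [:: s 1; x 0; x 1; rho a].

Local Notation E := (gen_by pair_gen).

Lemma E_x0 : E (x 0). Proof. by apply: gen_in; right; rewrite !inE eqxx ?orbT. Qed.
Lemma E_x1 : E (x 1). Proof. by apply: gen_in; right; rewrite !inE eqxx ?orbT. Qed.
Lemma E_rho : E (rho a). Proof. by apply: gen_in; right; rewrite !inE eqxx ?orbT. Qed.
Lemma E_s1 : E (s 1). Proof. by apply: gen_in; right; rewrite !inE eqxx ?orbT. Qed.
Lemma E_v1 n : E (v n 1). Proof. by apply: gen_in; left; exists n. Qed.

(** Conjugation by [rho] raises the index of a swap by one within its cycle, which gives all indices
    below [2 * e - 1]; from there on, conjugation by [x 1] raises the index by [e]. *)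
Lemma E_s i : 0 < i -> E (s i).
Proof.
have e4 := deg_gt4 M.
have small k : k.+1 < 2 * e - 1 -> E (s k.+1).
  elim: k => [|k IHk] hk; first exact: E_s1.
  have -> : s k.+2 = (rho a)^-1 * s k.+1 * rho a.
    apply: (@mulgI _ (rho a)); rewrite !mulgA mulgV mul1g.
    rewrite -![s _](sprod1) -!sprod_cat; apply: sprod_eq => j.
    rewrite !hswp_cat -!/(down _ _) /= /swp.
    have d i' := @down_mid M i'; have d1 := down1 M; have d0 := down0 M.
    have dout i' := @down_out M i'.
    case: (eqVneq j k.+2) => [->|h1]; first by rewrite !d ?eqxx //; lia.
    case: (eqVneq j k.+3) => [->|h2].
      by rewrite !d //=; do ?case: ifP; lia.
    case: (posnP j) => [->|j0]; first by rewrite d0.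
    case: (eqVneq j 1%N) => [->|j1]; first by rewrite d1; do ?case: ifP; lia.
    case: (ltnP j (2 * e)) => h; first by rewrite !d //=; do ?case: ifP; lia.
    by rewrite dout //; do ?case: ifP; lia.
  apply: gen_mul E_rho; apply: gen_mul; first exact: gen_inv E_rho.
  by apply: IHk; lia.
have [r] : exists r, i <= r by exists i.
elim: r i => [|r IHr] i ir i0; first lia.
case: (ltnP i (2 * e - 1)) => hi.
  by case: i i0 hi {ir} => // k _ hk; apply: small.
have -> : s i = (x 1)^-1 * s (i - e)%N * x 1.
  apply: (@mulgI _ (x 1)); rewrite !mulgA mulgV mul1g (rel_shift R); last lia.
  by rewrite subnK //; lia.
apply: gen_mul E_x1; apply: gen_mul; first exact: gen_inv E_x1.
by apply: IHr; lia.
Qed.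

Lemma E_sprod l : all (leq 1) l -> E (sprod l).
Proof.
elim: l => [|i l IHl] /=; first by rewrite sprod0 => _; apply: gen_one.
by case/andP=> i0 l0; rewrite sprod_cons; apply: gen_mul; [apply: E_s | apply: IHl].
Qed.

Lemma E_vS n i : E (v n i.+1).
Proof.
elim: i => [|i IHi]; first exact: E_v1.
have -> : v n i.+2 = s i.+1 * v n i.+1 * s i.+1.
  by rewrite (rel_sv R) -mulgA (rel_ss R) mulg1.
by apply: gen_mul; [apply: gen_mul => // |]; apply: E_s.
Qed.

Lemma E_x i : E (x i).
Proof.
case: i => [|i]; first exact: E_x0.
elim: i => [|i IHi]; first exact: E_x1.
have -> : x i.+2 = s i.+1 * x i.+1 * (sprod (iota i.+1 e.+1))^-1.
  by apply: (@mulIg _ (sprod (iota i.+1 e.+1))); rewrite mulgVK (rel_sx R).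
apply: gen_mul; first by apply: gen_mul => //; apply: E_s.
by apply/gen_inv/E_sprod/allP => j; rewrite mem_iota; lia.
Qed.

(** In the normal form of [coset_word] at [m = 0] the factor [s 0] occurs at most once, and it is
    absent when strand 0 is fixed. *)
Lemma sprod_E l : (E (sprod l) \/
    exists y z, [/\ E y, E z & sprod l = y * s 0 * z]) /\
  (hswp l 0 = 0%N -> E (sprod l)).
Proof.
have [k [l' [hl' _ El]]] : exists k l',
    [/\ all (fun j => 0 < j < 0 + (\max_(j <- l) j).+1) l',
        k <= (\max_(j <- l) j).+1 & sprod l = sprod l' * sprod (iota 0 k)].
  apply: coset_word; apply/allP => j jl /=.
  by rewrite add0n ltnS; apply: (leq_bigmax_seq j).
have l'1 : all (leq 1) l' by apply: sub_all hl' => j /andP[].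
have El' : E (sprod l') by apply: E_sprod.
case: k El => [|k] El.
  by rewrite El sprod0 mulg1; split; [left|].
have Ek : E (sprod (iota 1 k)).
  by apply/E_sprod/allP => j; rewrite mem_iota; lia.
split; first by right; exists (sprod l'), (sprod (iota 1 k)); rewrite El sprod_cons mulgA.
move=> l0; have := eq_hswp (etrans El (esym (sprod_cat l' (iota 0 k.+1)))) k.+1.
rewrite hswp_cat hswp_up /= add0n ltnn eqxx (@hswp_out l' 1) // -[in RHS]l0.
move/(can_inj (hswp_rev l)) => //.
Qed.

Lemma E_v n i : E (v n i).
Proof.
case: i => [|i]; last exact: E_vS.
(* Split strand 0. The first child corresponds to the added letter, which is fixed with trivial
   section, so the permutation fixes strand 0 and only the strands from 1 on carry labels. *)
have -> : v n 0 = x 0 * (sprod (map (addn 0) (head_word n)) *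
    \prod_(y <- iota 0 e.+1) v (nsec' n y) (0 + y)%N) * (x 0)^-1.
  by apply: (@mulIg _ (x 0)); rewrite mulgVK (rel_vx R) mulgA.
apply: gen_mul; last exact: gen_inv E_x0.
apply: gen_mul; first exact: E_x0.
apply: gen_mul; last first.
  by apply: gen_prod => -[|y]; [rewrite v_none; apply: gen_one | apply: E_vS].
apply: (sprod_E _).2; rewrite hswp_addn ltnn subn0 add0n head_wordE //.
Qed.

Lemma point_group_E z : point_group z -> E z \/ exists y1 y2, [/\ E y1, E y2 & z = y1 * s 0 * y2].
Proof.
case/point_group_form => l1 [y [l2 [/strand_group_form[l [m [F ->]]] ->]]].
have Ex l' : E (xw l') by apply: gen_prod => i; apply: E_x.
have El : E (labels m F) by apply: gen_prod => i; apply: gen_prod => n; apply: E_v.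
have [[h|[y1 [y2 [h1 h2 ->]]]] _] := sprod_E l.
  by left; apply: gen_mul (gen_inv (Ex _)); apply: gen_mul => //; apply: gen_mul.
right; exists (xw l1 * y1), (y2 * labels m F * (xw l2)^-1); split.
- exact: gen_mul.
- by apply: gen_mul (gen_inv (Ex _)); apply: gen_mul.
- by rewrite !mulgA.
Qed.

Lemma E_Hset z : E z -> point_group z.
Proof.
have Ha c i : point_group (a c i) by apply: gen_in; exists c, i.
apply: gen_sub => y [[n ->]|]; first exact: Ha.
rewrite !inE => /or4P[] /eqP->; try exact: Ha.
by apply: gen_prod => i; apply: Ha.
Qed.

Lemma E_flip z : E z -> E (t * z * t).
Proof.
have gen_flip y : pair_gen y -> E (t * y * t).
  case=> [[n ->]|]; first by rewrite (rel_tv R); apply: E_v.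
  rewrite !inE => /or4P[] /eqP->.
  - by rewrite (rel_ts R); apply: E_s1.
  - rewrite (rel_tx0 R); apply: gen_mul E_rho (gen_inv E_x0).
  - rewrite (rel_tx1 R); apply: gen_mul (gen_inv E_x0).
    apply: gen_mul E_x1 _; elim: (e) => [|k IHk]; first exact: gen_one.
    by rewrite expgS; apply: gen_mul E_rho IHk.
  (* Since [rho] is [t * x 0 * t * x 0], conjugation by [t] rotates this product cyclically. *)
  have -> : t * rho a * t = x 0 * rho a * (x 0)^-1.
    have -> : rho a = t * x 0 * t * x 0 by rewrite (rel_tx0 R) mulgVK.
    by rewrite !mulgA (rel_tt R) mul1g mulgK.
  by apply: gen_mul (gen_inv E_x0); apply: gen_mul E_x0 E_rho.
have tM y1 y2 : t * (y1 * y2) * t = (t * y1 * t) * (t * y2 * t).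
  by rewrite !mulgA -(mulgA (t * y1) t t) (rel_tt R) mulg1.
have tV y : t * y^-1 * t = (t * y * t)^-1 by rewrite !invgM tVE mulgA.
elim=> {z} [|y z hy _ IH|y z hy _ IH].
- by rewrite mulg1 (rel_tt R); apply: gen_one.
- by rewrite tM; apply: gen_mul => //; apply: gen_flip.
- by rewrite tM tV; apply: gen_mul => //; apply/gen_inv/gen_flip.
Qed.

(* The subgroup fixing the point at infinity and [t] form a BN-like pair. *)
Lemma double_coset z : gen_by (fun y => y = t \/ exists c i, y = a c i) z ->
  point_group z \/ exists y1 y2, [/\ point_group y1, point_group y2 & z = y1 * t * y2].
Proof.
have Ha c i : point_group (a c i) by apply: gen_in; exists c, i.
have tcase y : point_group y -> point_group (t * y * t) \/
    exists y1 y2, [/\ point_group y1, point_group y2 & t * y * t = y1 * t * y2].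
  case/point_group_E => [/E_flip/E_Hset h|[y1 [y2 [h1 h2 ->]]]]; first by left.
  right; exists (t * y1 * t * s 0), (s 0 * (t * y2 * t)); split.
  - by apply: gen_mul (Ha _ _); apply/E_Hset/E_flip.
  - by apply: gen_mul (Ha _ _) _; apply/E_Hset/E_flip.
  have ttK y0 : y0 * t * t = y0 by rewrite -mulgA (rel_tt R) mulg1.
  transitivity (t * y1 * t * (s 0 * t * s 0) * (t * y2 * t)); last by rewrite !mulgA.
  by rewrite -(rel_tbraid R) !mulgA !ttK.
elim=> {z} [|y z hy _ IH|y z hy _ IH].
- by left; apply: gen_one.
- case: hy IH => [->|[c [i ->]]].
    case=> [h|[y1 [y2 [h1 h2 ->]]]].
      by right; exists 1, z; rewrite mul1g; split=> //; apply: gen_one.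
    rewrite !mulgA; case: (tcase y1 h1) => [h|[y3 [y4 [h3 h4 ->]]]].
      by left; apply: gen_mul.
    by right; exists y3, (y4 * y2); rewrite !mulgA; split=> //; apply: gen_mul.
  case=> [h|[y1 [y2 [h1 h2 ->]]]]; first by left; apply: gen_mul (Ha c i) h.
  right; exists (a c i * y1), y2; rewrite !mulgA; split=> //.
  exact: gen_mul (Ha c i) h1.
- case: hy IH => [->|[c [i ->]]].
    rewrite tVE; case=> [h|[y1 [y2 [h1 h2 ->]]]].
      by right; exists 1, z; rewrite mul1g; split=> //; apply: gen_one.
    rewrite !mulgA; case: (tcase y1 h1) => [h|[y3 [y4 [h3 h4 ->]]]].
      by left; apply: gen_mul.
    by right; exists y3, (y4 * y2); rewrite !mulgA; split=> //; apply: gen_mul.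
  have HV := gen_inv (Ha c i).
  case=> [h|[y1 [y2 [h1 h2 ->]]]]; first by left; apply: gen_mul HV h.
  right; exists ((a c i)^-1 * y1), y2; rewrite !mulgA; split=> //.
  exact: gen_mul HV h1.
Qed.

Lemma point_group_nil z : point_group z -> p z [::] = [::].
Proof.
elim=> {z} [|_ z [c [i ->]] _ IH|_ z [c [i ->]] _ IH]; first exact: p1.
  by rewrite pM bijM IH pa ab_nil.
by rewrite pM bijM IH -{1}(ab_nil c i) -pa pK.
Qed.

Hypothesis gen_all : forall z, gen_by (fun y => y = t \/ exists c i, y = a c i) z.

Theorem relations_faithful z : (forall u, p z u = u) -> z = 1.
Proof.
case: (double_coset (gen_all z)) => [|[y1 [y2 [h1 h2 ->]]] h].
  exact: point_group_faithful.
have := h [::]; rewrite pM bijM (point_group_nil h2) pM bijM pt.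
move/(congr1 (p y1^-1)); rewrite pK (point_group_nil (gen_inv h1)).
by [].
Qed.

End Faithful.

(** * Finitely many relations suffice *)

Section FinitePresentation.
Variables (M : automaton) (N : nucleus M).
Local Notation e := (deg M).
Local Notation gx := (None : gen N).
Local Notation gs := (Some None : gen N).
Local Notation gn n := (Some (Some n) : gen N).

(* Conjugation by [x 0] brings the smaller index of a relation down to [e], and
   conjugation by another [x k] brings the gap between the indices down to
   [e + 2]. *)
Definition bound : nat := 2 * e + 4.

Record relations_upto (B : groupType) (a : gen N -> nat -> B) (t : B) : Prop :=
  RelationsUpto {
  upto_shift : forall c i j, i < bound -> j < bound -> i < j ->
    a c j * a gx i = a gx i * a c (j + e)%N;
  upto_vcomm : forall n c j i, i < bound -> j < bound -> j < i ->
    a (gn n) j * a c i = a c i * a (gn n) j;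
  upto_scomm : forall c j i, i < bound -> j < bound -> j.+1 < i ->
    a gs j * a c i = a c i * a gs j;
  upto_ss : forall i, i < bound -> a gs i * a gs i = 1;
  upto_braid : forall i, i < bound ->
    a gs i * a gs i.+1 * a gs i = a gs i.+1 * a gs i * a gs i.+1;
  upto_sv : forall n i, i < bound -> a gs i * a (gn n) i = a (gn n) i.+1 * a gs i;
  upto_vv : forall n1 n2 n3 i, i < bound -> nval n1 * nval n2 = nval n3 ->
    a (gn n1) i * a (gn n2) i = a (gn n3) i;
  upto_sx : forall i, i < bound ->
    a gs i * a gx i = a gx i.+1 * sprod a (iota i e.+1);
  upto_vx : forall n i, i < bound -> a (gn n) i * a gx i =
    a gx i * sprod a (map (addn i) (head_word n)) *
      \prod_(y <- iota 0 e.+1) a (gn (nsec' n y)) (i + y)%N;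
  upto_tt : t * t = 1;
  upto_tbraid : t * a gs 0 * t = a gs 0 * t * a gs 0;
  upto_tv : forall n, t * a (gn n) 1%N * t = a (gn n) 1%N;
  upto_ts : t * a gs 1%N * t = a gs 1%N;
  upto_tx0 : t * a gx 0 * t = rho a * (a gx 0)^-1;
  upto_tx1 : t * a gx 1%N * t = a gx 1%N * rho a ^+ e * (a gx 0)^-1 }.

Lemma relations_upto_of (B : groupType) (a : gen N -> nat -> B) t :
  relations a t -> relations_upto a t.
Proof. by case=> *; split; auto. Qed.

Section Extend.
Variables (B : groupType) (a : gen N -> nat -> B) (t : B).
Hypothesis U : relations_upto a t.
Local Notation x := (a gx).
Local Notation s := (a gs).
Local Notation v n := (a (gn n)).
Hypothesis a_shift : forall c j, 0 < j -> a c (j + e)%N = (x 0)^-1 * a c j * x 0.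

Let cj z := (x 0)^-1 * z * x 0.

Let cjM y z : cj (y * z) = cj y * cj z.
Proof. by rewrite /cj !mulgA mulgK. Qed.

Let cj1 : cj 1 = 1.
Proof. by rewrite /cj mulg1 mulVg. Qed.

Let cja c j : 0 < j -> cj (a c j) = a c (j + e)%N.
Proof. by move=> j0; rewrite a_shift. Qed.

Let local_ind (Q : nat -> Prop) : (forall i, i < bound -> Q i) ->
  (forall i, 0 < i -> Q i -> Q (i + e)%N) -> forall i, Q i.
Proof.
have e4 := deg_gt4 M; rewrite /bound => Q0 Qe i.
have [r] : exists r, i <= r by exists i.
elim: r i => [|r IHr] i ir; first by apply: Q0; lia.
case: (ltnP i (2 * e + 4)) => hi; first exact: Q0.
by rewrite -(@subnK e i); [apply: Qe; [lia | apply: IHr; lia] | lia].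
Qed.

Let shift_all c i j : i < j -> a c j * x i = x i * a c (j + e)%N.
Proof.
have e4 := deg_gt4 M; have := upto_shift U; rewrite /bound => h0.
have [g] : exists g, j - i <= g by exists (j - i)%N.
elim: g c i j => [|g IHg] c i j hg ij; first lia.
have [r] : exists r, i <= r by exists i.
elim: r i j hg ij => [|r IHr] i j hg ij ir.
  have -> : i = 0%N by lia.
  by rewrite a_shift ?mulgA ?mulgV ?mul1g //; lia.
case: (posnP i) => [->|i0]; first by rewrite a_shift ?mulgA ?mulgV ?mul1g //; lia.
case: (ltnP e i) => ei.
  have := congr1 cj (IHr (i - e)%N (j - e)%N ltac:(lia) ltac:(lia) ltac:(lia)).
  by rewrite !cjM !cja ?subnK //; lia.
case: (leqP j (i + e.+1)) => jie; first by apply: h0; lia.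
(* Write [a c j] as the conjugate of [a c (j - e)] by [x i.+1]. Conjugating further by [x i] turns
   these into [a c j] and [x (i.+1 + e)], and conjugating the former by the latter gives
   [a c (j + e)]. Every relation used has a smaller gap. *)
have hk c' m : i.+1 < m -> m < j -> a c' (m + e)%N = (x i.+1)^-1 * a c' m * x i.+1.
  by move=> h1 h2; rewrite -mulgA IHg ?mulKg //; lia.
have hi c' m : i < m -> m < j -> a c' (m + e)%N = (x i)^-1 * a c' m * x i.
  by move=> h1 h2; rewrite -mulgA IHg ?mulKg //; lia.
apply: (@mulgI _ (x i)^-1); rewrite mulKg mulgA.
have ji : j = (j - e + e)%N by lia.
rewrite {1}ji (hk c); [|lia|lia].
have E1 : (x i)^-1 * x i.+1 * x i = x (i.+1 + e)%N by rewrite hi //; lia.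
have E2 : (x (i.+1 + e)%N)^-1 * a c j * x (i.+1 + e)%N = a c (j + e)%N.
  by rewrite -mulgA IHg ?mulKg //; lia.
have E3 : a c j = (x i)^-1 * a c (j - e)%N * x i by rewrite {1}ji hi //; lia.
by rewrite -E2 -E1 E3 !invgM !invgK !mulgA !mulgK.
Qed.

Let comm_conj (y z k : B) : commute y z -> commute y k -> commute y (k^-1 * z * k).
Proof.
move=> yz yk; apply: commuteM => //; apply: commuteM => //.
exact: commuteV.
Qed.

(* Both families of commutation relations are instances of this statement,
   with [d = 0] and [d = 1]. *)
Let comm_all b d : d <= 1 ->
  (forall c i j, i < bound -> j < bound -> j + d < i -> commute (a b j) (a c i)) ->
  forall c i j, j + d < i -> commute (a b j) (a c i).
Proof.
have e4 := deg_gt4 M; rewrite /bound => d1 h0 c i j.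
have [g] : exists g, i - j <= g by exists (i - j)%N.
elim: g c i j => [|g IHg] c i j hg ij; first lia.
have [r] : exists r, j <= r by exists j.
elim: r i j hg ij => [|r IHr] i j hg ij jr; last first.
  case: (ltnP e j) => ej.
    have := congr1 cj (IHr (i - e)%N (j - e)%N ltac:(lia) ltac:(lia) ltac:(lia)).
    by rewrite !cjM !cja ?subnK //; lia.
  case: (leqP i (j + e.+2)) => jie; first by apply: h0; lia.
  have ii : i = (i - e + e)%N by lia.
  have -> : a c i = (x (j + d).+1)^-1 * a c (i - e)%N * x (j + d).+1.
    by rewrite {1}ii -mulgA shift_all ?mulKg //; lia.
  by apply: comm_conj; apply: IHg; lia.
case: (leqP i (j + e.+2)) => jie; first by apply: h0; lia.
have ii : i = (i - e + e)%N by lia.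
have -> : a c i = (x (j + d).+1)^-1 * a c (i - e)%N * x (j + d).+1.
  by rewrite {1}ii -mulgA shift_all ?mulKg //; lia.
by apply: comm_conj; apply: IHg; lia.
Qed.

Let cj_sprod l : all (leq 1) l -> cj (sprod a l) = sprod a (map (addn^~ e) l).
Proof.
elim: l => [|i l IHl] /=; first by rewrite /sprod !big_nil cj1.
by case/andP=> i0 l0; rewrite /sprod !big_cons cjM cja // -!/(sprod a _) IHl.
Qed.

Lemma relations_of_upto : relations a t.
Proof.
have e4 := deg_gt4 M; split.
- exact: shift_all.
- move=> n c j i ji; apply: (@comm_all (gn n) 0) => //; last by rewrite addn0.
  by move=> c' i' j' h1 h2; rewrite addn0; apply: (upto_vcomm U).
- move=> c j i ji; apply: (@comm_all gs 1) => //; last by rewrite addn1.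
  by move=> c' i' j' h1 h2; rewrite addn1; apply: (upto_scomm U).
- apply: local_ind => [i ib|i i0 /(congr1 cj)]; first exact: (upto_ss U).
  by rewrite cjM cj1 cja.
- apply: local_ind => [i ib|i i0 /(congr1 cj)]; first exact: (upto_braid U).
  by rewrite !cjM !cja.
- move=> n; apply: local_ind => [i ib|i i0 /(congr1 cj)]; first exact: (upto_sv U).
  by rewrite !cjM !cja.
- move=> n1 n2 n3 i E; move: i; apply: local_ind => [i ib|i i0 /(congr1 cj)].
    exact: (upto_vv U).
  by rewrite !cjM !cja.
- apply: local_ind => [i ib|i i0 /(congr1 cj)]; first exact: (upto_sx U).
  rewrite !cjM !cja // cj_sprod; last by apply/allP => j; rewrite mem_iota; lia.
  have -> : [seq j + e | j <- iota i e.+1] = iota (i + e) e.+1.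
    by rewrite -[(i + e)%N]addnC iotaDl; apply: eq_map => j; rewrite addnC.
  by [].
- move=> n; apply: local_ind => [i ib|i i0 /(congr1 cj)]; first exact: (upto_vx U).
  rewrite !cjM !cja // cj_sprod; last by apply/allP => _ /mapP[j _ ->]; lia.
  rewrite -map_comp => ->; congr (_ * sprod a _ * _).
    by apply: eq_map => j /=; lia.
  rewrite (big_morph cj cjM cj1); apply: eq_bigr => y _.
  by rewrite cja ?ltn_addr // addnAC.
- exact: upto_tt U.
- exact: upto_tbraid U.
- exact: upto_tv U.
- exact: upto_ts U.
- exact: upto_tx0 U.
- exact: upto_tx1 U.
Qed.

End Extend.

(* [None] names [t], and [Some (c, r)] names [a c r]; the members of index
   [> e] of each family are conjugates of these by powers of [x 0]. *)
Definition pgen : finType := option (option (option N) * 'I_e.+1).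

(** Index 0 stands apart, because conjugation by [x 0] shifts only positive indices; hence the
    division of [j.-1] and the remainders from 1 to [e]. *)
Definition family (B : groupType) (y : pgen -> B) (c : gen N) j : B :=
  let q := (j.-1 %/ e)%N in
  let r := if j is j'.+1 then (j' %% e).+1 else 0%N in
  (y (Some (None, ord0))) ^- q * y (Some (c, inord r)) * y (Some (None, ord0)) ^+ q.

Definition family_word (c : gen N) j : seq (pgen * bool) :=
  let q := (j.-1 %/ e)%N in
  let r := if j is j'.+1 then (j' %% e).+1 else 0%N in
  nseq q (Some (None, ord0), true) ++
    (Some (c, inord r), false) :: nseq q (Some (None, ord0), false).

Lemma gval_nseq (I : Type) (B : groupType) (y : I -> B) q i b :
  gval y (nseq q (i, b)) = letter_val y (i, b) ^+ q.
Proof.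
by elim: q => [|q IHq]; rewrite ?gval_nil // gval_cons IHq expgS.
Qed.

Lemma gval_family (B : groupType) (y : pgen -> B) c j :
  gval y (family_word c j) = family y c j.
Proof.
by rewrite gval_cat gval_cons !gval_nseq /letter_val /= expVgn mulgA.
Qed.

Lemma family0 (B : groupType) (y : pgen -> B) c :
  family y c 0 = y (Some (c, ord0)).
Proof.
rewrite /family div0n !expg0 invg1 mul1g mulg1; congr (y (Some (c, _))).
by apply/val_inj; rewrite /= inordK.
Qed.

Lemma family_shift (B : groupType) (y : pgen -> B) c j : 0 < j ->
  family y c (j + e)%N = (family y gx 0)^-1 * family y c j * family y gx 0.
Proof.
case: j => // j _; have e0 : 0 < e by have := deg_gt4 M; lia.
rewrite family0 /family addSn /= divnDr ?dvdnn // divnn e0 modnDr addn1.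
by rewrite expgSr invgM !mulgA.
Qed.

Lemma family_small (B : groupType) (y : pgen -> B) c j : j <= e ->
  family y c j = y (Some (c, inord j)).
Proof.
case: j => [|j] je; first by rewrite family0; congr (y (Some (c, _))); apply/val_inj; rewrite /= inordK.
by rewrite /family /= divn_small // modn_small // !expg0 invg1 mul1g mulg1.
Qed.

Section Relators.

Definition sword l : seq (pgen * bool) := flatten (map (family_word gs) l).

Definition vword n i : seq (pgen * bool) :=
  flatten [seq family_word (gn (nsec' n y)) (i + y)%N | y <- iota 0 e.+1].

(** When the side condition fails the relator is the empty word, so that every family of relators
    can range over a whole finite type. *)
Definition equation (b : bool) (w1 w2 : seq (pgen * bool)) :=
  if b then w1 ++ winv w2 else [::].

Lemma gval_equation (B : groupType) (y : pgen -> B) b w1 w2 :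
  gval y (equation b w1 w2) = 1 <-> (b -> gval y w1 = gval y w2).
Proof.
case: b => /=; last by rewrite gval_nil; split.
rewrite gval_cat gval_winv; split=> [/divg1_eq //|->//].
by rewrite mulgV.
Qed.

Local Notation fw := family_word.
Local Notation tw := [:: (None : pgen, false)].
Local Notation xwV := (winv (fw gx 0)).
Local Notation idx := 'I_bound.
Local Notation rhow := (sword (rev (iota 1 (2 * e - 2)))).

Definition over (T : finType) (F : T -> seq (pgen * bool)) := [seq F p | p <- enum T].

Definition relators : seq (seq (pgen * bool)) :=
  over (fun p : option (option N) * idx * idx => let: (c, i, j) := p in
    equation (i < j) (fw c j ++ fw gx i) (fw gx i ++ fw c (j + e))) ++
  over (fun p : N * option (option N) * idx * idx => let: (n, c, j, i) := p in
    equation (j < i) (fw (gn n) j ++ fw c i) (fw c i ++ fw (gn n) j)) ++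
  over (fun p : option (option N) * idx * idx => let: (c, j, i) := p in
    equation (j.+1 < i) (fw gs j ++ fw c i) (fw c i ++ fw gs j)) ++
  over (fun i : idx => equation true (fw gs i ++ fw gs i) [::]) ++
  over (fun i : idx => equation true (fw gs i ++ fw gs i.+1 ++ fw gs i)
    (fw gs i.+1 ++ fw gs i ++ fw gs i.+1)) ++
  over (fun p : N * idx => let: (n, i) := p in
    equation true (fw gs i ++ fw (gn n) i) (fw (gn n) i.+1 ++ fw gs i)) ++
  over (fun p : N * N * N * idx => let: (n1, n2, n3, i) := p in
    equation (nval n1 * nval n2 == nval n3) (fw (gn n1) i ++ fw (gn n2) i)
      (fw (gn n3) i)) ++
  over (fun i : idx => equation true (fw gs i ++ fw gx i)
    (fw gx i.+1 ++ sword (iota i e.+1))) ++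
  over (fun p : N * idx => let: (n, i) := p in
    equation true (fw (gn n) i ++ fw gx i)
      (fw gx i ++ sword (map (addn i) (head_word n)) ++ vword n i)) ++
  over (fun n : N => equation true (tw ++ fw (gn n) 1 ++ tw) (fw (gn n) 1)) ++
  [:: equation true (tw ++ tw) [::];
      equation true (tw ++ fw gs 0 ++ tw) (fw gs 0 ++ tw ++ fw gs 0);
      equation true (tw ++ fw gs 1 ++ tw) (fw gs 1);
      equation true (tw ++ fw gx 0 ++ tw) (rhow ++ xwV);
      equation true (tw ++ fw gx 1 ++ tw)
        (fw gx 1 ++ flatten (nseq e rhow) ++ xwV)].

Variables (B : groupType) (y : pgen -> B) (f : gen N -> nat -> B).
Hypothesis fE : forall c j, gval y (family_word c j) = f c j.

Let gval_sword l :
  gval y (sword l) = sprod f l.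
Proof.
elim: l => [|i l IHl]; first by rewrite gval_nil /sprod big_nil.
by rewrite /sword /= gval_cat fE IHl /sprod big_cons.
Qed.

Let gval_vword n i :
  gval y (vword n i) = \prod_(k <- iota 0 e.+1) f (gn (nsec' n k)) (i + k)%N.
Proof.
rewrite /vword; elim: (iota _ _) => [|k l IHl]; first by rewrite gval_nil big_nil.
by rewrite /= gval_cat fE IHl big_cons.
Qed.


Let gval_t : gval y tw = y None.
Proof. by rewrite gval_cons gval_nil mulg1. Qed.

Let gval_rhoX k : gval y (flatten (nseq k rhow)) = rho f ^+ k.
Proof.
by elim: k => [|k IHk]; rewrite ?gval_nil //= gval_cat IHk expgS gval_sword.
Qed.

Let overP (T : finType) (F : T -> seq (pgen * bool)) :
  (forall r, r \in over F -> gval y r = 1) <-> forall p, gval y (F p) = 1.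
Proof.
split=> [h p|h r /mapP[p _ ->] //]; apply: h.
by apply/mapP; exists p; rewrite ?mem_enum.
Qed.

Let catP rs1 rs2 : (forall r, r \in rs1 ++ rs2 -> gval y r = 1) <->
  (forall r, r \in rs1 -> gval y r = 1) /\ (forall r, r \in rs2 -> gval y r = 1).
Proof.
split=> [h|[h1 h2] r]; first by split=> r hr; apply: h; rewrite mem_cat hr ?orbT.
by rewrite mem_cat => /orP[/h1|/h2].
Qed.

Let consP r0 rs : (forall r, r \in r0 :: rs -> gval y r = 1) <->
  gval y r0 = 1 /\ (forall r, r \in rs -> gval y r = 1).
Proof.
rewrite -cat1s; split=> [/catP[h1 h2]|[h1 h2]].
  by split=> //; apply: h1; rewrite inE.
by apply/catP; split=> // r; rewrite inE => /eqP->.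
Qed.

Let gE := (gval_cat, gval_winv, fE, gval_sword, gval_vword, gval_nil,
  gval_t, gval_rhoX).

Lemma relators_upto :
  (forall r, r \in relators -> gval y r = 1) -> relations_upto f (y None).
Proof.
case/catP=> /overP h1 /catP[/overP h2 /catP[/overP h3 /catP[/overP h4
  /catP[/overP h5 /catP[/overP h6 /catP[/overP h7 /catP[/overP h8
  /catP[/overP h9 /catP[/overP h10]]]]]]]]].
case/consP=> h11 /consP[h12 /consP[h13 /consP[h14 /consP[h15 _]]]].
split.
- move=> c i j hi hj ij.
  have /gval_equation/(_ ij) := h1 (c, Ordinal hi, Ordinal hj).
  by rewrite !gE.
- move=> n c j i hi hj ij.
  have /gval_equation/(_ ij) := h2 (n, c, Ordinal hj, Ordinal hi).
  by rewrite !gE.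
- move=> c j i hi hj ij.
  have /gval_equation/(_ ij) := h3 (c, Ordinal hj, Ordinal hi).
  by rewrite !gE.
- by move=> i hi; have /gval_equation/(_ isT) := h4 (Ordinal hi); rewrite !gE.
- move=> i hi; have /gval_equation/(_ isT) := h5 (Ordinal hi).
  by rewrite !gE !mulgA.
- by move=> n i hi; have /gval_equation/(_ isT) := h6 (n, Ordinal hi); rewrite !gE.
- move=> n1 n2 n3 i hi /eqP E.
  by have /gval_equation/(_ E) := h7 (n1, n2, n3, Ordinal hi); rewrite !gE.
- by move=> i hi; have /gval_equation/(_ isT) := h8 (Ordinal hi); rewrite !gE.
- move=> n i hi; have /gval_equation/(_ isT) := h9 (n, Ordinal hi).
  by rewrite !gE mulgA.
- by move/gval_equation/(_ isT): h11; rewrite !gE.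
- by move/gval_equation/(_ isT): h12; rewrite !gE !mulgA.
- by move=> n; have /gval_equation/(_ isT) := h10 n; rewrite !gE !mulgA.
- by move/gval_equation/(_ isT): h13; rewrite !gE !mulgA.
- by move/gval_equation/(_ isT): h14; rewrite !gE !mulgA.
- by move/gval_equation/(_ isT): h15; rewrite !gE !mulgA.
Qed.

Lemma upto_relators :
  relations_upto f (y None) -> forall r, r \in relators -> gval y r = 1.
Proof.
case=> h1 h2 h3 h4 h5 h6 h7 h8 h9 h11 h12 h10 h13 h14 h15.
apply/catP; split; [|apply/catP; split; [|apply/catP; split; [|apply/catP; split;
  [|apply/catP; split; [|apply/catP; split; [|apply/catP; split; [|apply/catP; split;
  [|apply/catP; split; [|apply/catP; split]]]]]]]]].
- by apply/overP => -[[c i] j]; apply/gval_equation => ij; rewrite !gE h1.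
- by apply/overP => -[[[n c] j] i]; apply/gval_equation => ij; rewrite !gE h2.
- by apply/overP => -[[c j] i]; apply/gval_equation => ij; rewrite !gE h3.
- by apply/overP => i; apply/gval_equation => _; rewrite !gE h4.
- by apply/overP => i; apply/gval_equation => _; rewrite !gE !mulgA h5.
- by apply/overP => -[n i]; apply/gval_equation => _; rewrite !gE h6.
- apply/overP => -[[[n1 n2] n3] i]; apply/gval_equation => /eqP E.
  by rewrite !gE (h7 _ _ n3).
- by apply/overP => i; apply/gval_equation => _; rewrite !gE h8.
- by apply/overP => -[n i]; apply/gval_equation => _; rewrite !gE h9 // mulgA.
- by apply/overP => n; apply/gval_equation => _; rewrite !gE !mulgA h10.
do ?[apply/consP; split; [apply/gval_equation => _; rewrite !gE ?mulgA //|]].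
by [].
Qed.

End Relators.

Definition pb (l : pgen) : bij (seq nat) := if l is Some (c, r) then ab c r else tb M.

Lemma family_pb c j : family pb c j = ab c j.
Proof.
have e4 := deg_gt4 M; elim/ltn_ind: j => j IHj.
case: (posnP j) => [->|j0]; first exact: family0.
case: (leqP j e) => je.
  by rewrite family_small // -[pb _]/(ab c (inord j : 'I_e.+1)) inordK.
rewrite -(@subnK e j); last lia.
rewrite family_shift; last lia.
rewrite IHj; last lia.
have -> : family pb gx 0 = ab gx 0 by apply: family0.
have h : 0 < j - e by lia.
by rewrite -mulgA [X in _ * X](rel_shift (ab_relations N) c h) mulKg.
Qed.

Lemma relators_pb r : r \in relators -> gval pb r = 1.
Proof.
apply: (upto_relators (@gval_family _ pb)); rewrite (_ : family pb = @ab M N).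
  exact/relations_upto_of/ab_relations.
by apply/funext => c; apply/funext => j; apply: family_pb.
Qed.

End FinitePresentation.

(** * Torsion in the abelian quotient *)

Section Torsion.
Import GRing.Theory.
Local Open Scope ring_scope.

(* The determinant of [1 - 2A] is odd, and it annihilates every solution. *)
Lemma zmod_torsion (V : zmodType) n (u : 'I_n -> V) (A : 'M[int]_n) :
  (forall i, u i = \sum_j u j *~ (2 * A i j)) ->
  exists2 m, (0 < m)%N & forall i, u i *+ m = 0.
Proof.
move=> uA; pose B := 1%:M - 2%:R *: A.
have uB i : \sum_j u j *~ B i j = 0.
  under eq_bigr => j _ do rewrite /B !mxE mulrzBr.
  rewrite big_split /= sumrN -uA (bigD1 i) //= big1 => [|j /negPf ji].
    by rewrite eqxx mulr1z addr0 subrr.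
  by rewrite eq_sym ji mulr0z.
have detB : \det B != 0.
  apply/eqP => /(congr1 (intr : int -> 'F_2)).
  rewrite -det_map_mx map_mxB map_scalar_mx map_mxZ /= rmorph_nat.
  have -> : 2%:~R = 0 :> 'F_2 by apply/eqP.
  by rewrite scale0r subr0 det1 => /eqP.
exists `|\det B|%N => [|k]; first by rewrite absz_gt0.
suff h : u k *~ \det B = 0.
  have [E|E] : \det B = `|\det B|%N :> int \/ \det B = - `|\det B|%N%:Z by lia.
    by rewrite E in h.
  by apply: oppr_inj; rewrite oppr0 pmulrn -mulrNz -E.
have detE j : \sum_i \adj B k i * B i j = (k == j)%:R * \det B.
  have := congr1 (fun C : 'M_n => C k j) (mul_adj_mx B).
  by rewrite !mxE mulr_natl.
transitivity (\sum_j u j *~ (\sum_i \adj B k i * B i j)).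
  under eq_bigr => j _ do rewrite detE.
  rewrite (bigD1 k) //= eqxx mul1r big1 ?addr0 // => j /negPf jk.
  by rewrite eq_sym jk mul0r mulr0z.
under eq_bigr => j _ do rewrite mulrz_sumr.
rewrite exchange_big big1 // => i _ /=.
under eq_bigr => j _ do rewrite mulrC mulrzA.
by rewrite -mulrz_suml uB mul0rz.
Qed.

Lemma sum_count (V : zmodType) (I : finType) (u : I -> V) (r : seq I) :
  \sum_(j <- r) u j = \sum_j u j *~ count_mem j r.
Proof.
elim: r => [|k r IHr]; first by rewrite big_nil big1 // => j _; rewrite mulr0z.
rewrite big_cons IHr; under [RHS]eq_bigr => j _ do rewrite /= PoszD mulrzDr.
rewrite big_split /=; congr (_ + _); rewrite (bigD1 k) //= eqxx big1 ?addr0 //.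
by move=> j jk; rewrite eq_sym (negPf jk) mulr0z.
Qed.

End Torsion.

Section SquareTorsion.
Import GRing.Theory.

Lemma square_torsion (Q : groupType) (I : finType) (u : I -> Q) (c : I -> seq I) :
  (forall x y : Q, commute x y) ->
  (forall i, u i = (\prod_(j <- c i) u j) ^+ 2) ->
  exists2 m, 0 < m & forall i, u i ^+ m = 1.
Proof.
move=> Qab uc.
pose V : zmodType := HB.pack Q (GRing.isZmodule.Build Q
  (@mulgA Q) Qab (@mul1g Q) (@mulVg Q)).
have expV (x : V) k : (x *+ k)%R = (x : Q) ^+ k.
  by elim: k => // k IHk; rewrite mulrS IHk expgS.
have sumV (r : seq I) : (\sum_(j <- r) (u j : V))%R = \prod_(j <- r) u j.
  by [].
pose A := (\matrix_(i < #|I|, j < #|I|)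
  Posz (count_mem (enum_val j) (c (enum_val i))))%R.
have [|m m0 h] := @zmod_torsion V #|I| (u \o enum_val) A.
  move=> i; rewrite /= uc -expV -sumV.
  rewrite (sum_count (u : I -> V)) -sumrMnl big_enum_val; apply: eq_bigr => j _.
  by rewrite mxE mulrC mulrzA -pmulrn.
exists m => // i; rewrite -expV; have := h (enum_rank i).
by rewrite /= enum_rankK.
Qed.

End SquareTorsion.

(** * The subgroup generated by 3-cycles *)

(** Once two neighbouring swaps coincide, this propagates the equality along the whole chain of
    swaps and finally to [t]. *)
Lemma braid_commute_eq (Q : groupType) (y z : Q) : y * y = 1 -> z * z = 1 ->
  y * z = z * y -> y * z * y = z * y * z -> z = y.
Proof.
move=> yy zz yz; rewrite yz -(mulgA z) yy mulg1 => ->.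
by rewrite -yz -mulgA zz mulg1.
Qed.

Section AbelianQuotient.
Variables (M : automaton) (N : nucleus M).
Local Notation e := (deg M).
Local Notation gx := (None : gen N).
Local Notation gs := (Some None : gen N).
Local Notation gn n := (Some (Some n) : gen N).
Variables (Q : groupType) (a : gen N -> nat -> Q) (t : Q).
Hypothesis R : relations a t.
Local Notation x := (a gx).
Local Notation s := (a gs).
Local Notation v n := (a (gn n)).
Hypothesis cycle1 : s 1 * s 2 = 1.

Let ss i : s i * s i = 1. Proof. exact: rel_ss R i. Qed.

Let s2 : s 2 = s 1.
Proof. by apply: (@mulgI _ (s 1)); rewrite cycle1 ss. Qed.

Let s_far i j : i.+1 < j -> s i * s j = s j * s i.
Proof. by move=> ij; rewrite (rel_scomm R). Qed.

Let s_all i : s i = s 1.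
Proof.
case: i => [|i].
  apply: braid_commute_eq; [exact: ss | exact: ss | |].
    by have /esym := @s_far 0 2 isT; rewrite s2.
  exact/esym/(rel_braid R 0).
suff: s i.+1 = s 1 /\ s i.+2 = s 1 by case.
elim: i => [|i [IH1 IH2]]; first by rewrite s2.
split=> //; apply: braid_commute_eq; [exact: ss | exact: ss | |].
  by have := @s_far i.+1 i.+3 (ltnSn _); rewrite IH1.
by have := rel_braid R i.+2; rewrite IH2.
Qed.

Let t_s : t = s 1.
Proof.
have ts1 : t * s 1 = s 1 * t.
  by have := rel_ts R; move/(congr1 (fun z => z * t)); rewrite -mulgA (rel_tt R) mulg1.
apply: braid_commute_eq; [exact: ss | exact: rel_tt R | by rewrite ts1 |].
by have := rel_tbraid R; rewrite s_all => ->.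
Qed.

Let sprodE l : sprod a l = s 1 ^+ size l.
Proof.
elim: l => [|i l IHl]; first by rewrite /sprod big_nil.
by rewrite /sprod big_cons -/(sprod a l) IHl s_all expgS.
Qed.

Let s_even k : s 1 ^+ (2 * k) = 1.
Proof. by rewrite expgnA expg2 ss expg1n. Qed.

Let s_e : s 1 ^+ e = s 1.
Proof.
have := odd_double_half e; rewrite (deg_odd M) -muln2 mulnC => <-.
by rewrite expgnDr s_even mulg1.
Qed.

(** The cycle over the [e.+1] children is a product of an even number of swaps because [e] is odd,
    so it disappears. *)
Let x_succ i : x i.+1 = s 1 * x i.
Proof.
have := rel_sx R i; rewrite s_all sprodE size_iota expgS s_e ss mulg1.
by [].
Qed.

Let x_add i k : x (i + k)%N = s 1 ^+ k * x i.
Proof.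
elim: k => [|k IHk]; first by rewrite addn0 mul1g.
by rewrite addnS x_succ IHk expgS mulgA.
Qed.

(** In [x 2 * x 0 = x 0 * x (2 + e)] the splitting [x 2] equals [x 0], while [x (2 + e)] differs
    from it by an odd power of the common swap. *)
Lemma quotient_s i : s i = 1.
Proof.
rewrite s_all; have := @rel_shift _ _ _ _ _ R gx 0 2 isT.
have x2 : x 2 = x 0 by rewrite (x_add 0 2) expg2 ss mul1g.
rewrite x_add s_e x2 => /mulgI /esym E.
by apply: (@mulIg _ (x 0)); rewrite E mul1g.
Qed.

Lemma quotient_t : t = 1.
Proof. by rewrite t_s quotient_s. Qed.

Let sprod1 l : sprod a l = 1.
Proof. by rewrite sprodE quotient_s expg1n. Qed.

(** All splittings now have one class, and [rel_tx1] reduces to the equality of that class with its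
    product with its own inverse. *)
Lemma quotient_x i : x i = 1.
Proof.
have xE j : x j = x 0 by rewrite (x_add 0 j) quotient_s expg1n mul1g.
have := rel_tx1 R; rewrite quotient_t !mul1g !mulg1 /rho sprod1 expg1n mulg1 xE.
by rewrite mulgV xE.
Qed.

Lemma quotient_v n i : v n i = v n 0.
Proof.
elim: i => // i <-; have := rel_sv R n i; rewrite !quotient_s mulg1 mul1g.
by [].
Qed.

(** Labels on different strands commute, and the class of a label does not depend on its strand. *)
Lemma quotient_v_commute n n' : commute (v n 0) (v n' 0).
Proof.
rewrite -[v n' 0](quotient_v n' 1) /commute.
by have := rel_vcomm R n (gn n') (ltnSn 0).
Qed.

Lemma quotient_v_sections n : v n 0 = \prod_(y <- iota 0 e.+1) v (nsec' n y) 0.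
Proof.
have := rel_vx R n 0; rewrite !quotient_x sprod1 !mulg1 !mul1g => ->.
by apply: eq_bigr => y _; rewrite quotient_v.
Qed.

Lemma eq_label_class n n' i : nval n = nval n' -> v n i = v n' i.
Proof.
move=> E; have v1 : v (none N) i = 1.
  apply: (@mulgI _ (v (none N) i)); rewrite mulg1.
  by apply: rel_vv R _ _ _ _ _; rewrite nval1 mulg1.
by rewrite -[LHS]mulg1 -v1; apply: rel_vv R _ _ _ _ _; rewrite nval1 mulg1.
Qed.

End AbelianQuotient.

Section Core.
Variables (M : automaton) (N : nucleus M).
Local Notation e := (deg M).
Local Notation gx := (None : gen N).
Local Notation gs := (Some None : gen N).
Local Notation gn n := (Some (Some n) : gen N).
Variables (L : groupType) (a : gen N -> nat -> L) (t : L).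
Hypothesis R : relations a t.
Hypothesis gen_all : forall z, gen_by (fun y => y = t \/ exists c i, y = a c i) z.
Variable p : L -> bij (seq nat).
Hypothesis pM : {morph p : y z / y * z}.
Hypothesis pa : forall c i, p (a c i) = ab c i.
Hypothesis pt : p t = tb M.
Hypothesis p_inj : forall z, (forall u, p z u = u) -> z = 1.
Local Notation x := (a gx).
Local Notation s := (a gs).
Local Notation v n := (a (gn n)).

(** * The normal closure of a 3-cycle and its finite quotient *)

Definition cycle_conj y := exists k, y = (s 1 * s 2) ^ k.

Definition cycle_group := gen_by cycle_conj.

Lemma cycle_group_conj z k : cycle_group z -> cycle_group (z ^ k).
Proof.
elim=> {z} [|y z [j ->] _ IH|y z [j ->] _ IH]; first by rewrite conj1g; apply: gen_one.
  rewrite (conjMg (_ ^ j)) -conjgM; apply: gen_mul IH; apply: gen_in.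
  by exists (j * k).
rewrite (conjMg (_ ^ j)^-1) conjVg -conjgM; apply: gen_mul IH; apply/gen_inv/gen_in.
by exists (j * k).
Qed.

Lemma cycle_group_quotient : exists (Q : groupType) (q : L -> Q),
  [/\ forall y, exists z, q z = y, {morph q : y z / y * z}
    & forall z, q z = 1 <-> cycle_group z].
Proof.
have [||||||||||Q [q [qs qE q1 qM _]]] :=
  @quotient_group L (fun y z => cycle_group (y^-1 * z)) 1
    (fun y z => y * z) (fun y => y^-1).
- by move=> y; rewrite mulVg; apply: gen_one.
- by move=> y z /gen_inv; rewrite invgM invgK.
- by move=> y z w h1 h2; have := gen_mul h1 h2; rewrite mulgA mulgK.
- move=> y y' z z' h1 h2.
  have -> : (y * z)^-1 * (y' * z') = (y^-1 * y') ^ z * (z^-1 * z').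
    by rewrite conjgE invgM !mulgA mulgK.
  by apply: gen_mul h2; apply: cycle_group_conj.
- move=> y y' h; rewrite invgK; have -> : y * y'^-1 = ((y^-1 * y') ^ y^-1)^-1.
    by rewrite conjgE invgK !mulgA mulgV mul1g invgM invgK.
  by apply/gen_inv/cycle_group_conj.
- by move=> y z w /=; rewrite (mulgA y) mulVg; apply: gen_one.
- by move=> y /=; rewrite mul1g mulVg; apply: gen_one.
- by move=> y /=; rewrite mulg1 mulVg; apply: gen_one.
- by move=> y /=; rewrite mulVg invg1 mulg1; apply: gen_one.
- by move=> y /=; rewrite mulgV invg1 mulg1; apply: gen_one.
exists Q, q; split=> // z; rewrite -q1.
split=> [/esym/qE|h]; first by rewrite invg1 mul1g.
by apply/esym/qE; rewrite invg1 mul1g.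
Qed.

Lemma prod_delta (Q : groupType) (I : eqType) (r : seq I) (F : I -> Q) i :
  uniq r -> \prod_(j <- r) F j ^+ (j == i) = if i \in r then F i else 1.
Proof.
elim: r => [|j r IHr] /=; first by rewrite big_nil.
case/andP=> jr ur; rewrite big_cons IHr // inE eq_sym; case: eqP => [->|_] /=.
  by rewrite (negPf jr) mulg1.
by rewrite mul1g.
Qed.

Lemma sub_commute (Q : groupType) (S : Q -> Prop) y z :
  (forall y z, S y -> S z -> commute y z) -> gen_by S y -> gen_by S z -> commute y z.
Proof.
move=> h; have h1 y' z' : S y' -> gen_by S z' -> commute y' z'.
  move=> hy; elim=> {z'} [|z1 z' hz _ IH|z1 z' hz _ IH]; first exact: commute1.
    by apply: commuteM => //; apply: h.
  by apply: commuteM => //; apply/commuteV/h.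
move=> hy hz; elim: hy => {y} [|y1 y hy _ IH|y1 y hy _ IH].
- exact/commute_sym/commute1.
- apply/commute_sym/commuteM; apply/commute_sym => //; exact: h1.
- apply/commute_sym/commuteM; last exact/commute_sym.
  exact/commuteV/commute_sym/h1.
Qed.

Section Quotient.
Variables (Q : groupType) (q : L -> Q).
Hypothesis q_surj : forall y, exists z, q z = y.
Hypothesis qM : {morph q : y z / y * z}.
Hypothesis qT : forall z, q z = 1 <-> cycle_group z.

Let Rq : relations (fun c i => q (a c i)) (q t).
Proof. exact: relations_morph. Qed.

Let cycle_q : q (s 1) * q (s 2) = 1.
Proof. by rewrite -qM; apply/qT/gen_in; exists 1; rewrite conjg1. Qed.

Lemma q_s i : q (s i) = 1. Proof. exact: (quotient_s Rq cycle_q). Qed.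
Lemma q_x i : q (x i) = 1. Proof. exact: (quotient_x Rq cycle_q). Qed.
Lemma q_t : q t = 1. Proof. exact: (quotient_t Rq cycle_q). Qed.
Lemma q_v n i : q (v n i) = q (v n 0).
Proof. exact: (quotient_v Rq cycle_q). Qed.

Local Notation u n := (q (v n 0)).

Lemma q_gen y : gen_by (fun y => exists n, y = u n) y.
Proof.
have [z <-] := q_surj y; elim: (gen_all z) => {y z} [|y z hy _ IH|y z hy _ IH].
- by rewrite (morph1g qM); apply: gen_one.
- rewrite qM; case: hy => [->|[c [i ->]]]; first by rewrite q_t mul1g.
  case: c => [[n|]|]; rewrite ?q_s ?q_x ?mul1g // q_v.
  by apply: gen_cons => //; exists n.
- rewrite qM (morphVg qM); case: hy => [->|[c [i ->]]]; first by rewrite q_t invg1 mul1g.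
  case: c => [[n|]|]; rewrite ?q_s ?q_x ?invg1 ?mul1g // q_v.
  by apply: gen_consV => //; exists n.
Qed.

Lemma q_commute (y z : Q) : commute y z.
Proof.
apply: sub_commute (q_gen y) (q_gen z) => _ _ [n ->] [n' ->].
exact: (quotient_v_commute Rq cycle_q).
Qed.

(* Doubling the alphabet makes every class a square of a product of classes,
   which forces torsion. *)
Section Doubled.
Variables (d : nat) (deg_double : e = (2 * d).+1).
Hypothesis sec_double : forall (g : M) k, k < d -> sec g (d + k)%N = sec g k.
Hypothesis sec_pad : forall g : M, sec g (2 * d)%N = 1.

Lemma q_square n : u n = (\prod_(n' <- [seq nsec n k | k <- iota 0 d]) u n') ^+ 2.
Proof.
have -> := quotient_v_sections Rq cycle_q n.
have e1 y : nval y = 1 -> u y = 1.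
  rewrite -(nval1 N) => /(eq_label_class Rq 0) ->.
  by have := @v_none _ _ _ _ _ Rq 0.
rewrite /= big_cons /= e1 ?nval1 // mul1g (iotaDl 1 0) big_map deg_double.
rewrite -addn1 mul2n -addnn !iotaD !big_cat big_seq1 /= !add0n.
rewrite [X in _ * X]e1; last by rewrite nval_sec addnn -mul2n sec_pad.
rewrite mulg1 expg2 !big_map; congr (_ * _).
have -> : iota d d = map (addn d) (iota 0 d) by rewrite -iotaDl addn0.
rewrite big_map big_seq [RHS]big_seq.
apply: eq_bigr => k; rewrite mem_iota => /andP[_ kd].
by apply: (eq_label_class Rq 0); rewrite !nval_sec sec_double.
Qed.

Lemma q_torsion : exists2 m, 0 < m & forall y : Q, y ^+ m = 1.
Proof.
have [m m0 hm] := square_torsion q_commute q_square; exists m => // y.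
elim: (q_gen y) => {y} [|_ y [n ->] _ IH|_ y [n ->] _ IH]; first exact: expg1n.
  by rewrite expgMn ?hm ?mul1g //; apply: q_commute.
by rewrite expgMn ?IH ?expVgn ?hm ?invg1 ?mul1g //; apply: q_commute.
Qed.

Lemma q_finite : exists r : seq Q, forall y, y \in r.
Proof.
have [m m0 hm] := q_torsion.
pose f (k : {ffun N -> 'I_m}) := \prod_(n <- enum N) u n ^+ k n.
exists (codom f) => y.
suff [k ->] : exists k : N -> nat, y = \prod_(n <- enum N) u n ^+ k n.
  apply/codomP; exists [ffun n => Ordinal (ltn_pmod (k n) m0)].
  apply: eq_bigr => n _; rewrite ffunE /= {1}(divn_eq (k n) m) mulnC.
  by rewrite expgnDr expgnA hm expg1n mul1g.
have step n k : exists k', u n * \prod_(n <- enum N) u n ^+ k n =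
    \prod_(n <- enum N) u n ^+ k' n.
  exists (fun n' => (n' == n) + k n')%N; under [RHS]eq_bigr do rewrite expgnDr.
  rewrite prodgM_commute; last by move=> *; apply: q_commute.
  by rewrite prod_delta ?enum_uniq // mem_enum.
elim: (q_gen y) => {y} [|_ y [n ->] _ [k ->]|_ y [n ->] _ [k ->]].
- by exists (fun=> 0%N); rewrite big1_seq.
- by have [k' ->] := step n k; exists k'.
have -> : (u n)^-1 = u n ^+ m.-1.
  by apply: mulg1_eq; rewrite -expgS prednK ?hm.
elim: (m.-1) => [|m' [k1 IH]]; first by exists k; rewrite mul1g.
by have [k' E] := step n k1; exists k'; rewrite expgS -mulgA IH.
Qed.

End Doubled.

(* Hence conjugates of the basic 3-cycle under the whole group are conjugates
   under [cycle_group]. *)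
Lemma q_lift y : exists2 c, commute c (s 1 * s 2) & q c = y.
Proof.
(* The 3-cycle moves the strands 1, 2 and 3; a label on strand 4 has the same class as on strand 0
   and commutes with it. *)
have vc n : commute (v n 4) (s 1 * s 2).
  by apply: commuteM; apply/commute_sym/(rel_scomm R).
elim: (q_gen y) => {y} [|_ y [n ->] _ [c hc <-]|_ y [n ->] _ [c hc <-]].
- by exists 1; [apply/commute_sym/commute1 | apply: morph1g].
- exists (v n 4 * c); last by rewrite qM q_v.
  by apply/commute_sym/commuteM; apply/commute_sym.
- exists ((v n 4)^-1 * c); last by rewrite qM (morphVg qM) q_v.
  by apply/commute_sym/commuteM; [apply: commuteV|]; apply/commute_sym.
Qed.

End Quotient.

(** The strands of large index after [w] accumulate at the point [w]. The condition says that they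
    are carried to the strands after [f w] by a translation of the index, with their contents
    unchanged. *)
Definition germ (f : seq nat -> seq nat) := forall w : seq nat, exists i0 b,
  forall i w', f (w ++ (i + i0)%N :: w') = f w ++ (i + b)%N :: w'.

Lemma germ_comp f g : germ f -> germ g -> germ (f \o g).
Proof.
move=> hf hg w; have [i1 [b1 h1]] := hg w; have [i2 [b2 h2]] := hf (g w).
exists (i2 + i1)%N, (b1 + b2)%N => i w' /=; rewrite addnA h1.
by rewrite addnAC h2 addnA.
Qed.

Lemma germ_inv (h : bij (seq nat)) : germ h -> germ (bij_fun (h^-1)).
Proof.
move=> hh w; have [i0 [b E]] := hh (h^-1 w); exists b, i0 => i w'.
by rewrite -{1}(bijKV h w) -E bijVK.
Qed.

Lemma app_cat (g : M) w i w' : e <= i -> app g (w ++ i :: w') = app g w ++ i :: w'.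
Proof.
move=> ei; elim: w g => [|j w IHw] g /=; last by rewrite IHw.
by rewrite act_out ?sec_out ?app1.
Qed.

Lemma germ_subcone y : germ (subcone M y).
Proof.
case: y => [|y] w; last by exists 0%N, 0%N => i w'; rewrite addn0.
case: w => [|j w]; first by exists 0%N, e => i w'; rewrite addn0.
by exists 0%N, 0%N => i w'; rewrite addn0.
Qed.

Lemma germ_cons f k : germ f -> germ (fun w => k :: f w).
Proof. by move=> hf w; have [i0 [b E]] := hf w; exists i0, b => i w'; rewrite E. Qed.

Lemma germ_ab c i : germ (@ab M N c i).
Proof.
move=> w; case: w => [|j w].
  rewrite ab_nil; case: c => [[n|]|].
  - by exists i.+1, i.+1 => k w' /=; rewrite ifN //; lia.
  - exists i.+2, i.+2 => k w' /=; congr (_ :: _); rewrite /swp.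
    by do ?case: ifP; lia.
  - exists (i + e).+1, i.+1 => k w' /=; rewrite ifN ?ifN; [|lia|lia].
    by congr (_ :: _); lia.
case: c => [[n|]|] /=.
- case: (j == i); last by exists 0%N, 0%N.
  by exists e, e => k w'; rewrite app_cat ?leq_addl.
- by exists 0%N, 0%N.
case: ltnP => ji; first by exists 0%N, 0%N.
case: leqP => jie; last by exists 0%N, 0%N.
exact: germ_cons (@germ_subcone (j - i)) w.
Qed.

Lemma germ_tb : germ (tb M).
Proof.
have e4 := deg_gt4 M; case=> [|j w].
  exists e, 0%N => k w' /=; rewrite ifN ?ifN; [|lia|lia].
  by rewrite addnK addn0.
rewrite /=; case: (j == 0%N); first exact: (@germ_subcone 0 w).
by case: (j < e); exists 0%N, 0%N.
Qed.

Lemma germ_p z : germ (p z).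
Proof.
have base y : y = t \/ (exists c i, y = a c i) -> germ (p y).
  by case=> [->|[c [i ->]]]; rewrite ?pt ?pa; [apply: germ_tb | apply: germ_ab].
elim: (gen_all z) => {z} [|y z hy _ IH|y z hy _ IH].
- by rewrite (morph1g pM) => w; exists 0%N, 0%N.
- by rewrite pM; apply: germ_comp IH; apply: base.
- by rewrite pM (morphVg pM); apply: germ_comp IH; apply/germ_inv/base.
Qed.

Lemma p_transitive (w : seq nat) : exists z, p z [::] = w.
Proof.
have e4 := deg_gt4 M.
have [r] : exists r, size w <= r by exists (size w).
elim: r w => [|r IHr] [|j w] // hw; try by exists 1; rewrite (morph1g pM).
case: w hw => [|i w] hw.
  elim: j {hw} => [|j [z E]]; first by exists t; rewrite pt.
  exists (s j * z); rewrite pM bijM E pa /=; congr [:: _].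
  by rewrite /swp eqxx.
have [m] : exists m, i <= m by exists i.
elim: m i hw => [|m IHm] i hw im.
  have [z E] := IHr ((j + i.+1)%N :: w) hw; exists (x j * z).
  by rewrite pM bijM E pa [ab _ _ _]xb_mid //; lia.
case: (ltnP i e) => ie.
  have [z E] := IHr ((j + i.+1)%N :: w) hw; exists (x j * z).
  by rewrite pM bijM E pa [ab _ _ _]xb_mid.
have [||z E] := IHm (i - e)%N; [by [] | lia |].
exists (x j * z); rewrite pM bijM E pa.
transitivity (xb M j ((j + 0)%N :: (i - e)%N :: w)); first by rewrite addn0.
by rewrite xb_mid //=; congr [:: _, _ & _]; lia.
Qed.

Lemma p_eq y z : (forall u, p y u = p z u) -> y = z.
Proof.
move=> h; apply: (@mulgI _ z^-1); rewrite mulVg; apply: p_inj => u.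
by rewrite pM bijM h (morphVg pM) bijVK.
Qed.

Definition off (S : nat -> bool) (h : seq nat -> seq nat) :=
  forall u, ~~ (if u is j :: _ then S j else false) -> h u = u.

(** Since [n] carries the strands of [S] off [S], the conjugate of [y] is the identity on [S], while
    [z] is the identity off [S]. *)
Lemma disjoint_commute (S : nat -> bool) (n y z : L) :
  (forall j w, S j -> exists j' w', p n (j :: w) = j' :: w' /\ ~~ S j') ->
  off S (p y) -> off S (p z) -> commute (n * y * n^-1) z.
Proof.
pose inS u := if u is j :: _ then S j else false => hn hy hz.
have nS u : inS u -> ~~ inS (p n u).
  by case: u => // j w /= /(hn j w)[j' [w' [-> ?]]].
have stable y' : off S (p y') -> forall u, inS (p y' u) = inS u.
  move=> hy' u; apply/idP/idP => h; last first.
    apply/negPn/negP => h1; have := hy' _ h1.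
    by move/(can_inj (bij_funK (p y'))) => E; rewrite E h in h1.
  by apply/negPn/negP => h1; rewrite (hy' _ h1) (negPf h1) in h.
have conj_fix u : inS u -> p (n * y * n^-1) u = u.
  move=> hu; rewrite !pM (morphVg pM) !bijM hy ?bijKV //.
  by apply/negP => /nS; rewrite bijKV hu.
apply: p_eq => w.
rewrite (pM (n * y * n^-1)) (pM z) !bijM; case hw: (inS w); first by rewrite !conj_fix // stable.
rewrite (hz w); last by rewrite -/(inS w) hw.
rewrite hz // -/(inS _) !pM (morphVg pM) !bijM.
case h: (inS ((p n)^-1 w)); first by apply: nS; rewrite stable.
by rewrite hy ?bijKV ?hw // -/(inS _) h.
Qed.

Lemma off_sprod (S : nat -> bool) l : (forall j, ~~ S j -> hswp l j = j) ->
  off S (p (sprod a l)).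
Proof.
by move=> h u hu; rewrite (p_sprod pM pa); case: u hu => //= j u /h ->.
Qed.

(** * Simplicity of the group generated by the 3-cycles *)

Section Simplicity.
Variables (Q : groupType) (q : L -> Q).
Hypothesis q_surj : forall y, exists z, q z = y.
Hypothesis qM : {morph q : y z / y * z}.
Hypothesis qT : forall z, q z = 1 <-> cycle_group z.

Let cycle_group_sprod l : cycle_group (sprod a l).
Proof.
apply/qT; rewrite /sprod (morph_prodg qM) big1_seq // => i _.
exact: q_s qM qT i.
Qed.

Lemma three_cycle_in (P : set L) n : subgroup P ->
  (forall y z, P y -> cycle_group z -> P (y ^ z)) -> P n ->
  (forall j w, 0 < j < 6 -> exists j' w', p n (j :: w) = j' :: w' /\ ~~ (0 < j' < 6)) ->
  exists k, P ((s 1 * s 2) ^ k).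
Proof.
(* With [y] and [z] the 3-cycles on strands 1, 2, 3 and 3, 4, 5, the conjugate of
   [y] by [n] commutes with both, so [P] contains [y^-1 * z * y * z^-1], which
   is again a 3-cycle. *)
case=> P1 PM PV PT Pn hn; exists (sprod a [:: 2; 3; 2; 1]%N).
pose y := sprod a [:: 1; 2]%N; pose z := sprod a [:: 3; 4]%N.
have offE l : all (fun j => 0 < j < 5) l -> off (fun j => 0 < j < 6) (p (sprod a l)).
  move=> hl; apply: off_sprod => j; elim: l hl => //= i l IHl /andP[hi /IHl hl] hj.
  by rewrite hl //; rewrite /swp; do ?case: ifP; lia.
have cy : commute (n * y * n^-1) y by apply: disjoint_commute hn _ _; apply: offE.
have cz : commute (n * y * n^-1) z by apply: disjoint_commute hn _ _; apply: offE.
pose c1 := n * y * n^-1 * y^-1.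
have Pc1 : P c1.
  rewrite /c1 -!mulgA; apply: PM => //; rewrite mulgA.
  have := PT _ _ (PV _ Pn) (gen_inv (cycle_group_sprod [:: 1; 2]%N)).
  by rewrite conjgE invgK mulgA.
have Pc2 : P (c1 * (z * c1^-1 * z^-1)).
  apply: PM => //; have := PT _ _ (PV _ Pc1) (gen_inv (cycle_group_sprod [:: 3; 4]%N)).
  by rewrite conjgE invgK mulgA.
suff -> : (s 1 * s 2) ^ sprod a [:: 2; 3; 2; 1]%N = c1 * (z * c1^-1 * z^-1) by [].
transitivity (y^-1 * z * y * z^-1); last first.
  rewrite /c1; move: (n * y * n^-1) cy cz => y' cy cz.
  have cw : commute y' (y^-1 * z * y).
    by apply: commuteM => //; apply: commuteM => //; apply: commuteV.
  by rewrite invgM invgK !mulgA -(mulgA y') -(mulgA y') cw mulgK.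
have -> : s 1 * s 2 = sprod a [:: 1; 2]%N by rewrite (sprod_cons a) (sprod1 a).
rewrite conjgE -!(sprod_rev R) -!(sprod_cat a); apply: (sprod_eq R pM pa).
by case=> [|[|[|[|[|[|j]]]]]].
Qed.

Lemma cycle_group_generated (P : set L) k : (forall y z, P y -> cycle_group z -> P (y ^ z)) ->
  subgroup P -> P ((s 1 * s 2) ^ k) -> forall z, cycle_group z -> P z.
Proof.
move=> PT PS Pk z; apply: gen_subgroup PS _ => _ [k' ->].
(* The class of [k' * k^-1] in the quotient is absorbed by an element [c] commuting with the
   3-cycle, so the two conjugates differ by an element of [cycle_group]. *)
have [c cc cE] := q_lift q_surj qM qT (q (k' * k^-1)).
have -> : (s 1 * s 2) ^ k' = ((s 1 * s 2) ^ k) ^ ((c^-1 * (k' * k^-1)) ^ k).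
  have {1}-> : s 1 * s 2 = (s 1 * s 2) ^ c^-1.
    by rewrite conjgE invgK mulgA cc mulgK.
  rewrite -!conjgM; congr (_ ^ _); rewrite conjgE mulVKg.
  by rewrite -mulgA mulgVK.
apply: PT => //; apply/cycle_group_conj/qT.
by rewrite qM (morphVg qM) cE mulVg.
Qed.

Theorem cycle_group_simple (P : set L) n : subgroup P ->
  (forall y z, P y -> cycle_group z -> P (y ^ z)) -> P n -> n <> 1 -> cycle_group `<=` P.
Proof.
move=> PS PT Pn n1 z Tz; have [P1 PM PV] := PS.
have [w hw] : exists w, p n w <> w.
  apply: contrapT => h; apply: n1; apply: p_inj => w.
  by apply: contrapT => hw; apply: h; exists w.
(* By transitivity a moved point becomes infinity, so the conjugate of [n] carries the strands near
   infinity close to another point, inside one strand [j]. *)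
have [z1 z1E] := p_transitive w.
have n1E : p (n ^ z1) [::] <> [::].
  by rewrite conjgE !pM (morphVg pM) !bijM z1E => E; apply: hw; rewrite -[LHS](bijKV (p z1)) E z1E.
case E1 : (p (n ^ z1) [::]) n1E => [//|j v0] _.
have [i0 [b gE]] := germ_p (n ^ z1) [::].
have e4 := deg_gt4 M.
(* Conjugating also by a power of [x 0] moves the strands 1 to 5 out to [k + m * e]. The choice of
   [m] puts these indices beyond [i0], where the germ formula holds, and beyond [j]. *)
pose m := (i0 + j).+1; pose h := z1 * (x 0) ^- m.
have me : (i0 + j).+1 <= m * e by rewrite leq_pmulr //; lia.
have x0V k u : 0 < k -> p ((x 0) ^- m) (k :: u) = (k + m * e)%N :: u.
  move=> k0; rewrite -expVgn; elim: (m) => [|m' IHm]; first by rewrite p1 // addn0.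
  rewrite expgS pM bijM IHm (morphVg pM) pa; apply: (can_inj (bij_funK (xb M 0))).
  rewrite bijKV xb_gt; last lia.
  by congr (_ :: _); lia.
have x0nil : p ((x 0) ^- m) [::] = [::].
  rewrite -expVgn; elim: (m) => [|m' IHm]; first by rewrite p1.
  by rewrite expgS pM bijM IHm (morphVg pM) -{1}(ab_nil gx 0) pa bijVK.
(* [three_cycle_in] speaks of the fixed strands 1 to 5, so it is applied to the conjugate of [P] by
   [h]; as [cycle_group] is normal, the conclusion is transported back at the end. *)
have PhS : subgroup (fun y => P (y ^ h^-1)).
  split=> [|y y' hy hy'|y hy]; rewrite ?conj1g ?conjMg ?conjVg; auto.
have PhT y y' : P (y ^ h^-1) -> cycle_group y' -> P ((y ^ y') ^ h^-1).
  by move=> hy hy'; rewrite conjJg; apply: PT => //; apply: cycle_group_conj.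
have [||k hk] := three_cycle_in PhS PhT (n := n ^ h).
- by rewrite -conjgM mulgV conjg1.
- move=> k u /andP[k0 k6].
  have E : p (n ^ z1) ((k + m * e)%N :: u) = j :: v0 ++ (k + m * e - i0 + b)%N :: u.
    rewrite -[RHS]/((j :: v0) ++ _) -E1 -gE /=; congr (p _ (_ :: _)).
    by lia.
  have {}E : p ((x 0) ^- m) (p (n ^ h) (k :: u)) =
      j :: v0 ++ (k + m * e - i0 + b)%N :: u.
    rewrite -E -bijM -pM /h conjgM conjgE invgK mulKg pM bijM x0V //.
  case: (p (n ^ h) (k :: u)) E => [|j' u'].
    by rewrite x0nil.
  (* Strand 0 lies outside the window from 1 to 5. From a positive strand [j'] one would land on
     [j' + m * e], which exceeds [j]. *)
  case: (posnP j') => [-> _|j'0]; first by exists 0%N, u'.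
  rewrite x0V // => -[j'E _]; exists j', u'; split=> //.
  by lia.
by have := cycle_group_generated PhT PhS hk (cycle_group_conj h Tz); rewrite conjgK.
Qed.

End Simplicity.
End Core.

(** * Embedding an automaton group *)

Lemma subgroup_type (L : groupType) (H : set L) : subgroup H ->
  exists (K : groupType) (f : K -> L),
    [/\ {morph f : y z / y * z}, injective f & forall z, H z <-> exists k, f k = z].
Proof.
case=> H1 HM HV; pose T := {z | H z}.
pose one : T := exist _ 1 H1.
pose mu (y z : T) : T := exist _ (sval y * sval z) (HM _ _ (svalP y) (svalP z)).
pose iv (y : T) : T := exist _ (sval y)^-1 (HV _ (svalP y)).
have inj (y z : T) : sval y = sval z -> y = z by case: y z => [y hy] [z hz] /= E; apply: eq_exist.
pose C : choiceType := HB.pack T (gen_eqMixin T) (gen_choiceMixin T).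
have muA : @associative C mu by move=> y z w; apply: inj; apply: mulgA.
have mu1l : @left_id C C one mu by move=> y; apply: inj; apply: mul1g.
have mu1r : @right_id C C one mu by move=> y; apply: inj; apply: mulg1.
have muVl : @left_inverse C C C one iv mu by move=> y; apply: inj; apply: mulVg.
have muVr : @right_inverse C C C one iv mu by move=> y; apply: inj; apply: mulgV.
pose K : groupType := HB.pack C (isGroup.Build C muA mu1l mu1r muVl muVr).
exists K, (fun y : K => sval (y : T)); split=> //.
move=> z; split=> [hz|[y <-]]; last exact: svalP.
by exists (exist _ z hz : T).
Qed.

Section Embedding.
Variables (M : automaton) (N : nucleus M).
Local Notation e := (deg M).
Local Notation gx := (None : gen N).
Local Notation gs := (Some None : gen N).
Local Notation gn n := (Some (Some n) : gen N).
Variables (d : nat) (deg_double : e = (2 * d).+1).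
Hypothesis sec_double : forall (g : M) k, k < d -> sec g (d + k)%N = sec g k.
Hypothesis sec_pad : forall g : M, sec g (2 * d)%N = 1.
Hypothesis contract : exists k, forall n n' : N, deep N k (nval n * nval n').
Hypothesis faithful : forall g : M, (forall u, app g u = u) -> g = 1.

Section Labels.
Variables (L : groupType) (a : gen N -> nat -> L).
Variable p : L -> bij (seq nat).
Hypothesis pM : {morph p : y z / y * z}.
Hypothesis pa : forall c i, p (a c i) = ab c i.

Lemma label_exists k g i : deep N k g -> exists z, p z = nb g i.
Proof.
elim: k g i => [|k IHk] g i /=; first by case=> n <-; exists (a (gn n) i).
move=> hg; have [|||l lE _] := @hswp_exists e.+1 (act' g) (act' g^-1).
- exact: act'K.
- by move=> y; rewrite -act'M mulgV act'1.
- exact: act'_out.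
have hs y j : exists z, p z = nb (sec' g y) j.
  by apply: IHk; case: y => [|y]; [apply: deep1 | apply: hg].
have [f fE] := choice (fun y => hs y (i + y)%N).
(* This is [nb_split] solved for the label: pass to the children of strand [i], act there by labels
   of smaller depth, and return. *)
exists (a gx i * sprod a (map (addn i) l) * \prod_(y <- iota 0 e.+1) f y * (a gx i)^-1).
apply: (@mulIg _ (p (a gx i))); rewrite -pM mulgVK pa (nb_split N i lE) !pM pa.
congr (_ * _ * _).
  by rewrite /sprod (morph_prodg pM); apply: eq_bigr => j _; rewrite pa.
by rewrite (morph_prodg pM); apply: eq_bigr => y _; rewrite fE.
Qed.

End Labels.

Definition diagonal m (g : M) (u : seq nat) : seq nat :=
  if u is j :: w then j :: (if j < m then app g w else w) else [::].

Theorem automaton_embedding (G : set M) : (forall g, G g -> exists k, deep N k g) ->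
  subgroup G ->
  exists K : groupType,
    [/\ finitely_presented K,
        simple_group K
      & exists f : M -> K,
          (forall g h, G g -> G h -> f (g * h) = f g * f h) /\
          (forall g h, G g -> G h -> f g = f h -> g = h)].
Proof.
move=> Gdeep [_ GM _].
have [L [y yP]] := presented_group (relators N).
have [ygen yrel _] := yP.
have R : relations (family y) (y None).
  apply: relations_of_upto; last by move=> *; apply: family_shift.
  exact: (relators_upto (@gval_family _ _ _ y)).
have [p pM py] := presents_lift yP (@relators_pb M N).
have pa c i : p (family y c i) = ab c i.
  rewrite -gval_family gval_morph // -(family_pb c i) -gval_family.
  by apply: eq_gval => l /=; rewrite py.
have pt : p (y None) = tb M by apply: py.
have gen_all z : gen_by (fun g => g = y None \/ exists c i, g = family y c i) z.
  have gy l : gen_by (fun g => g = y None \/ exists c i, g = family y c i) (y l).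
    apply: gen_in; case: l => [[c r]|]; last by left.
    right; exists c, r; rewrite family_small ?inord_val //.
    by rewrite -ltnS.
  have [w <-] := ygen z; rewrite /gval; apply: gen_prod => -[l []]; last exact: gy.
  exact/gen_inv/gy.
have p_inj := relations_faithful R pM pa pt contract faithful gen_all.
have [Q [q [q_surj qM qT]]] := cycle_group_quotient (family y).
have [m m0 hm] := q_torsion R gen_all q_surj qM qT deg_double sec_double sec_pad.
have [r hr] := q_finite R gen_all q_surj qM qT deg_double sec_double sec_pad.
have TS : subgroup (cycle_group (family y)).
  by split; [apply: gen_one | move=> *; apply: gen_mul | move=> *; apply: gen_inv].
have [K [v [vM v_inj vT]]] := subgroup_type TS.
exists K; split.
- pose J : finType := seq_sub r; pose k z : J := SeqSub (hr (q z)).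
  have [t0 t0E] := choice (fun j : J => q_surj (ssval j)).
  (* The coset of the subgroup has to be represented by 1, as the rewriting process requires. *)
  pose tt j := if j == k 1 then 1 else t0 j.
  have qtt j : q (tt j) = ssval j by rewrite /tt; case: eqP => // ->.
  apply: (@finite_index_finitely_presented _ _ _ _ yP K v vM v_inj J (k 1) tt k).
  + by rewrite /tt eqxx.
  + by move=> j; apply/val_inj; rewrite /= qtt.
  + move=> g h; split=> [/(congr1 val) /= E|[b ->]].
      have /vT[b bE] : cycle_group (family y) (g^-1 * h) by apply/qT; rewrite qM (morphVg qM) E mulVg.
      by exists b; rewrite bE mulVKg.
    apply/val_inj; rewrite /= qM; have /qT -> : cycle_group (family y) (v b) by apply/vT; exists b.
    by rewrite mulg1.
- split.
    have /vT[c cE] : cycle_group (family y) (family y (Some None) 1 * family y (Some None) 2).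
      by apply: gen_in; exists 1; rewrite conjg1.
    exists c => c1; move: cE; rewrite c1 (morph1g vM) => /esym.
    move/(congr1 (fun z => p z [:: 1%N])).
    by rewrite pM bijM !pa (morph1g pM).
  move=> P [P1 PM PV] PJ; have [[c [Pc c1]]|h] := pselect (exists c, P c /\ c <> 1).
    right; apply/seteqP; split=> // c' _.
    pose P' z := exists2 k, P k & v k = z.
    have P'S : subgroup P'.
      split; first by exists 1; rewrite ?(morph1g vM).
        by move=> _ _ [k1 h1 <-] [k2 h2 <-]; exists (k1 * k2); rewrite ?vM //; apply: PM.
      by move=> _ [k1 h1 <-]; exists k1^-1; rewrite ?(morphVg vM) //; apply: PV.
    have P'J z w : P' z -> cycle_group (family y) w -> P' (z ^ w).
      move=> [k1 h1 <-] /vT[k2 <-]; exists (k1 ^ k2); first exact: PJ.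
      by rewrite !conjgE !vM (morphVg vM).
    have vc1 : v c <> 1 by rewrite -(morph1g vM) => /v_inj.
    have P'c : P' (v c) by exists c.
    have Tc' : cycle_group (family y) (v c') by apply/vT; exists c'.
    by have [k1 hk /v_inj <-] := cycle_group_simple R gen_all pM pa pt p_inj q_surj qM qT
      P'S P'J P'c vc1 Tc'.
  left; apply/seteqP; split=> [c Pc|_ ->] //=.
  by apply: contrapT => c1; apply: h; exists c.
have label g i : exists z, G g -> p z = nb g i.
  case: (pselect (G g)) => [hg|hg]; last by exists 1.
  by have [k /(label_exists pM pa i)[z <-]] := Gdeep g hg; exists z.
have [f fE] := choice (fun gi => label gi.1 gi.2).
pose D g := \prod_(i <- iota 0 m) f (g, i).
have DE g u : G g -> p (D g) u = diagonal m g u.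
  move=> hg; rewrite /D (morph_prodg pM).
  have -> : \prod_(i <- iota 0 m) p (f (g, i)) = \prod_(i <- iota 0 m) nb g (0 + i)%N.
    by apply: eq_bigr => i _; rewrite (fE (g, i)).
  by rewrite (nb_prod (fun=> g)); case: u.
have DT g : G g -> cycle_group (family y) (D g).
  (* Moving a label to the next strand is conjugation by a swap, which is trivial in the quotient.
     So the class of [D g] is an [m]-th power, hence 1. *)
  move=> hg; have step i : q (f (g, i.+1)) = q (f (g, i)).
    have -> : f (g, i.+1) = family y (Some None) i * f (g, i) * family y (Some None) i.
      apply: (p_eq pM p_inj) => u; rewrite pM bijM (pM (family y _ i)) bijM !pa !(fE (g, _)) //.
      have n1 : (i.+1 == i) = false by lia.
      have n2 : (i == i.+1) = false by lia.
      case: u => //= j w; rewrite /swp; case: (eqVneq j i) => [->|ji].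
        by rewrite n1 n2 eqxx.
      case: (eqVneq j i.+1) => [->|ji']; first by rewrite !eqxx.
      by rewrite (negPf ji) (negPf ji').
    rewrite (qM (family y gs i * f (g, i))) (qM (family y gs i)).
    by rewrite (q_s R qM qT) mul1g mulg1.
  apply/qT; rewrite /D (morph_prodg qM) -[RHS](hm (q (f (g, 0%N)))).
  have -> : \prod_(i <- iota 0 m) q (f (g, i)) = \prod_(0 <= i < m) q (f (g, 0%N)).
    rewrite /index_iota subn0; apply: eq_bigr => i _.
    by elim: i => // i <-; apply: step.
  by rewrite prodg_const_nat subn0.
have vD g : exists k, G g -> v k = D g.
  case: (pselect (G g)) => [/DT/vT[k kE]|hg]; last by exists 1.
  by exists k.
have [F FE] := choice vD; exists F; split=> g h hg hh.
  apply: v_inj; rewrite vM !FE //; last exact: GM.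
  apply: (p_eq pM p_inj) => u; rewrite pM bijM !DE //; last exact: GM.
  by case: u => //= j w; congr (_ :: _); case: ifP; rewrite ?appM.
move=> /(congr1 v); rewrite !FE // => E.
(* As [m] is positive, strand 0 carries the label, and reading it off there recovers the group
   element. *)
apply: (@mulgI _ h^-1); rewrite mulVg; apply: faithful => u; rewrite appM.
have := congr1 (fun z => p z (0%N :: u)) E; rewrite !DE //= m0 => -[->].
exact: appK.
Qed.

End Embedding.

(** * Groups of tree automorphisms *)

Section TreeAutomaton.
Variable d : nat.
Hypothesis d2 : 2 <= d.
Implicit Types (g h : tree_aut d) (x : 'I_d) (v w : vertex d).

Lemma root_letter_exists g x : exists y, g [:: x] = [:: y].
Proof.
have [y E] : child (g [::]) (g [:: x]) by apply/aut_child; exists x.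
by exists y; rewrite E aut_root.
Qed.

Definition root_letter g x : 'I_d := projT1 (cid (root_letter_exists g x)).

Lemma root_letterE g x : g [:: x] = [:: root_letter g x].
Proof. by rewrite /root_letter; case: (cid _). Qed.

Lemma aut_cons g x v : g (x :: v) = root_letter g x :: local_action g [:: x] v.
Proof. by rewrite -cat1s local_actionE root_letterE. Qed.

Lemma root_letterM g h x : root_letter (g * h) x = root_letter g (root_letter h x).
Proof.
by have := root_letterE (g * h) x; rewrite tree_aut_mulE !root_letterE => -[].
Qed.

Lemma root_letter1 x : root_letter 1 x = x.
Proof. by have := root_letterE 1 x; rewrite tree_aut_oneE => -[]. Qed.

Lemma local_actionM g h v :
  local_action (g * h) v = local_action g (h v) * local_action h v.
Proof.
apply/esym/local_action_unique => w.
by rewrite !tree_aut_mulE !local_actionE.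
Qed.

Lemma local_action1 v : local_action (1 : tree_aut d) v = 1.
Proof. by apply/esym/local_action_unique => w; rewrite !tree_aut_oneE. Qed.

Lemma local_action_nil g : local_action g [::] = g.
Proof. by apply/esym/local_action_unique => w; rewrite aut_root. Qed.

Lemma local_action_cat g v w :
  local_action g (v ++ w) = local_action (local_action g v) w.
Proof.
by apply/esym/local_action_unique => u; rewrite -catA !local_actionE -catA.
Qed.

Lemma local_actionV g v :
  local_action g^-1 v = (local_action g (g^-1 v))^-1.
Proof.
apply: (@mulgI _ (local_action g (g^-1 v))).
by rewrite -local_actionM !mulgV local_action1.
Qed.

Definition nat_letter g i : nat :=
  if insub i is Some x then root_letter g x else i.

Definition nat_section g i : tree_aut d :=
  if insub i is Some x then local_action g [:: x] else 1.

Lemma nat_letter_ord g x : nat_letter g x = root_letter g x.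
Proof. by rewrite /nat_letter valK. Qed.

Lemma nat_section_ord g x : nat_section g x = local_action g [:: x].
Proof. by rewrite /nat_section valK. Qed.

Lemma nat_out g i : d <= i -> nat_letter g i = i /\ nat_section g i = 1.
Proof.
move=> di; rewrite /nat_letter /nat_section insubF //.
by rewrite ltnNge di.
Qed.

Lemma nat_letter_lt g i : (nat_letter g i < d) = (i < d).
Proof.
case: (ltnP i d) => id; last by rewrite (nat_out g id).1 ltnNge id.
by rewrite -[i]/(val (Ordinal id)) nat_letter_ord ltn_ord.
Qed.

Lemma nat_letterM g h i : nat_letter (g * h) i = nat_letter g (nat_letter h i).
Proof.
case: (ltnP i d) => id; last first.
  by rewrite (nat_out (g * h) id).1 (nat_out h id).1 (nat_out g id).1.
by rewrite -[i]/(val (Ordinal id)) !nat_letter_ord root_letterM.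
Qed.

Lemma nat_sectionM g h i :
  nat_section (g * h) i = nat_section g (nat_letter h i) * nat_section h i.
Proof.
case: (ltnP i d) => id; last first.
  by rewrite (nat_out (g * h) id).2 (nat_out h id).1 (nat_out h id).2
    (nat_out g id).2 mulg1.
rewrite -[i]/(val (Ordinal id)) nat_letter_ord !nat_section_ord local_actionM.
by rewrite root_letterE.
Qed.

Lemma nat_letter1 i : nat_letter 1 i = i.
Proof.
case: (ltnP i d) => id; last by rewrite (nat_out 1 id).1.
by rewrite -[i]/(val (Ordinal id)) nat_letter_ord root_letter1.
Qed.

Lemma nat_section1 i : nat_section 1 i = 1.
Proof.
case: (ltnP i d) => id; last by rewrite (nat_out 1 id).2.
by rewrite -[i]/(val (Ordinal id)) nat_section_ord local_action1.
Qed.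

(* The letters [i] and [d + i] with [i < d] are two copies of the letter [i] of
   the tree, and [2 * d] is a fixed letter that makes the degree odd. *)
Definition dbl_letter g i : nat :=
  if i < d then nat_letter g i else (d + nat_letter g (i - d))%N.

Definition dbl_section g i : tree_aut d :=
  if i < d then nat_section g i else nat_section g (i - d).

Definition doubled : automaton.
Proof.
refine (@Automaton (tree_aut d) (2 * d).+1 dbl_letter dbl_section _ _ _ _ _ _ _ _).
- lia.
- by rewrite /= mul2n odd_double.
- by move=> i; rewrite /dbl_letter !nat_letter1; case: ltnP => // /subnKC.
- by move=> i; rewrite /dbl_section !nat_section1 if_same.
- move=> g h i; rewrite /dbl_letter !nat_letterM; case: (ltnP i d) => id.
    by rewrite nat_letter_lt id.
  by rewrite ltnNge leq_addr /= addKn.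
- move=> g h i; rewrite /dbl_section /dbl_letter !nat_sectionM.
  case: (ltnP i d) => id; first by rewrite nat_letter_lt id.
  by rewrite ltnNge leq_addr /= addKn.
- move=> g i di; rewrite /dbl_letter ltnNge (leq_trans _ di) /=; last lia.
  by rewrite (nat_out g _).1; lia.
- move=> g i di; rewrite /dbl_section ltnNge (leq_trans _ di) /=; last lia.
  by rewrite (nat_out g _).2 //; lia.
Defined.

Lemma doubled_faithful (g : doubled) : (forall u, app g u = u) -> g = 1.
Proof.
have appE v h : app (h : doubled) (map val v) = map val (h v).
  elim: v h => [|x v IHv] h; first by rewrite aut_root.
  rewrite aut_cons !map_cons -IHv /= /dbl_letter /dbl_section ltn_ord.
  by rewrite nat_letter_ord nat_section_ord.
move=> h; apply: tree_aut_ext => v; apply: (inj_map val_inj).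
by rewrite -appE h.
Qed.

Section Contracting.
Variable G : set (tree_aut d).
Hypotheses (GS : subgroup G) (Gsim : self_similar G) (Gcon : contracting G).

(** The given contracting set may lack 1, sections and inverses. Adding all sections keeps it
    finite, because each of its elements has only finitely many sections outside it; sections of
    inverses are inverses of sections, so symmetrizing preserves closure under sections. *)
Lemma nucleus_exists : exists (N : nucleus doubled),
  (forall n : N, G (nval n)) /\ forall g, G g -> exists k, deep N k g.
Proof.
have [G1 GM GV] := GS; have [N0 [N0fin N0G N0con]] := Gcon.
pose S := [set h | exists n v, (N0 n \/ n = 1) /\ h = local_action n v].
have Sfin : finite_set S.
  apply: (@sub_finite_set _ _ (N0 `|` [set 1] `|`
    \bigcup_(n in N0) (local_action n @` [set v | ~ N0 (local_action n v)]))).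
    move=> _ [n [v [[hn|->] ->]]]; last by left; right; apply: local_action1.
    have [h|h] := pselect (N0 (local_action n v)); first by left; left.
    by right; exists n => //; exists v.
  rewrite !finite_setU; split; first by split=> //; apply: finite_set1.
  apply: bigcup_finite => // n hn; apply: finite_image; apply: N0con.
  exact: N0G.
have SG h : S h -> G h.
  by move=> [n [v [[hn|->] ->]]]; apply: Gsim => //; apply: N0G.
pose S2 := [set h | S h \/ S h^-1].
have S2fin : finite_set S2.
  apply: (@sub_finite_set _ _ (S `|` (fun h => h^-1) @` S)).
    by move=> h [hS|hS]; [left | right; exists h^-1; rewrite ?invgK].
  by rewrite finite_setU; split=> //; apply: finite_image.
have S1 : S 1 by exists 1, [::]; split; [right | rewrite local_action1].
have S21 : S2 1 by left.
have Ssec h v : S h -> S (local_action h v).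
  by move=> [n [u [hn ->]]]; exists n, (u ++ v); rewrite local_action_cat.
have S2sec h v : S2 h -> S2 (local_action h v).
  case=> hS; first by left; apply: Ssec.
  by right; rewrite -[h]invgK local_actionV invgK; apply: Ssec.
have S2V h : S2 h -> S2 h^-1 by case=> hS; [right; rewrite invgK | left].
have [r rE] := (@finite_seqP _ S2).1 S2fin.
have inr h : h \in r <-> S2 h by rewrite rE.
pose nv (n : seq_sub r) : doubled := ssval n.
have nvP (n : seq_sub r) : S2 (nv n) by apply/inr/ssvalP.
have sec_S2 h i : S2 h -> S2 (sec (h : doubled) i).
  move=> hS /=; rewrite /dbl_section /nat_section.
  by case: (ltnP i d) => _; case: insubP => [x _ _|_] //; apply: S2sec.
have oneP : (1 : tree_aut d) \in r by apply/inr.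
have invP (n : seq_sub r) : (nv n)^-1 \in r by apply/inr/S2V.
have secP (n : seq_sub r) i : sec (nv n) i \in r by apply/inr/sec_S2.
exists (@Nucleus doubled (seq_sub r) nv (SeqSub oneP) erefl
  (fun n => SeqSub (invP n)) (fun n => erefl)
  (fun n i => SeqSub (secP n i)) (fun n i => erefl)).
split=> [n /=|g /N0con].
  by have [/SG //|/SG/GV] := nvP n; rewrite invgK.
set N := @Nucleus _ _ _ _ _ _ _ _ _.
move=> /finite_seqP[bad badE].
have deepP k h : (forall v : vertex d, size v = k -> S2 (local_action h v)) ->
    deep N k h.
  elim: k h => [|k IHk] h hk /=.
    have /inr hr : S2 h by rewrite -(local_action_nil h); apply: hk.
    by exists (SeqSub hr).
  move=> i; apply: IHk => v sv; rewrite /dbl_section /nat_section.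
  have S2one : S2 (local_action 1 v) by rewrite local_action1.
  by case: (ltnP i d) => _; case: insubP => [x _ _|_] //;
    rewrite -local_action_cat; apply: hk; rewrite /= sv.
(* This depth exceeds the length of every word at which the section of [g] lies outside the
   contracting set. *)
exists (\max_(v <- bad) size v).+1; apply: deepP => v sv; left.
exists (local_action g v), [::]; split; last by rewrite local_action_nil.
left; apply: contrapT => hv; have : v \in bad by have : [set` bad] v by rewrite -badE.
by move=> /(leq_bigmax_seq (F := size)) /(_ isT); rewrite sv ltnn.
Qed.

End Contracting.
End TreeAutomaton.

Theorem theorem1 (d : nat) (G : set (tree_aut d)) :
  (2 <= d)%N ->
  subgroup G ->
  self_similar G ->
  contracting G ->
  exists K : groupType,
    [/\ finitely_presented K,
        simple_group K
      & exists f : tree_aut d -> K,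
          {in G &, {morph f : x y / x * y}} /\ {in G &, injective f}].
Proof.
move=> d2 GS Gsim Gcon; have [G1 GM GV] := GS.
have [N [NG Ndeep]] := nucleus_exists d2 GS Gsim Gcon.
have [|||K [Kfp Ks [f [fM f_inj]]]] :=
    @automaton_embedding (doubled d2) N d erefl _ _ _ (@doubled_faithful d d2) G Ndeep GS.
- move=> g k kd /=; rewrite /dbl_section kd ltnNge leq_addr /= addKn.
  by [].
- move=> g /=; rewrite /dbl_section ifN; last lia.
  by rewrite (nat_out g _).2 //; lia.
(* Contraction gives a depth for each product of two nucleus elements. Closure under sections makes
   [deep] monotone in the depth, so the maximum over the finitely many pairs serves all of them. *)
- have [k kE] := choice (fun nn : N * N => Ndeep _ (GM _ _ (NG nn.1) (NG nn.2))).
  have deepS j (g : doubled d2) : deep N j g -> deep N j.+1 g.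
    elim: j g => [|j IHj] g; first by case=> n <- i; exists (nsec n i); rewrite nval_sec.
    by move=> h i; apply: IHj; apply: h.
  have deep_le j1 j2 (g : doubled d2) : j1 <= j2 -> deep N j1 g -> deep N j2 g.
    by move=> /subnK <- h; elim: (j2 - j1)%N => // j; apply: deepS.
  exists (\max_nn k nn) => n n'; apply: deep_le (kE (n, n')).
  exact: (leq_bigmax (n, n')).
exists K; split=> //; exists f; split=> g h /set_mem hg /set_mem hh.
  exact: fM.
exact: f_inj.
Qed.
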